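(* Let $Z_1,\dots,Z_m$ be i.i.d. standard normal, and for given reals $c,\lambda_k,d_k,w_k$ ($k=1,\dots,m$) and $w_0$ let $Y=c+\sum_{k=1}^m(d_kZ_k+\lambda_kZ_k^2)$ and $W=w_0+\sum_{k=1}^m w_kZ_k$. Let $(W_j,Y_j)_{j=1}^n$ be i.i.d. copies of $(W,Y)$ with means $\overline W,\overline Y$. Let $v\in\mathbb R$ and let $\hat\eta$ be the solution, in the domain where all $1-2\lambda_k\eta>0$, of $\sum_{k=1}^m\frac{\lambda_k(1-2\lambda_k\eta)+d_k^2(1-\lambda_k\eta)\eta}{(1-2\lambda_k\eta)^2}=v-c$. Then as $n\to\infty$ $$\mathsf E[\overline W\mid\overline Y=v]=w_0+\sum_{k=1}^m\frac{w_kd_k}{(1-2\lambda_k\hat\eta)^3}\Big[\hat\eta(1-2\lambda_k\hat\eta)^2+\frac{\mathcal K_Y^{(3)}(\hat\eta)(1-2\lambda_k\hat\eta)-4\lambda_k\mathcal K_Y''(\hat\eta)}{2n\mathcal K_Y''(\hat\eta)^2+\frac14\mathcal K_Y^{(4)}(\hat\eta)-\frac5{12}\mathcal K_Y^{(3)}(\hat\eta)^2/\mathcal K_Y''(\hat\eta)}\Big]+O(n^{-2}),$$ and, if moreover $\hat\eta\neq0$ and $1-\alpha:=\mathsf P[\overline Y\ge v]$, $$\mathsf E[\overline W\mid\overline Y\ge v]=w_0+\sum_{k=1}^m\frac{\phi(\sqrt n\hat\omega)}{\sqrt n\hat z(1-\alpha)}\frac{w_kd_k}{1-2\lambda_k\hat\eta}\Big[\hat\eta+\frac1n\Big(\Big(\frac{\hat\rho_4}8-\frac{5\hat\rho_3^2}{24}-\frac{\hat\rho_3}{2\hat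 z}-\frac1{\hat z^2}\Big)\hat\eta+\frac{1}{\sqrt{\mathcal K_Y''(\hat\eta)}(1-2\lambda_k\hat\eta)}\Big(\frac{\hat\rho_3}2+\frac1{\hat z}\Big)-\frac{4\lambda_k}{2\mathcal K_Y''(\hat\eta)(1-2\lambda_k\hat\eta)^2}\Big)\Big]+\frac{\phi(\sqrt n\hat\omega)}{\sqrt n(1-\alpha)}O(n^{-2}).$$ In particular (case $n=1$), with $W=\partial Y/\partial\mu_i$ for the delta-gamma loss described in the context and $v=v_\alpha(Y)$, these give the saddlepoint approximations to the VaR sensitivity $\partial v_\alpha(Y)/\partial\mu_i$ and CVaR sensitivity $\partial c_\alpha(Y)/\partial\mu_i$.
   Context: $\mathcal K_Y(\eta)=c\eta-\frac12\sum_k\log(1-2\lambda_k\eta)+\frac12\sum_k\frac{d_k^2\eta^2}{1-2\lambda_k\eta}$ is the CGF of $Y$; $\hat z=\hat\eta\sqrt{\mathcal K_Y''(\hat\eta)}$, $\hat\omega=\mathrm{sign}(\hat\eta)\sqrt{2(\hat\eta v-\mathcal K_Y(\hat\eta))}$, $\hat\rho_3=\mathcal K_Y^{(3)}(\hat\eta)/\mathcal K_Y''(\hat\eta)^{3/2}$, $\hat\rho_4=\mathcal K_Y^{(4)}(\hat\eta)/\mathcal K_Y''(\hat\eta)^2$; $\phi$ is the standard normal density. Delta-gamma setting: risk factors $\mathbf X\sim\mathcal N(\boldsymbol\mu,\boldsymbol\Sigma)$ in $\mathbb R^m$, loss $Y=f(\mathbf 0)+\mathbf a^\top\mathbf X+\mathbf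 X^\top\mathbf B\mathbf X$ with $\mathbf B=(b_{ik})$ symmetric; $\boldsymbol\Sigma=\mathbf H\mathbf H^\top$, $\mathbf H^\top\mathbf B\mathbf H=\mathbf P\boldsymbol\Lambda\mathbf P^\top$ with $\mathbf P$ orthonormal, $\boldsymbol\Lambda=\mathrm{diag}(\lambda_1,\dots,\lambda_m)$; then $Y=c+\sum_k(d_kZ_k+\lambda_kZ_k^2)$ with $c=f(\mathbf 0)+\mathbf a^\top\boldsymbol\mu+\boldsymbol\mu^\top\mathbf B\boldsymbol\mu$, $\mathbf d=\mathbf P^\top\mathbf H^\top(\mathbf a+2\mathbf B\boldsymbol\mu)$, and $\partial Y/\partial\mu_i=a_i+2\sum_kb_{ik}\mu_k+\sum_k[2\mathbf P^\top\mathbf H^\top\mathbf B]_{ki}Z_k$, i.e. $w_0=a_i+2\sum_kb_{ik}\mu_k$, $w_k=[2\mathbf P^\top\mathbf H^\top\mathbf B]_{ki}$. $v_\alpha(Y)=\inf\{l:\mathsf P(Y\le l)\ge\alpha\}$ (VaR) and $c_\alpha(Y)=\mathsf E[Y\mid Y\ge v_\alpha(Y)]$ (CVaR); by results of Hong and Liu these sensitivities equal $\mathsf E[\partial Y/\partial\mu_i\mid Y=v_\alpha]$ and $\mathsf E[\partial Y/\partial\mu_i\mid Y\ge v_\alpha]$ respectively. *)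

(* Defs.v *)
From HB Require Import structures.
From mathcomp Require Import all_boot all_order all_algebra.
From mathcomp Require Import all_classical all_reals all_analysis.
Set Implicit Arguments. Unset Strict Implicit. Unset Printing Implicit Defensive.
Import Order.TTheory GRing.Theory Num.Theory.
Import numFieldNormedType.Exports.
Local Open Scope classical_set_scope.
Local Open Scope ring_scope.

Section defs.
Context {R : realType}.

(* Cumulant generating function K_Y of Y = c + sum_k (d_k Z_k + lam_k Z_k^2). *)
Definition KY (m : nat) (c : R) (lam d : 'I_m -> R) (eta : R) : R :=
  c * eta - 2^-1 * \sum_(k < m) ln (1 - 2 * lam k * eta)
  + 2^-1 * \sum_(k < m) (d k ^+ 2 * eta ^+ 2) / (1 - 2 * lam k * eta).

Definition KYn (j : nat) (m : nat) (c : R) (lam d : 'I_m -> R) : R -> R := derive1n j (@KY m c lam d).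

Definition phi (x : R) : R := normal_pdf 0 1 x.

Definition zhat (m : nat) (c : R) (lam d : 'I_m -> R) (eta : R) : R := eta * Num.sqrt (KYn 2 c lam d eta).
Definition omegahat (m : nat) (c : R) (lam d : 'I_m -> R) (v eta : R) : R :=
  Num.sg eta * Num.sqrt (2 * (eta * v - KY c lam d eta)).
Definition rho3hat (m : nat) (c : R) (lam d : 'I_m -> R) (eta : R) : R :=
  KYn 3 c lam d eta / Num.sqrt (KYn 2 c lam d eta) ^+ 3.
Definition rho4hat (m : nat) (c : R) (lam d : 'I_m -> R) (eta : R) : R :=
  KYn 4 c lam d eta / KYn 2 c lam d eta ^+ 2.

Section prob.
Context {dT : measure_display} {T : measurableType dT} (P : probability T R).

Definition mutually_independent (I : eqType) (X : I -> {RV P >-> R}) : Prop :=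
  forall (s : seq I), uniq s -> forall B : I -> set R, (forall i, measurable (B i)) ->
    P (\bigcap_(i in [set` s]) (X i @^-1` B i)) = (\prod_(i <- s) P (X i @^-1` B i))%E.

Definition std_normal_rv (X : {RV P >-> R}) : Prop :=
  forall A : set R, measurable A -> distribution P X A = normal_prob 0 1 A.

Definition Ycopy m (Z : nat -> 'I_m -> {RV P >-> R}) (c : R) (lam d : 'I_m -> R)
  (j : nat) (t : T) : R :=
  c + \sum_(k < m) (d k * Z j k t + lam k * Z j k t ^+ 2).
Definition Wcopy m (Z : nat -> 'I_m -> {RV P >-> R}) (w0 : R) (w : 'I_m -> R)
  (j : nat) (t : T) : R :=
  w0 + \sum_(k < m) w k * Z j k t.

Definition smean (F : nat -> T -> R) (n : nat) (t : T) : R :=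
  n%:R^-1 * \sum_(j < n) F j t.

Definition cond_exp (X : T -> R) (A : set T) : R :=
  Rintegral P A X / fine (P A).

(* E[X | V = v], defined as lim_{h -> 0+} E[X | |V - v| <= h] *)
Definition cond_exp_at (X V : T -> R) (v L : R) : Prop :=
  (fun h : R => cond_exp X [set t | `|V t - v| <= h]) @ 0^'+ --> L.
End prob.

Definition approx_eq (m : nat) (c : R) (lam d : 'I_m -> R) (w0 : R) (w : 'I_m -> R) (eta : R) (n : nat) : R :=
  let K2 := KYn 2 c lam d eta in
  let K3 := KYn 3 c lam d eta in
  let K4 := KYn 4 c lam d eta in
  w0 + \sum_(k < m)
    (w k * d k / (1 - 2 * lam k * eta) ^+ 3 *
     (eta * (1 - 2 * lam k * eta) ^+ 2 +
      (K3 * (1 - 2 * lam k * eta) - 4 * lam k * K2) /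
      (2 * n%:R * K2 ^+ 2 + 4^-1 * K4 - 5 / 12 * K3 ^+ 2 / K2))).

(* saddlepoint approximation of E[Wbar | Ybar >= v]; oma = 1 - alpha *)
Definition approx_tail (m : nat) (c : R) (lam d : 'I_m -> R) (w0 : R) (w : 'I_m -> R) (v eta oma : R) (n : nat) : R :=
  let K2 := KYn 2 c lam d eta in
  let z := zhat c lam d eta in
  let om := omegahat c lam d v eta in
  let r3 := rho3hat c lam d eta in
  let r4 := rho4hat c lam d eta in
  let sn := Num.sqrt n%:R in
  w0 + \sum_(k < m)
    (phi (sn * om) / (sn * z * oma) * (w k * d k / (1 - 2 * lam k * eta)) *
     (eta + n%:R^-1 *
        ((r4 / 8 - 5 * r3 ^+ 2 / 24 - r3 / (2 * z) - 1 / z ^+ 2) * eta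
         + 1 / (Num.sqrt K2 * (1 - 2 * lam k * eta)) * (r3 / 2 + 1 / z)
         - 4 * lam k / (2 * K2 * (1 - 2 * lam k * eta) ^+ 2)))).

End defs.

(* Main.v *)
(** Put S = n (Ybar - v), and let U be the sum over the sample of the w_k Z_jk.  The transforms
    E[e^{(eta+it)S}] and E[U e^{(eta+it)S}] equal M e^{n(A+iB)(t)} and n M (rho+i sigma)(t) e^{n(A+iB)(t)};
    they are found one coordinate at a time from a linear differential equation given by Stein's
    identity under a Gaussian weight.  Fourier inversion under the tilted law, carried out with
    Gaussian mollifiers, expresses E[U | S = 0] as the quotient of the integrals of the second and the
    first transform, and E[U; S >= 0] as the integral of the second one divided by eta + i t.
    The saddlepoint equation makes B(t) = O(t^3), so Laplace's method, with the majorant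
    A(t) <= - a ln (1 + b t^2) valid for all t, gives both integrals with relative error O(n^-2).
    For eta < 0 the inversion is done on S <= 0 and one uses E[U] = 0.  If K_Y''(eta) = 0, then all
    lam_k and d_k vanish and Ybar is constant. *)

(* Every transform is a pair of real functions, a cosine and a sine part, so each complex identity
   (the differential equation, products of factors, division by eta + i t) appears as two real ones.
   Conditioning on a null event is a limit over shrinking windows, so the density of S must be known
   near 0 with an error quadratic in the window; it is Lipschitz once the transform decays fast
   enough. For small n this may fail, since one coordinate with lam_k nonzero gives only a power of
   t whose exponent grows with n; hence the statements start at some n. Indicators jump at their
   ends, so inverting against them requires S to have no atoms. One coordinate has transform ratio s
   d / (1 - 2 lam s) with s = eta + i t, so division by s in the tail integral leaves no pole. The
   denominator in the first formula is 2 K''^2 (n + e), where e / n is the relative correction of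
   the denominator integral; the numerator contains the same correction, and (a (1 + e/n) + b/n) /
   (1 + e/n) is exactly a + b / (n + e). In the tail formula 1 - alpha is kept exact, so only the
   numerator is expanded. *)
Require Import Defs.
From HB Require Import structures.
From mathcomp Require Import all_boot all_order all_algebra.
From mathcomp Require Import all_classical all_reals all_analysis.
From mathcomp Require Import measurable_realfun ring lra zify.
Import Order.TTheory GRing.Theory Num.Theory.
Import numFieldNormedType.Exports.
Local Open Scope classical_set_scope.
Local Open Scope ring_scope.

Set Implicit Arguments. Unset Strict Implicit. Unset Printing Implicit Defensive.

(** * Real-valued integrals *)

Notation intg mu f := (mu.-integrable setT (EFin \o f)).

Section real_integral.
Context {R : realType} {dT : measure_display} {T : measurableType dT}.
Variable mu : {measure set T -> \bar R}.
Implicit Types f g : T -> R.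

Lemma intg_measurable f : intg mu f -> measurable_fun setT f.
Proof. by move=> /measurable_int /measurable_EFinP. Qed.

Lemma intg_le f g : measurable_fun setT f -> (forall x, `|f x| <= g x) ->
  intg mu g -> intg mu f.
Proof.
move=> mf fg; apply: le_integrable => //; first exact/measurable_EFinP.
by move=> x _; rewrite /= lee_fin (le_trans (fg x))// ler_norm.
Qed.

Lemma eq_intg f g : f =1 g -> intg mu f -> intg mu g.
Proof. by move=> /funext ->. Qed.

Lemma intgD f g : intg mu f -> intg mu g -> intg mu (fun x => f x + g x).
Proof. by move=> hf hg; apply: eq_integrable (integrableD measurableT hf hg). Qed.

Lemma intgB f g : intg mu f -> intg mu g -> intg mu (fun x => f x - g x).
Proof. by move=> hf hg; apply: eq_integrable (integrableB measurableT hf hg). Qed.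

Lemma intgZl k f : intg mu f -> intg mu (fun x => k * f x).
Proof. by move=> hf; apply: eq_integrable (integrableZl measurableT k hf). Qed.

Lemma intgZr k f : intg mu f -> intg mu (fun x => f x * k).
Proof. by move=> /(intgZl k); apply: eq_intg => x; rewrite mulrC. Qed.

Lemma intg_norm f : intg mu f -> intg mu (fun x => `|f x|).
Proof. exact: integrable_norm. Qed.

Lemma Rint_norm_le f g : measurable_fun setT f -> (forall x, `|f x| <= g x) ->
  intg mu g -> `|\int[mu]_x f x| <= \int[mu]_x g x.
Proof.
move=> mf fg hg; have hf := intg_le mf fg hg.
rewrite (le_trans (le_normr_Rintegral _ hf))//.
by apply: le_Rintegral => //; exact: intg_norm.
Qed.

Lemma Rint_dct (F : nat -> T -> R) f g :
  (forall n, measurable_fun setT (F n)) ->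
  (forall x, F n x @[n --> \oo] --> f x) ->
  intg mu g -> (forall n x, `|F n x| <= g x) ->
  \int[mu]_x F n x @[n --> \oo] --> \int[mu]_x f x.
Proof.
move=> mF Ff hg Fg.
have mf : measurable_fun setT f.
  by apply: (measurable_fun_cvg mF) => x _; exact: Ff.
have [] := @dominated_convergence _ _ _ mu setT measurableT
  (fun n => EFin \o F n) (EFin \o f) (EFin \o g) => //.
- by move=> n; exact/measurable_EFinP.
- exact/measurable_EFinP.
- by apply: aeW => x _; apply: cvg_EFin (Ff x); exact: nearW.
- by apply: aeW => x n _; rewrite /= lee_fin.
move=> hf _ cv.
apply: fine_cvg; rewrite fineK; last exact: integrable_fin_num.
exact: cv.
Qed.

End real_integral.

(** The double integrals below have integrands dominated by a product g(x) h(y); Tonelli then gives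
    integrability on the product space, and with it both orders of integration. *)
Lemma Rint_fubini (R : realType) d1 d2 (T1 : measurableType d1)
    (T2 : measurableType d2) (m1 : {sigma_finite_measure set T1 -> \bar R})
    (m2 : {sigma_finite_measure set T2 -> \bar R})
    (f : T1 * T2 -> R) (g : T1 -> R) (h : T2 -> R) :
  measurable_fun setT f -> intg m1 g -> intg m2 h ->
  (forall x y, `|f (x, y)| <= g x * h y) ->
  [/\ \int[m1]_x (\int[m2]_y f (x, y)) = \int[m2]_y (\int[m1]_x f (x, y)),
      \int[(m1 \x m2)%E]_z f z = \int[m1]_x (\int[m2]_y f (x, y)),
      intg (m1 \x m2)%E f & intg m1 (fun x => \int[m2]_y f (x, y))].
Proof.
move=> mf hg hh fgh.
have mEf : measurable_fun setT (EFin \o f) by exact/measurable_EFinP.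
have hf : intg (m1 \x m2)%E f.
  apply/integrable12ltyP => //.
  have [/measurable_EFinP mg _] := integrableP _ _ _ hg.
  have [/measurable_EFinP mh _] := integrableP _ _ _ hh.
  apply: (@le_lt_trans _ _ (\int[m1]_x (`|g x| * \int[m2]_y `|h y|)%:E)%E).
    apply: ge0_le_integral => //=.
    - by move=> x _; exact: integral_ge0.
    - apply: (@measurable_fun_fubini_tonelli_F _ _ _ _ _ m2 (fun z => `|(f z)%:E|%E)) => //.
      exact: measurableT_comp.
    - apply/measurable_EFinP/measurable_funM => //; exact: measurableT_comp.
    move=> x _.
    apply: (@le_trans _ _ (\int[m2]_y (`|g x| * `|h y|)%:E)%E).
      apply: ge0_le_integral => //=.
      - apply: measurableT_comp => //; apply: measurableT_comp => //.
        exact: measurableT_comp.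
      - apply/measurable_EFinP/measurable_funM => //; exact: measurableT_comp.
      move=> y _; rewrite lee_fin (le_trans (fgh x y))// -normrM ler_norm//.
    under eq_integral do rewrite EFinM.
    rewrite ge0_integralZl//=.
    - rewrite EFinM lee_wpmul2l ?lee_fin// /Rintegral fineK//.
      by apply: integrable_fin_num => //; exact: intg_norm.
    - by apply/measurable_EFinP; exact: measurableT_comp.
  by have /integrable_lty := intgZr (\int[m2]_y `|h y|) (intg_norm hg); exact.
have sec1 x : intg m2 (fun y => f (x, y)).
  apply: (@intg_le _ _ _ _ _ (fun y => g x * h y)) => //.
  - by apply: measurableT_comp => //.
  - exact: intgZl.
have sec2 y : intg m1 (fun x => f (x, y)).
  apply: (@intg_le _ _ _ _ _ (fun x => g x * h y)) => //.
  - by apply: measurableT_comp => //.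
  - exact: intgZr.
have FE : fubini_F m2 (EFin \o f) = EFin \o (fun x => \int[m2]_y f (x, y)).
  apply/funext => x; rewrite /fubini_F/= fineK//.
  exact: (integrable_fin_num _ (sec1 x)).
have i1 : intg m1 (fun x => \int[m2]_y f (x, y)).
  by rewrite -FE; exact: integrable_fubini_F.
have e12 : \int[(m1 \x m2)%E]_z f z = \int[m1]_x (\int[m2]_y f (x, y)).
  rewrite /Rintegral -(integral12_prod_meas1 hf); congr fine.
  apply: eq_integral => x _; rewrite /fubini_F/= fineK//.
  exact: (integrable_fin_num _ (sec1 x)).
split => //; rewrite -e12.
rewrite /Rintegral -(integral21_prod_meas1 hf); congr fine.
apply: eq_integral => x _; rewrite /fubini_G/= fineK//.
exact: (integrable_fin_num _ (sec2 x)).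
Qed.

(** * Derivatives *)

Section derivatives.
Context {R : realType}.
Implicit Types (f g : R -> R) (x a b : R).

Definition der f x a := is_derive (x : R) (1 : R) f a.

Lemma der_eq f x a b : der f x a -> a = b -> der f x b.
Proof. by move=> h <-. Qed.

Lemma der_cst a x : der (fun=> a) x 0.
Proof. exact: is_derive_cst. Qed.

Lemma der_id x : der (fun y => y) x 1.
Proof. exact: is_derive_id. Qed.

Lemma derD f g x a b : der f x a -> der g x b -> der (fun y => f y + g y) x (a + b).
Proof. exact: is_deriveD. Qed.

Lemma derN f x a : der f x a -> der (fun y => - f y) x (- a).
Proof. exact: is_deriveN. Qed.

Lemma derB f g x a b : der f x a -> der g x b -> der (fun y => f y - g y) x (a - b).
Proof. exact: is_deriveB. Qed.

Lemma derM f g x a b : der f x a -> der g x b ->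
  der (fun y => f y * g y) x (a * g x + f x * b).
Proof.
move=> hf hg; have h := @is_deriveM _ _ _ _ _ _ _ _ hf hg.
by apply: der_eq h _; rewrite /GRing.scale/=; ring.
Qed.

Lemma derX f n x a : der f x a -> der (fun y => f y ^+ n) x (n%:R * f x ^+ n.-1 * a).
Proof.
move=> hf; have h := @is_deriveX _ _ _ n _ _ _ hf.
have -> : (fun y => f y ^+ n) = f ^+ n by apply/funext => y; rewrite exprfctE.
exact: h.
Qed.

Lemma derV f x a : f x != 0 -> der f x a -> der (fun y => (f y)^-1) x (- a / f x ^+ 2).
Proof.
move=> f0 hf; apply: der_eq (is_deriveV f0 hf) _.
by rewrite /GRing.scale/= mulNr mulrC mulNr.
Qed.

Lemma der_comp f g x a b : der f (g x) a -> der g x b -> der (fun y => f (g y)) x (a * b).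
Proof. exact: is_derive1_comp. Qed.

Lemma der_exp f x a : der f x a -> der (fun y => expR (f y)) x (expR (f x) * a).
Proof. exact/der_comp/is_derive_expR. Qed.

Lemma der_cos f x a : der f x a -> der (fun y => cos (f y)) x (- sin (f x) * a).
Proof. exact/der_comp/is_derive_cos. Qed.

Lemma der_sin f x a : der f x a -> der (fun y => sin (f y)) x (cos (f x) * a).
Proof. exact/der_comp/is_derive_sin. Qed.

Lemma der_ln f x a : 0 < f x -> der f x a -> der (fun y => ln (f y)) x (a / f x).
Proof.
by move=> f0 h; apply: der_eq (der_comp (is_derive1_ln f0) h) _; rewrite mulrC.
Qed.

Lemma der_atan f x a : der f x a -> der (fun y => atan (f y)) x (a / (1 + f x ^+ 2)).
Proof.
by move=> h; apply: der_eq (der_comp (is_derive1_atan (f x)) h) _; rewrite mulrC.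
Qed.

Lemma der_sum (I : Type) (s : seq I) (F : I -> R -> R) (D : I -> R) x :
  (forall i, der (F i) x (D i)) ->
  der (fun y => \sum_(i <- s) F i y) x (\sum_(i <- s) D i).
Proof.
move=> h; elim: s => [|i s IH].
  have -> : (fun y => \sum_(i <- [::]) F i y) = fun=> 0.
    by apply/funext => y; rewrite big_nil.
  by rewrite big_nil; exact: der_cst.
have -> : (fun y => \sum_(i <- i :: s) F i y) = fun y => F i y + \sum_(i <- s) F i y.
  by apply/funext => y; rewrite big_cons.
by rewrite big_cons; exact: derD.
Qed.

Lemma der_continuous f (df : R -> R) : (forall x, der f x (df x)) -> continuous f.
Proof.
move=> h x; apply/differentiable_continuous/derivable1_diffP.
exact: (@ex_derive _ _ _ _ _ _ _ (h x)).
Qed.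

Lemma der_measurable f (df : R -> R) : (forall x, der f x (df x)) ->
  measurable_fun setT f.
Proof. by move=> /der_continuous; exact: continuous_measurable_fun. Qed.

Lemma der0_cst f x y : (forall z, der f z 0) -> f x = f y.
Proof. by move=> h; apply: is_derive_0_is_cst => z; exact: h. Qed.

Lemma der_derive1 f x a : der f x a -> derive1 f x = a.
Proof. by move=> h; rewrite derive1E (@derive_val _ _ _ _ _ _ _ h). Qed.

End derivatives.

(** The derivative is built by unification and compared with the wanted value afterwards, through
    [der_eq] and [ring] or [field]. [eassumption] precedes the structural rules, so that local
    derivative facts are used and side conditions are closed. *)
Ltac der := repeat first
  [ apply: der_cst | apply: der_id | eassumption
  | eapply derX | eapply derB | eapply derD | eapply derN | eapply derM
  | eapply der_exp | eapply der_cos | eapply der_sin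
  | eapply der_ln | eapply der_atan | eapply derV ].

(** * Integrals of derivatives over the line *)

Section ftc_line.
Context {R : realType}.
Notation leb := (@lebesgue_measure R).

Lemma ftc_interval (h h' : R -> R) (a b : R) : a < b ->
  (forall x, der h x (h' x)) -> continuous h' ->
  \int[leb]_(x in `[a, b]) h' x = h b - h a.
Proof.
move=> ab dh ch; rewrite /Rintegral (@continuous_FTC2 _ h' h)//.
- exact: continuous_subspaceT.
- split.
  + by move=> x _; exact: (@ex_derive _ _ _ _ _ _ _ (dh x)).
  + by apply: cvg_at_right_filter; exact: der_continuous.
  + by apply: cvg_at_left_filter; exact: der_continuous.
- by move=> x _; exact: der_derive1.
Qed.

(** Limits along the integers suffice: integrability of [h'] makes its integrals over [-n, n]
    converge to the integral over the line. *)
Lemma ftc_line (h h' : R -> R) : (forall x, der h x (h' x)) -> continuous h' ->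
  intg leb h' -> h n%:R @[n --> \oo] --> (0 : R) -> h (- n%:R) @[n --> \oo] --> (0 : R) ->
  \int[leb]_x h' x = 0.
Proof.
move=> dh ch ih hp hm.
have mh : measurable_fun setT h' by exact: continuous_measurable_fun.
have cv : \int[leb]_x ((h' \_ `[- n%:R, n%:R]) x) @[n --> \oo] --> \int[leb]_x h' x.
  apply: (@Rint_dct _ _ _ leb (fun n => h' \_ `[- n%:R, n%:R]) h' (fun x => `|h' x|)).
  - move=> n; apply/measurable_restrict => //.
    exact: measurable_funS mh.
  - move=> x; apply: cvg_near_cst; near=> n.
    rewrite patchE mem_set//= in_itv/=.
    have : `|x| <= n%:R by near: n; exact: nbhs_infty_ger.
    by rewrite ler_norml => /andP[-> ->].
  - exact: intg_norm.
  - by move=> n x; rewrite patchE; case: ifP => //; rewrite normr0.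
have cv2 : \int[leb]_x ((h' \_ `[- n%:R, n%:R]) x) @[n --> \oo] --> (0 : R).
  have h0 : h n%:R - h (- n%:R) @[n --> \oo] --> (0 : R).
    by rewrite -[X in _ --> X](subr0 (0:R)); exact: cvgB.
  apply: cvg_trans h0; apply: near_eq_cvg; near=> n.
  rewrite -Rintegral_mkcond (ftc_interval _ dh)//.
  have n0 : (0 < n)%N by near: n; exact: nbhs_infty_gt.
  by rewrite ltrNl (@lt_trans _ _ 0)// ?oppr_lt0 ltr0n.
exact: cvg_unique cv cv2.
Unshelve. all: by end_near. Qed.

End ftc_line.

(** * Gaussian weights and their transforms *)

Section gaussian_weight.
Context {R : realType}.
Notation leb := (@lebesgue_measure R).
Implicit Types q b z : R.

(** Precision [q] and linear coefficient [b] are used instead of variance and mean because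
    exponential tilting by a quadratic acts on them additively. *)
Definition gw (q b z : R) : R := expR (- (q / 2) * z ^+ 2 + b * z).

Definition gmass (q b : R) : R := Num.sqrt (2 * pi / q) * expR (b ^+ 2 / (2 * q)).

Lemma gw_ge0 q b z : 0 <= gw q b z. Proof. exact: expR_ge0. Qed.

Lemma der_gw q b z : der (gw q b) z ((b - q * z) * gw q b z).
Proof. by eapply der_eq; [rewrite /gw; der | rewrite /gw /=; field]. Qed.

Lemma continuous_gw q b : continuous (gw q b).
Proof. exact/der_continuous/der_gw. Qed.

Lemma measurable_gw q b : measurable_fun setT (gw q b).
Proof. by apply: continuous_measurable_fun; exact: continuous_gw. Qed.

Lemma gw_normal q b z : 0 < q ->
  gw q b z = gmass q b * normal_pdf (b / q) (Num.sqrt q)^-1 z.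
Proof.
move=> q0; have sq0 : Num.sqrt q != 0 by rewrite gt_eqF// sqrtr_gt0.
rewrite normal_pdfE ?invr_eq0// /normal_peak /normal_fun /gmass.
have e : (Num.sqrt q)^-1 ^+ 2 = q^-1 by rewrite exprVn sqr_sqrtr// ltW.
rewrite e.
have -> : (q^-1 * pi) *+ 2 = 2 * pi / q by rewrite -mulr_natl; ring.
have s0 : 0 < Num.sqrt (2 * pi / q).
  by rewrite sqrtr_gt0 divr_gt0// mulr_gt0// pi_gt0.
rewrite mulrACA divff ?gt_eqF// mul1r -expRD /gw; congr expR.
rewrite -mulr_natl; field; exact: lt0r_neq0.
Qed.

Lemma intg_gw q b : 0 < q -> intg leb (gw q b).
Proof.
move=> q0; have := intgZl (gmass q b) (integrable_normal_pdf (b / q) (Num.sqrt q)^-1).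
by apply: eq_intg => z; rewrite gw_normal.
Qed.

Lemma Rint_gw q b : 0 < q -> \int[leb]_z gw q b z = gmass q b.
Proof.
move=> q0; under eq_Rintegral do rewrite gw_normal//.
rewrite RintegralZl//; last exact: integrable_normal_pdf.
by rewrite /Rintegral integral_normal_pdf mulr1.
Qed.

(** For |z| <= 1 the power is at most 1; otherwise |z|^k <= (z^2)^k, which is bounded by a single
    term of the exponential series of a z^2. *)
Lemma pow_le_gauss (a : R) k : 0 < a ->
  exists2 C : R, 0 <= C & forall z : R, `|z| ^+ k <= C * expR (a * z ^+ 2).
Proof.
move=> a0; exists (1 + k`!%:R / a ^+ k).
  by rewrite addr_ge0// divr_ge0// exprn_ge0// ltW.
move=> z.
have az0 : 0 <= a * z ^+ 2 by rewrite mulr_ge0 ?sqr_ge0// ltW.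
have e1 : 1 <= expR (a * z ^+ 2) by rewrite -expR0 ler_expR.
have e2 : (a * z ^+ 2) ^+ k <= k`!%:R * expR (a * z ^+ 2).
  case: k => [|k]; first by rewrite expr0 fact0 mul1r.
  rewrite -ler_pdivrMl ?ltr0n ?fact_gt0// mulrC.
  by apply: le_trans (expR_ge1Dxn k az0); rewrite lerDr.
have e3 : `|z| ^+ k <= 1 + (z ^+ 2) ^+ k.
  have [z1|z1] := leP `|z| 1.
    by rewrite (le_trans (exprn_ile1 _ _ z1))// lerDl exprn_ge0 ?sqr_ge0.
  rewrite -[z ^+ 2](real_normK (num_real z)) exprAC expr2 -[leLHS]add0r lerD//.
  by rewrite ler_peMr ?exprn_ge0// exprn_ege1// ltW.
rewrite (le_trans e3)// mulrDl mul1r lerD//.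
rewrite mulrAC ler_pdivlMr ?exprn_gt0//.
by move: e2; rewrite exprMn mulrC.
Qed.

(** The power costs e^{q z^2 / 8}; completing the square absorbs the linear term into the constant
    e^{b^2 / q}. *)
Lemma gw_pow_le q b k : 0 < q ->
  exists2 C : R, 0 <= C & forall z : R, `|z| ^+ k * gw q b z <= C * gw (q / 4) 0 z.
Proof.
move=> q0; have q8 : 0 < q / 8 by rewrite divr_gt0.
have [C C0 hC] := pow_le_gauss k q8.
exists (C * expR (b ^+ 2 / q)); first by rewrite mulr_ge0// expR_ge0.
move=> z; rewrite (le_trans (ler_wpM2r (gw_ge0 _ _ _) (hC z)))//.
rewrite -!mulrA ler_wpM2l// /gw -!expRD ler_expR -subr_ge0.
rewrite [leRHS](_ : _ = (q * z / 2 - b) ^+ 2 / q); last first.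
  by field; exact: lt0r_neq0.
by rewrite divr_ge0 ?sqr_ge0// ltW.
Qed.

Lemma intg_pow_gw q b k : 0 < q -> intg leb (fun z => `|z| ^+ k * gw q b z).
Proof.
move=> q0; have [C C0 hC] := gw_pow_le b k q0.
apply: (@intg_le _ _ _ leb _ (fun z => C * gw (q / 4) 0 z)).
- apply: measurable_funM; last exact: measurable_gw.
  by apply: measurable_funX; exact: normr_measurable.
- by move=> z; rewrite ger0_norm// mulr_ge0 ?gw_ge0// exprn_ge0.
- by apply/intgZl/intg_gw; rewrite divr_gt0.
Qed.

Lemma gw_pow_cvg0 (h : R -> R) (C q b : R) k : 0 < q ->
  (forall z, `|h z| <= C * (`|z| ^+ k * gw q b z)) ->
  (h n%:R @[n --> \oo] --> (0 : R)) * (h (- n%:R) @[n --> \oo] --> (0 : R)).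
Proof.
move=> q0 hh; have [D D0 hD] := gw_pow_le b k q0.
(* The factor 1 + 8/q comes from n + 1 <= (1 + 8/q) (1 + q n^2 / 8), whose last factor is at most
   e^{q n^2 / 8}. *)
pose K := `|C| * D * (1 + 8 / q).
have key (n : nat) (z : R) : `|z| = n%:R -> `|h z| <= K * harmonic n.
  move=> zn; rewrite (le_trans (hh z))//.
  apply: (@le_trans _ _ (`|C| * (D * gw (q / 4) 0 z))).
    apply: (le_trans (ler_wpM2r _ (ler_norm C))).
      by rewrite mulr_ge0 ?gw_ge0// exprn_ge0.
    by rewrite ler_wpM2l.
  rewrite mulrA /K -[leRHS]mulrA ler_wpM2l ?mulr_ge0//.
  rewrite /harmonic /=.
  have y0 : 0 <= q / 8 * z ^+ 2 by rewrite mulr_ge0 ?sqr_ge0// divr_ge0// ltW.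
  have -> : gw (q / 4) 0 z = (expR (q / 8 * z ^+ 2))^-1.
    by rewrite -expRN /gw; congr expR; field.
  rewrite ler_pdivlMr ?ltr0n// mulrC ler_pdivrMr ?expR_gt0//.
  apply: (@le_trans _ _ ((1 + 8 / q) * (1 + q / 8 * z ^+ 2))); last first.
    by rewrite ler_wpM2l ?expR_ge1Dx// addr_ge0// divr_ge0// ltW.
  have -> : (1 + 8 / q) * (1 + q / 8 * z ^+ 2) = 1 + z ^+ 2 + (8 / q + q / 8 * z ^+ 2).
    by field; exact: lt0r_neq0.
  rewrite -[leLHS]addr0 lerD//; last by rewrite addr_ge0// divr_ge0// ltW.
  by rewrite -(real_normK (num_real z)) zn -natr1 addrC lerD2l -natrX ler_nat; case: (n) => // m; rewrite expnS leq_pmulr// expn1.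
have kh : K * harmonic n @[n --> \oo] --> (0 : R).
  by rewrite -[X in _ --> X](mulr0 K); apply: cvgMr; exact: cvg_harmonic.
split; apply: norm_cvg0; apply: squeeze_cvgr (cvg_cst _) kh; apply: nearW => n;
  by rewrite normr_ge0/=; apply: key; rewrite ?normrN ger0_norm.
Qed.

End gaussian_weight.

(** The majorant is uniform in the parameter, so any neighbourhood of [t] will do; radius 1 is
    taken. *)
Lemma der_under_integral (R : realType) dT (T : measurableType dT)
    (mu : {measure set T -> \bar R}) (f f' : R -> T -> R) (G : T -> R) (t : R) :
  (forall s, intg mu (f s)) -> (forall s y, der (f^~ y) s (f' s y)) ->
  intg mu G -> (forall s y, `|f' s y| <= G y) ->
  der (fun s => \int[mu]_y f s y) t (\int[mu]_y f' t y).
Proof.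
move=> hf df hG fG.
have e s y : partial1of2 f s y = f' s y by rewrite /partial1of2; exact: der_derive1.
have tI : `]t - 1, t + 1[%classic t by rewrite /= in_itv/=; apply/andP; split; lra.
have hf' s : `]t - 1, t + 1[%classic s -> mu.-integrable setT (EFin \o f s) by [].
have df' s y : `]t - 1, t + 1[%classic s -> setT y -> derivable (f^~ y) s 1.
  by move=> _ _; exact: (@ex_derive _ _ _ _ _ _ _ (df s y)).
have G0 y : 0 <= G y by rewrite (le_trans _ (fG t y)).
have fG' s y : `]t - 1, t + 1[%classic s -> setT y -> `|partial1of2 f s y| <= G y.
  by move=> _ _; rewrite e.
split.
  exact: (derivable_under_integral measurableT tI hf' df' G0 hG fG').
rewrite -derive1E (differentiation_under_integral measurableT tI hf' df' G0 hG fG').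
by apply: eq_Rintegral => y _; rewrite e.
Qed.

(** * The transform of a quadratic under a Gaussian weight *)

Section quadratic_gaussian_transform.
Context {R : realType}.
Notation leb := (@lebesgue_measure R).
Variables (q b lam d : R).
Hypothesis q0 : 0 < q.

Let a (z : R) : R := d * z + lam * z ^+ 2.

(** Together with [gsin], the real and imaginary parts of the integral G_k of z^k e^{it(dz + lam
    z^2)} against the Gaussian weight. *)
Definition gcos (k : nat) (t : R) : R :=
  \int[leb]_z (z ^+ k * cos (t * (d * z + lam * z ^+ 2)) * gw q b z).
Definition gsin (k : nat) (t : R) : R :=
  \int[leb]_z (z ^+ k * sin (t * (d * z + lam * z ^+ 2)) * gw q b z).

Let mX k : measurable_fun setT (fun z : R => z ^+ k).
Proof. exact: measurable_funX. Qed.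

Let ma : measurable_fun setT a.
Proof. by apply: measurable_funD; apply: measurable_funM => //; exact: mX. Qed.

Lemma intg_gcos k t : intg leb (fun z => z ^+ k * cos (t * (d * z + lam * z ^+ 2)) * gw q b z).
Proof.
apply: (@intg_le _ _ _ leb _ (fun z => `|z| ^+ k * gw q b z)).
- apply: measurable_funM; last exact: measurable_gw.
  apply: measurable_funM => //.
  apply: measurableT_comp; first by apply: continuous_measurable_fun; exact: continuous_cos.
  exact: measurable_funM.
- move=> z; rewrite !normrM (ger0_norm (gw_ge0 _ _ _)) normrX ler_wpM2r ?gw_ge0//.
  rewrite ler_piMr ?exprn_ge0// ler_norml cos_geN1 cos_le1//.
- exact: intg_pow_gw.
Qed.

Lemma intg_gsin k t : intg leb (fun z => z ^+ k * sin (t * (d * z + lam * z ^+ 2)) * gw q b z).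
Proof.
apply: (@intg_le _ _ _ leb _ (fun z => `|z| ^+ k * gw q b z)).
- apply: measurable_funM; last exact: measurable_gw.
  apply: measurable_funM => //.
  apply: measurableT_comp; first by apply: continuous_measurable_fun; exact: continuous_sin.
  exact: measurable_funM.
- move=> z; rewrite !normrM (ger0_norm (gw_ge0 _ _ _)) normrX ler_wpM2r ?gw_ge0//.
  rewrite ler_piMr ?exprn_ge0// ler_norml sin_geN1 sin_le1//.
- exact: intg_pow_gw.
Qed.

Let abound (z : R) : `|a z| * gw q b z <= `|d| * (`|z| ^+ 1 * gw q b z) + `|lam| * (`|z| ^+ 2 * gw q b z).
Proof.
rewrite [leRHS](_ : _ = (`|d| * `|z| + `|lam| * `|z| ^+ 2) * gw q b z); last by ring.
rewrite ler_wpM2r ?gw_ge0// (le_trans (ler_normD _ _))//.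
by rewrite -normrX -!normrM.
Qed.

Let intg_bound : intg leb (fun z : R => `|d| * (`|z| ^+ 1 * gw q b z) + `|lam| * (`|z| ^+ 2 * gw q b z)).
Proof. by apply: intgD; apply: intgZl; exact: intg_pow_gw. Qed.

Lemma der_gcos0 t : der (gcos 0) t (- (d * gsin 1 t + lam * gsin 2 t)).
Proof.
have -> : - (d * gsin 1 t + lam * gsin 2 t) =
  \int[leb]_z (- sin (t * a z) * a z * gw q b z).
  rewrite -mulN1r /gsin -!RintegralZl//; try exact: intg_gsin.
  rewrite -RintegralD//; try by apply: intgZl; exact: intg_gsin.
  rewrite -RintegralZl//; last by apply: intgD; apply: intgZl; exact: intg_gsin.
  by apply: eq_Rintegral => z _; rewrite /a; ring.
apply: (@der_under_integral _ _ _ leb _ (fun t z => - sin (t * a z) * a z * gw q b z) _ _ _ _ intg_bound).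
- by move=> s; exact: intg_gcos.
- move=> s z; eapply der_eq; [der|rewrite /a /=; ring].
- move=> s z; apply: le_trans (abound z).
  rewrite !normrM (ger0_norm (gw_ge0 _ _ _)) normrN ler_wpM2r ?gw_ge0//.
  by rewrite ler_piMl// ler_norml sin_geN1 sin_le1.
Qed.

Lemma der_gsin0 t : der (gsin 0) t (d * gcos 1 t + lam * gcos 2 t).
Proof.
have -> : d * gcos 1 t + lam * gcos 2 t =
  \int[leb]_z (cos (t * a z) * a z * gw q b z).
  rewrite /gcos -!RintegralZl//; try exact: intg_gcos.
  rewrite -RintegralD//; try by apply: intgZl; exact: intg_gcos.
  by apply: eq_Rintegral => z _; rewrite /a; ring.
apply: (@der_under_integral _ _ _ leb _ (fun t z => cos (t * a z) * a z * gw q b z) _ _ _ _ intg_bound).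
- by move=> s; exact: intg_gsin.
- move=> s z; eapply der_eq; [der|rewrite /a /=; ring].
- move=> s z; apply: le_trans (abound z).
  rewrite !normrM (ger0_norm (gw_ge0 _ _ _)) ler_wpM2r ?gw_ge0//.
  by rewrite ler_piMl// ler_norml cos_geN1 cos_le1.
Qed.

(* Stein's identity: the integral of a derivative vanishes. *)
Lemma stein_cos k t :
  k%:R * gcos k.-1 t - t * d * gsin k t - 2 * lam * t * gsin k.+1 t
  + b * gcos k t - q * gcos k.+1 t = 0.
Proof.
pose h (z : R) := z ^+ k * cos (t * a z) * gw q b z.
have cvh : (h n%:R @[n --> \oo] --> (0 : R)) * (h (- n%:R) @[n --> \oo] --> (0 : R)).
  apply: (@gw_pow_cvg0 _ _ 1 q b k q0) => z; rewrite mul1r.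
  rewrite !normrM (ger0_norm (gw_ge0 _ _ _)) normrX ler_wpM2r ?gw_ge0//.
  by rewrite ler_piMr ?exprn_ge0// ler_norml cos_geN1 cos_le1.
(* For k = 0 the truncated predecessor is harmless: its term carries the coefficient 0. *)
pose h' (z : R) := k%:R * (z ^+ k.-1 * cos (t * a z) * gw q b z)
  - t * d * (z ^+ k * sin (t * a z) * gw q b z)
  - 2 * lam * t * (z ^+ k.+1 * sin (t * a z) * gw q b z)
  + b * (z ^+ k * cos (t * a z) * gw q b z)
  - q * (z ^+ k.+1 * cos (t * a z) * gw q b z).
have dh z : der h z (h' z).
  have dg := der_gw q b z.
  by eapply der_eq; [rewrite /h /a; der|rewrite /h' /a /= (exprS z k); ring].
have ch' : continuous h'.
  pose h1 n (z : R) := z ^+ n * cos (t * a z) * gw q b z.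
  have c1 n : continuous (h1 n).
    apply: der_continuous => z; rewrite /h1 /a; have dg := der_gw q b z; der.
  pose h2 n (z : R) := z ^+ n * sin (t * a z) * gw q b z.
  have c2 n : continuous (h2 n).
    apply: der_continuous => z; rewrite /h2 /a; have dg := der_gw q b z; der.
  move=> z; rewrite /h'; apply: cvgB; last by apply: cvgMr; exact: (c1 k.+1).
  apply: cvgD; last by apply: cvgMr; exact: (c1 k).
  apply: cvgB; last by apply: cvgMr; exact: (c2 k.+1).
  apply: cvgB; last by apply: cvgMr; exact: (c2 k).
  by apply: cvgMr; exact: (c1 k.-1).
have i1 n x := intgZl x (intg_gcos n t).
have i2 n x := intgZl x (intg_gsin n t).
have ih' : intg leb h'.
  by do ![apply: intgB | apply: intgD]; [exact: i1|exact: i2|exact: i2|exact: i1|exact: i1].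
rewrite -[RHS](ftc_line dh ch' ih' cvh.1 cvh.2) /h'.
rewrite RintegralB//; last by do ![apply: intgB | apply: intgD].
rewrite RintegralD//; last by do ![apply: intgB | apply: intgD].
rewrite RintegralB//; last by do ![apply: intgB | apply: intgD].
rewrite RintegralB// !RintegralZl//; by [exact: intg_gcos|exact: intg_gsin].
Qed.

Lemma stein_sin k t :
  k%:R * gsin k.-1 t + t * d * gcos k t + 2 * lam * t * gcos k.+1 t
  + b * gsin k t - q * gsin k.+1 t = 0.
Proof.
pose h (z : R) := z ^+ k * sin (t * a z) * gw q b z.
have cvh : (h n%:R @[n --> \oo] --> (0 : R)) * (h (- n%:R) @[n --> \oo] --> (0 : R)).
  apply: (@gw_pow_cvg0 _ _ 1 q b k q0) => z; rewrite mul1r.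
  rewrite !normrM (ger0_norm (gw_ge0 _ _ _)) normrX ler_wpM2r ?gw_ge0//.
  by rewrite ler_piMr ?exprn_ge0// ler_norml sin_geN1 sin_le1.
pose h' (z : R) := k%:R * (z ^+ k.-1 * sin (t * a z) * gw q b z)
  + t * d * (z ^+ k * cos (t * a z) * gw q b z)
  + 2 * lam * t * (z ^+ k.+1 * cos (t * a z) * gw q b z)
  + b * (z ^+ k * sin (t * a z) * gw q b z)
  - q * (z ^+ k.+1 * sin (t * a z) * gw q b z).
have dh z : der h z (h' z).
  have dg := der_gw q b z.
  by eapply der_eq; [rewrite /h /a; der|rewrite /h' /a /= (exprS z k); ring].
have ch' : continuous h'.
  pose h1 n (z : R) := z ^+ n * cos (t * a z) * gw q b z.
  have c1 n : continuous (h1 n).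
    apply: der_continuous => z; rewrite /h1 /a; have dg := der_gw q b z; der.
  pose h2 n (z : R) := z ^+ n * sin (t * a z) * gw q b z.
  have c2 n : continuous (h2 n).
    apply: der_continuous => z; rewrite /h2 /a; have dg := der_gw q b z; der.
  move=> z; rewrite /h'; apply: cvgB; last by apply: cvgMr; exact: (c2 k.+1).
  apply: cvgD; last by apply: cvgMr; exact: (c2 k).
  apply: cvgD; last by apply: cvgMr; exact: (c1 k.+1).
  apply: cvgD; last by apply: cvgMr; exact: (c1 k).
  by apply: cvgMr; exact: (c2 k.-1).
have i1 n x := intgZl x (intg_gcos n t).
have i2 n x := intgZl x (intg_gsin n t).
have ih' : intg leb h'.
  by do ![apply: intgB | apply: intgD]; [exact: i2|exact: i1|exact: i1|exact: i2|exact: i2].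
rewrite -[RHS](ftc_line dh ch' ih' cvh.1 cvh.2) /h'.
rewrite RintegralB//; last by do ![apply: intgB | apply: intgD].
rewrite RintegralD//; last by do ![apply: intgB | apply: intgD].
rewrite RintegralD//; last by do ![apply: intgB | apply: intgD].
rewrite RintegralD// !RintegralZl//; by [exact: intg_gcos|exact: intg_gsin].
Qed.

(** With mu = b/q, beta = 2 lam/q and delta = (d + 2 lam mu)^2 / q, [gA] and [gB] are the real and
    imaginary parts of i t (d mu + lam mu^2) - log(1 - i beta t)/2 - delta t^2 / (2 (1 - i beta t)),
    the logarithm of G_0(t) / G_0(0). *)
Definition gA (t : R) : R :=
  - 4^-1 * ln (1 + (2 * lam / q * t) ^+ 2)
  - 2^-1 * ((d + 2 * lam * (b / q)) ^+ 2 / q) * t ^+ 2 / (1 + (2 * lam / q * t) ^+ 2).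

Definition gB (t : R) : R :=
  (d * (b / q) + lam * (b / q) ^+ 2) * t + 2^-1 * atan (2 * lam / q * t)
  - 2^-1 * ((d + 2 * lam * (b / q)) ^+ 2 / q) * (2 * lam / q) * t ^+ 3
    / (1 + (2 * lam / q * t) ^+ 2).

Let qD t : q ^+ 2 + (2 * lam * t) ^+ 2 != 0.
Proof. by rewrite gt_eqF// ltr_pwDl ?exprn_gt0// sqr_ge0. Qed.

Let D1 t : 0 < 1 + (2 * lam / q * t) ^+ 2.
Proof. by rewrite ltr_pwDl// sqr_ge0. Qed.

(** Stein's identities for k = 0 say (q - 2 i lam t) G_1 = (b + i t d) G_0; multiplying by the
    conjugate solves for G_1. The case k = 1 gives G_2 in the same way. *)
Lemma gcos1E t : gcos 1 t = (q * (b * gcos 0 t - t * d * gsin 0 t)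
  - 2 * lam * t * (t * d * gcos 0 t + b * gsin 0 t)) / (q ^+ 2 + (2 * lam * t) ^+ 2).
Proof.
have := stein_cos 0 t; have := stein_sin 0 t; rewrite !mul0r => h1 h2.
apply: (mulIf (qD t)); rewrite divfK ?qD//.
have -> : b * gcos 0 t - t * d * gsin 0 t = 2 * lam * t * gsin 1 t + q * gcos 1 t.
  by move: h2 => /=; lra.
have -> : t * d * gcos 0 t + b * gsin 0 t = q * gsin 1 t - 2 * lam * t * gcos 1 t.
  by move: h1 => /=; lra.
ring.
Qed.

Lemma gsin1E t : gsin 1 t = (q * (t * d * gcos 0 t + b * gsin 0 t)
  + 2 * lam * t * (b * gcos 0 t - t * d * gsin 0 t)) / (q ^+ 2 + (2 * lam * t) ^+ 2).
Proof.
have := stein_cos 0 t; have := stein_sin 0 t; rewrite !mul0r => h1 h2.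
apply: (mulIf (qD t)); rewrite divfK ?qD//.
have -> : b * gcos 0 t - t * d * gsin 0 t = 2 * lam * t * gsin 1 t + q * gcos 1 t.
  by move: h2 => /=; lra.
have -> : t * d * gcos 0 t + b * gsin 0 t = q * gsin 1 t - 2 * lam * t * gcos 1 t.
  by move: h1 => /=; lra.
ring.
Qed.

Let gcos2E t : gcos 2 t = (q * (gcos 0 t + b * gcos 1 t - t * d * gsin 1 t)
  - 2 * lam * t * (gsin 0 t + t * d * gcos 1 t + b * gsin 1 t)) / (q ^+ 2 + (2 * lam * t) ^+ 2).
Proof.
have := stein_cos 1 t; have := stein_sin 1 t; rewrite !mul1r => h1 h2.
apply: (mulIf (qD t)); rewrite divfK ?qD//.
have -> : gcos 0 t + b * gcos 1 t - t * d * gsin 1 t = 2 * lam * t * gsin 2 t + q * gcos 2 t.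
  by move: h2 => /=; lra.
have -> : gsin 0 t + t * d * gcos 1 t + b * gsin 1 t = q * gsin 2 t - 2 * lam * t * gcos 2 t.
  by move: h1 => /=; lra.
ring.
Qed.

Let gsin2E t : gsin 2 t = (q * (gsin 0 t + t * d * gcos 1 t + b * gsin 1 t)
  + 2 * lam * t * (gcos 0 t + b * gcos 1 t - t * d * gsin 1 t)) / (q ^+ 2 + (2 * lam * t) ^+ 2).
Proof.
have := stein_cos 1 t; have := stein_sin 1 t; rewrite !mul1r => h1 h2.
apply: (mulIf (qD t)); rewrite divfK ?qD//.
have -> : gcos 0 t + b * gcos 1 t - t * d * gsin 1 t = 2 * lam * t * gsin 2 t + q * gcos 2 t.
  by move: h2 => /=; lra.
have -> : gsin 0 t + t * d * gcos 1 t + b * gsin 1 t = q * gsin 2 t - 2 * lam * t * gcos 2 t.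
  by move: h1 => /=; lra.
ring.
Qed.

Definition gA' (t : R) : R :=
  - 2^-1 * (2 * lam / q) ^+ 2 * t / (1 + (2 * lam / q * t) ^+ 2)
  - ((d + 2 * lam * (b / q)) ^+ 2 / q) * t / (1 + (2 * lam / q * t) ^+ 2) ^+ 2.

Definition gB' (t : R) : R :=
  (d * (b / q) + lam * (b / q) ^+ 2) + 2^-1 * (2 * lam / q) / (1 + (2 * lam / q * t) ^+ 2)
  - 2^-1 * ((d + 2 * lam * (b / q)) ^+ 2 / q) * (2 * lam / q) * t ^+ 2
    * (3 + (2 * lam / q * t) ^+ 2) / (1 + (2 * lam / q * t) ^+ 2) ^+ 2.

Lemma der_gA t : der gA t (gA' t).
Proof.
have h := D1 t; have h' := lt0r_neq0 h.
eapply der_eq; [rewrite /gA; der => //|rewrite /gA' /=; field].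
by rewrite lt0r_neq0//= qD.
Qed.

Lemma der_gB t : der gB t (gB' t).
Proof.
have h := D1 t; have h' := lt0r_neq0 h.
eapply der_eq; [rewrite /gB; der => //|rewrite /gB' /=; field].
by rewrite lt0r_neq0//= qD.
Qed.

(** Real part of the equation G_0' = (A' + i B') G_0, obtained by eliminating G_1 and G_2 from the
    derivative. *)
Let ode_cos t : - (d * gsin 1 t + lam * gsin 2 t) = gA' t * gcos 0 t - gB' t * gsin 0 t.
Proof.
rewrite gsin2E gsin1E gcos1E /gA' /gB'.
move: (gcos 0 t) (gsin 0 t) (lt0r_neq0 (D1 t)) => C S h.
by field; rewrite lt0r_neq0//= qD.
Qed.

Let ode_sin t : d * gcos 1 t + lam * gcos 2 t = gA' t * gsin 0 t + gB' t * gcos 0 t.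
Proof.
rewrite gcos2E gsin1E gcos1E /gA' /gB'.
move: (gcos 0 t) (gsin 0 t) (lt0r_neq0 (D1 t)) => C S h.
by field; rewrite lt0r_neq0//= qD.
Qed.

(** X + i Y = G_0 e^{-(A + i B)} has derivative 0 and equals the Gaussian mass at t = 0. Rotating
    back by e^{A + i B} gives both formulas without an appeal to uniqueness for differential
    equations. *)
Lemma gcos_gsinE t :
  gcos 0 t = gmass q b * expR (gA t) * cos (gB t) /\
  gsin 0 t = gmass q b * expR (gA t) * sin (gB t).
Proof.
pose X s := expR (- gA s) * (gcos 0 s * cos (gB s) + gsin 0 s * sin (gB s)).
pose Y s := expR (- gA s) * (gsin 0 s * cos (gB s) - gcos 0 s * sin (gB s)).
have dA := der_gA; have dB := der_gB.
have dC s : der (gcos 0) s (gA' s * gcos 0 s - gB' s * gsin 0 s).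
  by rewrite -ode_cos; exact: der_gcos0.
have dS s : der (gsin 0) s (gA' s * gsin 0 s + gB' s * gcos 0 s).
  by rewrite -ode_sin; exact: der_gsin0.
have dX s : der X s 0.
  have := dA s; have := dB s; have := dC s; have := dS s => h1 h2 h3 h4.
  by eapply der_eq; [rewrite /X; der|rewrite /=; ring].
have dY s : der Y s 0.
  have := dA s; have := dB s; have := dC s; have := dS s => h1 h2 h3 h4.
  by eapply der_eq; [rewrite /Y; der|rewrite /=; ring].
have A0 : gA 0 = 0 by rewrite /gA !(mulr0, mul0r, expr0n, addr0, ln1, subr0)/=.
have B0 : gB 0 = 0 by rewrite /gB !(mulr0, mul0r, expr0n, addr0, atan0, subr0)/=.
have C0 : gcos 0 0 = gmass q b.
  rewrite -(Rint_gw b q0); apply: eq_Rintegral => z _.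
  by rewrite mul0r cos0 expr0 !mul1r.
have S0 : gsin 0 0 = 0.
  rewrite /gsin; under eq_Rintegral do rewrite mul0r sin0 mulr0 mul0r.
  by rewrite /Rintegral integral0.
have X0 s : X s = gmass q b.
  by rewrite (der0_cst s 0 dX) /X A0 B0 C0 S0 oppr0 expR0 cos0 mul1r mulr1 mul0r addr0.
have Y0 s : Y s = 0.
  by rewrite (der0_cst s 0 dY) /Y A0 B0 C0 S0 sin0 !(mul0r, mulr0) subrr mulr0.
have eA s : expR (gA s) * expR (- gA s) = 1 by rewrite -expRD subrr expR0.
have cs := cos2Dsin2 (gB t); have := X0 t; have := Y0 t.
rewrite /X /Y => hY hX; split.
- rewrite -hX -[LHS]mulr1 -cs -[LHS]mulr1 -(eA t).
  apply/eqP; rewrite -subr_eq0; apply/eqP.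
  transitivity (- expR (gA t) * sin (gB t) * (expR (- gA t) * (gsin 0 t * cos (gB t) - gcos 0 t * sin (gB t)))).
    by ring.
  by rewrite hY mulr0.
- rewrite -hX -[LHS]mulr1 -cs -[LHS]mulr1 -(eA t).
  apply/eqP; rewrite -subr_eq0; apply/eqP.
  transitivity (expR (gA t) * cos (gB t) * (expR (- gA t) * (gsin 0 t * cos (gB t) - gcos 0 t * sin (gB t)))).
    by ring.
  by rewrite hY mulr0.
Qed.

End quadratic_gaussian_transform.

(** * Independence *)

Section independence.
Context {R : realType} {dT : measure_display} {T : measurableType dT}.
Variable P : probability T R.
Context {I : eqType} (X : I -> {RV P >-> R}).

Definition cylinder (s : seq I) (B : I -> set R) : set T :=
  \bigcap_(i in [set` s]) (X i @^-1` B i).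

(** A form of independence suited to adding one coordinate at a time: [V] is to be built from the
    coordinates in [s] and is tested against cylinders over all other coordinates, which are the
    events that [mutually_independent] speaks of. *)
Definition indep_outside dY (Y : measurableType dY) (s : seq I) (V : {mfun T >-> Y}) :=
  forall A, measurable A -> forall s', uniq s' -> (forall i, i \in s' -> i \notin s) ->
  forall B, (forall i, measurable (B i)) ->
  P (V @^-1` A `&` cylinder s' B) = (P (V @^-1` A) * P (cylinder s' B))%E.

Lemma measurable_cylinder s B : (forall i, measurable (B i)) -> measurable (cylinder s B).
Proof.
move=> mB; apply: fin_bigcap_measurable; first exact: finite_seq.
by move=> i _; rewrite -[X in measurable X]setTI; exact: measurable_funP.
Qed.

Lemma cylinder_cons i s B : cylinder (i :: s) B = X i @^-1` B i `&` cylinder s B.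
Proof.
apply/seteqP; split => [t h|t [h1 h2] j /=].
  by split=> [|j js]; apply: h; rewrite /= inE ?eqxx// js orbT.
by rewrite inE => /orP[/eqP->//|js]; exact: h2.
Qed.

Lemma cylinder_nil B : cylinder [::] B = setT.
Proof. by apply/seteqP; split => // t _ j. Qed.

Hypothesis indepX : mutually_independent X.

Lemma probability_cylinder_cons i s B : uniq (i :: s) -> (forall i, measurable (B i)) ->
  P (cylinder (i :: s) B) = (P (X i @^-1` B i) * P (cylinder s B))%E.
Proof.
move=> us mB; rewrite /cylinder !indepX// ?big_cons//.
by move: us => /= /andP[].
Qed.

Lemma indep_outside_cst dY (Y : measurableType dY) (y : Y) :
  indep_outside [::] (cst y : {mfun T >-> Y}).
Proof.
move=> A mA s us _ B mB; rewrite preimage_cst; case: ifPn => _.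
  by rewrite setTI probability_setT mul1e.
by rewrite set0I measure0 mul0e.
Qed.

Lemma indep_outside_comp dY (Y : measurableType dY) dY' (Y' : measurableType dY') s
    (V : {mfun T >-> Y}) (g : {mfun Y >-> Y'}) (W : {mfun T >-> Y'}) :
  (forall t, W t = g (V t)) -> indep_outside s V -> indep_outside s W.
Proof.
move=> WE hV A mA s' us' ss' B mB.
have -> : W @^-1` A = V @^-1` (g @^-1` A).
  by apply/seteqP; split => t /=; rewrite WE.
by apply: hV => //; rewrite -[X in measurable X]setTI; exact: measurable_funP.
Qed.

Section step.
Context dY (Y : measurableType dY) (s : seq I) (V : {mfun T >-> Y}) (i : I).
Context (VX : {mfun T >-> (Y * R)%type}).
Hypothesis VXE : forall t, VX t = (V t, X i t).
Hypothesis hV : indep_outside s V.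
Hypothesis si : i \notin s.

(** On rectangles this is [hV] combined with mutual independence. For a cylinder of positive
    probability, both sides divided by that probability are laws, of [VX] under the conditioned
    probability and a product law; they agree on rectangles, hence everywhere. *)
Let joint s' B : uniq s' -> (forall j, j \in s' -> j \notin i :: s) ->
  (forall j, measurable (B j)) ->
  forall D, measurable D -> P (VX @^-1` D `&` cylinder s' B) =
   ((distribution P V \x distribution P (X i)) D * P (cylinder s' B))%E.
Proof.
move=> us' ss' mB D mD; pose E := cylinder s' B.
have mE : measurable E by exact: measurable_cylinder.
have is' : i \notin s' by apply/negP => /ss'; rewrite inE eqxx.
have rect A C : measurable A -> measurable C ->
    P (VX @^-1` (A `*` C) `&` E) = (P (V @^-1` A) * P (X i @^-1` C) * P E)%E.
  move=> mA mC.
  (* The constraint on X_i is put into the cylinder itself; since i is not in s', [E] does not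
     change. *)
  pose B' j := if j == i then C else B j.
  have mB' j : measurable (B' j) by rewrite /B'; case: ifP.
  have EB' : E = cylinder s' B'.
    apply: eq_bigcapr => j /= js'; rewrite /B'; case: eqP => // ji.
    by move: is'; rewrite -ji js'.
  have -> : VX @^-1` (A `*` C) `&` E = V @^-1` A `&` cylinder (i :: s') B'.
    rewrite cylinder_cons -EB' /B' eqxx setIA; congr (_ `&` _).
    by apply/seteqP; split => t /=; rewrite VXE.
  rewrite hV//=; last 2 first.
  - by rewrite is'.
  - by move=> j; rewrite inE => /orP[/eqP->//|/ss']; rewrite inE negb_or => /andP[].
  rewrite probability_cylinder_cons//=; last by rewrite is'.
  by rewrite -EB' /B' eqxx muleA.
have PE_fin : P E \is a fin_num by exact: fin_num_measure.
have [PE0|PE0] := eqVneq (P E) 0%E.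
  rewrite PE0 mule0; apply/eqP; rewrite eq_le measure_ge0 andbT -PE0.
  by rewrite le_measure ?inE//; apply: measurableI => //; rewrite -[X in measurable X]setTI; exact: measurable_funP.
pose Q : probability T R := mnormalize (mrestr P mE) P.
have PE_pos : fine (P E) != 0 by rewrite fine_eq0.
have QE A : Q A = (P (A `&` E) * (fine (P E))^-1%:E)%E.
  rewrite /Q/= /mnormalize; case: ifPn => [h|_].
    have : (P (setT `&` E) == 0%E) || (P (setT `&` E) == +oo%E) by exact: h.
    by rewrite setTI (negbTE PE0)/= => /eqP h'; move: PE_fin; rewrite h'.
  by rewrite -[X in fine (P X)]setTI.
have dQ B0 : distribution Q VX B0 = (P (VX @^-1` B0 `&` E) * (fine (P E))^-1%:E)%E.
  exact: QE.
have key : ((distribution P V \x distribution P (X i)) D = distribution Q VX D)%E.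
  apply: product_measure_unique => // A C mA mC.
  have e := dQ (A `*` C); rewrite rect// in e; apply: (eq_trans e).
  by rewrite -muleA -[X in (_ * (X * _))%E](fineK PE_fin) -EFinM divff// mule1.
rewrite key [X in _ = (X * _)%E]dQ.
by rewrite -muleA -[X in (_ * (_ * X))%E](fineK PE_fin) -EFinM mulVf// mule1.
Qed.

Let law D : measurable D ->
  P (VX @^-1` D) = ((distribution P V \x distribution P (X i)) D)%E.
Proof.
move=> mD.
have := @joint [::] (fun=> setT) isT (fun j => False_ind _ \o notF) (fun=> measurableT) D mD.
by rewrite cylinder_nil setIT probability_setT mule1.
Qed.

Lemma indep_outside_pair : indep_outside (i :: s) VX.
Proof. by move=> A mA s' us' ss' B mB; rewrite joint// law. Qed.

Lemma indep_outside_expectation (f : Y -> R) (g : R -> R) :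
  measurable_fun setT f -> measurable_fun setT g ->
  intg P (fun t => f (V t)) -> intg P (fun t => g (X i t)) ->
  intg P (fun t => f (V t) * g (X i t)) /\
  \int[P]_t (f (V t) * g (X i t)) = \int[P]_t f (V t) * \int[P]_t g (X i t).
Proof.
move=> mf mg hf hg.
have mEf : measurable_fun setT (EFin \o f) by exact/measurable_EFinP.
have mEg : measurable_fun setT (EFin \o g) by exact/measurable_EFinP.
pose m1 := distribution P V; pose m2 := distribution P (X i).
have hf1 : intg m1 f by exact: integrable_pushforward.
have hg2 : intg m2 g by exact: integrable_pushforward.
pose F (z : Y * R) := f z.1 * g z.2.
have mF : measurable_fun setT F.
  by apply: measurable_funM; apply: measurableT_comp.
have FE t : f (V t) * g (X i t) = F (VX t) by rewrite VXE.
have Fle x y : `|F (x, y)| <= `|f x| * `|g y| by rewrite normrM.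
have [e1 e2 iF _] := @Rint_fubini R _ _ _ _ m1 m2 F _ _ mF
  (intg_norm hf1) (intg_norm hg2) Fle.
have eqm (h : Y * R -> \bar R) : (\int[m1 \x m2]_z h z = \int[distribution P VX]_z h z)%E.
  apply: eq_measure_integral => A mA _; first [exact: (law mA)|exact: (esym (law mA))].
have iFP : intg P (fun t => f (V t) * g (X i t)).
  apply/integrableP; split.
    by apply/measurable_EFinP; apply: measurable_funM; exact: measurableT_comp.
  under eq_integral do rewrite /= FE.
  rewrite -(@ge0_integral_distribution _ _ _ _ _ P VX (fun z => `|(F z)%:E|%E))//; last first.
    by apply: measurableT_comp => //; exact/measurable_EFinP.
  by rewrite -eqm; have /integrableP[] := iF.
split => //.
transitivity (\int[(m1 \x m2)%E]_z F z).
  rewrite /Rintegral eqm (@integral_distribution _ _ _ _ _ P VX (EFin \o F))//.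
  - by congr fine; apply: eq_integral => t _; rewrite /= FE.
  - exact/measurable_EFinP.
  - by apply: eq_integrable iFP => // t _; rewrite /= FE.
rewrite e2.
have -> : \int[P]_t f (V t) = \int[m1]_x f x.
  by rewrite /Rintegral /m1 (@integral_distribution _ _ _ _ _ P V (EFin \o f)).
have -> : \int[P]_t g (X i t) = \int[m2]_x g x.
  by rewrite /Rintegral /m2 (@integral_distribution _ _ _ _ _ P (X i) (EFin \o g)).
rewrite -RintegralZr//; apply: eq_Rintegral => x _.
by rewrite /F /= RintegralZl.
Qed.

End step.

End independence.

(** * Transforms of exponentially tilted sums *)

Section normal_expectation.
Context {R : realType}.
Notation leb := (@lebesgue_measure R).

(** The Radon-Nikodym derivative of the normal law and the normal density have the same integral
    over every measurable set, so they agree almost everywhere. *)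
Lemma ge0_integral_normal_prob (m s : R) (F : R -> \bar R) :
  measurable_fun setT F -> (forall x, 0 <= F x)%E ->
  (\int[normal_prob m s]_x F x = \int[leb]_x (F x * (normal_pdf m s x)%:E))%E.
Proof.
move=> mF F0; have dom := normal_prob_dominates m s.
rewrite -(Radon_Nikodym_SigmaFinite.change_of_variables dom F0 measurableT mF).
have mRN := measurable_int _ (Radon_Nikodym_SigmaFinite.f_integrable dom).
have mpdf : measurable_fun setT (EFin \o normal_pdf m s).
  by apply/measurable_EFinP; exact: measurable_normal_pdf.
apply: ae_eq_integral => //.
- exact: emeasurable_funM.
- exact: emeasurable_funM.
apply: (@filterS _ _ _ (fun x => setT x -> Radon_Nikodym_SigmaFinite.f (normal_prob m s) leb x = (normal_pdf m s x)%:E)).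
  by move=> x h /h ->.
apply: (@integral_ae_eq _ _ _ leb setT measurableT (EFin \o normal_pdf m s)) => //.
  exact: Radon_Nikodym_SigmaFinite.f_integrable.
by move=> E _ mE; rewrite -(Radon_Nikodym_SigmaFinite.f_integral dom).
Qed.

Context {dT : measure_display} {T : measurableType dT} (P : probability T R).

Lemma std_normal_expectation (X : {RV P >-> R}) (F : R -> R) : std_normal_rv X ->
  measurable_fun setT F -> intg leb (fun z => F z * gw 1 0 z) ->
  intg P (fun t => F (X t)) /\
  \int[P]_t F (X t) = (\int[leb]_z (F z * gw 1 0 z)) / gmass 1 0.
Proof.
move=> hX mF hF.
have g0 : gmass 1 0 != 0 :> R.
  by rewrite gt_eqF// mulr_gt0 ?expR_gt0// sqrtr_gt0 divr_gt0// mulr_gt0// pi_gt0.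
have pdfE z : normal_pdf 0 1 z = gw 1 0 z / gmass 1 0 :> R.
  by rewrite gw_normal// mul0r sqrtr1 invr1 mulrC mulKf.
have mX : measurable_fun setT (X : T -> measurableTypeR R) by exact: (measurable_funP X).
pose Y : {mfun T >-> measurableTypeR R} :=
  HB.pack (X : T -> measurableTypeR R) (isMeasurableFun.Build _ _ _ _ _ mX).
have ge0 (H : R -> R) : measurable_fun setT H -> (forall x, 0 <= H x) ->
    intg leb (fun z => H z * gw 1 0 z) ->
    (\int[P]_t (H (X t))%:E = ((\int[leb]_z (H z * gw 1 0 z)) / gmass 1 0)%:E)%E.
  move=> mH H0 hH.
  have mEH : measurable_fun setT (EFin \o H) by exact/measurable_EFinP.
  transitivity (\int[normal_prob 0 1]_y (H y)%:E)%E.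
    transitivity (\int[distribution P Y]_y (H y)%:E)%E.
      by rewrite ge0_integral_distribution.
    by apply: eq_measure_integral => A mA _; exact: hX.
  rewrite ge0_integral_normal_prob//.
  rewrite -RintegralZr// /Rintegral fineK.
    by apply: eq_integral => z _; rewrite /= -EFinM pdfE mulrA.
  by apply: integrable_fin_num => //; exact: intgZr.
have hN : intg leb (fun z => `|F z| * gw 1 0 z).
  by apply: eq_intg (intg_norm hF) => z; rewrite normrM (ger0_norm (gw_ge0 _ _ _)).
have mN : measurable_fun setT (fun z => `|F z|) by exact: measurableT_comp.
have mD : measurable_fun setT (fun z => `|F z| + F z) by exact: measurable_funD.
have hD : intg leb (fun z => (`|F z| + F z) * gw 1 0 z).
  by apply: eq_intg (intgD hN hF) => z; rewrite mulrDl.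
have iF : intg P (fun t => F (X t)).
  apply/integrableP; split; first by apply/measurable_EFinP; exact: measurableT_comp.
  have := ge0 _ mN (fun z => normr_ge0 (F z)) hN => /= ->.
  exact: ltry.
split => //.
have D0 z : 0 <= `|F z| + F z by rewrite -lerBlDr sub0r -normrN ler_norm.
(* A signed [F] is reduced to the nonnegative case as (|F| + F) - |F|. *)
have -> : \int[P]_t F (X t) = \int[P]_t (`|F (X t)| + F (X t)) - \int[P]_t `|F (X t)|.
  rewrite -RintegralB//; last 2 first.
  - by apply: intgD => //; exact: intg_norm.
  - exact: intg_norm.
  by apply: eq_Rintegral => t _; rewrite addrAC subrr add0r.
rewrite /Rintegral (ge0 _ mD D0 hD) (ge0 _ mN (fun z => normr_ge0 (F z)) hN)/=.
rewrite -mulrBl -RintegralB//; congr (_ / _).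
by apply: eq_Rintegral => z _; rewrite mulrDl addrAC subrr add0r.
Qed.

End normal_expectation.

(** * The transform of one tilted coordinate *)

Section tilted_coordinate.
Context {R : realType}.
Notation leb := (@lebesgue_measure R).
Variables (eta lam d : R).

(* For a standard normal Z and Y = d Z + lam Z^2, E[e^{(eta + i t) Y}] = tM e^{tA + i tB},
   and inserting the factor Z multiplies this by tre + i tim. *)
Definition tq : R := 1 - 2 * lam * eta.
Definition tM : R := gmass tq (eta * d) / gmass 1 0.
Definition tA (t : R) : R := gA tq (eta * d) lam d t.
Definition tB (t : R) : R := gB tq (eta * d) lam d t.
Definition tre (t : R) : R :=
  (eta * d * tq - 2 * lam * t ^+ 2 * d) / (tq ^+ 2 + (2 * lam * t) ^+ 2).
Definition tim (t : R) : R := t * d / (tq ^+ 2 + (2 * lam * t) ^+ 2).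

Hypothesis q0 : 0 < tq.

(** Tilting stays in the Gaussian family: the precision becomes 1 - 2 lam eta and the linear
    coefficient eta d. *)
Let tiltE z : expR (eta * (d * z + lam * z ^+ 2)) * gw 1 0 z = gw tq (eta * d) z.
Proof. by rewrite /gw -expRD /tq; congr expR; field. Qed.

Context {dT : measure_display} {T : measurableType dT} (P : probability T R).
Variable X : {RV P >-> R}.
Hypothesis hX : std_normal_rv X.

Let Y (t : T) := d * X t + lam * X t ^+ 2.

Let mquad : measurable_fun setT (fun z : R => d * z + lam * z ^+ 2).
Proof. by apply: measurable_funD; apply: measurable_funM => //; exact: measurable_funX. Qed.

Let mexp : measurable_fun setT (fun z : R => expR (eta * (d * z + lam * z ^+ 2))).
Proof. by apply: measurableT_comp => //; exact: measurable_funM. Qed.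

Lemma tilted_cos k t :
  intg P (fun x => X x ^+ k * (expR (eta * Y x) * cos (t * Y x))) /\
  \int[P]_x (X x ^+ k * (expR (eta * Y x) * cos (t * Y x))) =
  gcos tq (eta * d) lam d k t / gmass 1 0.
Proof.
pose F (z : R) := z ^+ k * (expR (eta * (d * z + lam * z ^+ 2)) * cos (t * (d * z + lam * z ^+ 2))).
have FE z : z ^+ k * cos (t * (d * z + lam * z ^+ 2)) * gw tq (eta * d) z = F z * gw 1 0 z.
  by rewrite -tiltE /F; ring.
have [] := @std_normal_expectation _ _ _ P X F hX.
- apply: measurable_funM; first exact: measurable_funX.
  apply: measurable_funM => //; apply: measurableT_comp.
    by apply: continuous_measurable_fun; exact: continuous_cos.
  exact: measurable_funM.
- apply: (@eq_intg _ _ _ leb _ _ FE); exact: intg_gcos _ _ _ q0 k t.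
move=> h1 h2; split; first exact: h1.
have e : \int[leb]_z (F z * gw 1 0 z) = gcos tq (eta * d) lam d k t.
  by apply: eq_Rintegral => z _; rewrite -FE.
by rewrite h2 e.
Qed.

Lemma tilted_sin k t :
  intg P (fun x => X x ^+ k * (expR (eta * Y x) * sin (t * Y x))) /\
  \int[P]_x (X x ^+ k * (expR (eta * Y x) * sin (t * Y x))) =
  gsin tq (eta * d) lam d k t / gmass 1 0.
Proof.
pose F (z : R) := z ^+ k * (expR (eta * (d * z + lam * z ^+ 2)) * sin (t * (d * z + lam * z ^+ 2))).
have FE z : z ^+ k * sin (t * (d * z + lam * z ^+ 2)) * gw tq (eta * d) z = F z * gw 1 0 z.
  by rewrite -tiltE /F; ring.
have [] := @std_normal_expectation _ _ _ P X F hX.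
- apply: measurable_funM; first exact: measurable_funX.
  apply: measurable_funM => //; apply: measurableT_comp.
    by apply: continuous_measurable_fun; exact: continuous_sin.
  exact: measurable_funM.
- apply: (@eq_intg _ _ _ leb _ _ FE); exact: intg_gsin _ _ _ q0 k t.
move=> h1 h2; split; first exact: h1.
have e : \int[leb]_z (F z * gw 1 0 z) = gsin tq (eta * d) lam d k t.
  by apply: eq_Rintegral => z _; rewrite -FE.
by rewrite h2 e.
Qed.

Lemma tilted_transform t :
  [/\ \int[P]_x (X x ^+ 0 * (expR (eta * Y x) * cos (t * Y x))) = tM * expR (tA t) * cos (tB t),
      \int[P]_x (X x ^+ 0 * (expR (eta * Y x) * sin (t * Y x))) = tM * expR (tA t) * sin (tB t),
      \int[P]_x (X x ^+ 1 * (expR (eta * Y x) * cos (t * Y x))) =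
        tM * expR (tA t) * (tre t * cos (tB t) - tim t * sin (tB t)) &
      \int[P]_x (X x ^+ 1 * (expR (eta * Y x) * sin (t * Y x))) =
        tM * expR (tA t) * (tre t * sin (tB t) + tim t * cos (tB t))].
Proof.
have [c0 s0] := gcos_gsinE (eta * d) lam d q0 t.
rewrite !(tilted_cos _ _).2 !(tilted_sin _ _).2 gcos1E// gsin1E// c0 s0.
have D0 : tq ^+ 2 + (2 * lam * t) ^+ 2 != 0.
  by rewrite gt_eqF// ltr_pwDl ?exprn_gt0// sqr_ge0.
have g0 : gmass 1 0 != 0 :> R.
  by rewrite gt_eqF// mulr_gt0 ?expR_gt0// sqrtr_gt0 divr_gt0// mulr_gt0// pi_gt0.
(* Collapses to t d the numerator of the imaginary part of (eta d + i t d) / (q - 2 i lam t). *)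
have dq : d = tq * d + 2 * lam * (eta * d) by rewrite /tq; ring.
have e2 : t * (tq * d + 2 * lam * (eta * d)) / (tq ^+ 2 + (2 * lam * t) ^+ 2) = tim t.
  by rewrite -dq.
rewrite -e2 /tM /tA /tB /tre.
move: (expR _) (cos (gB _ _ _ _ _)) (sin (gB _ _ _ _ _)) (gmass tq _) => E C S G.
by split; try (by rewrite mulrAC; congr (_ * _); ring);
  field; rewrite D0 g0.
Qed.

End tilted_coordinate.

(** * Sums of independent tilted coordinates *)

Section tilted_sum.
Context {R : realType} {dT : measure_display} {T : measurableType dT}.
Variable P : probability T R.
Context {I : eqType} (X : I -> {RV P >-> R}).
Variables (eta : R) (lam d w : I -> R).
Hypothesis indepX : mutually_independent X.
Hypothesis normalX : forall i, std_normal_rv (X i).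
Hypothesis q0 : forall i, 0 < tq eta (lam i).

Definition qsum (s : seq I) (x : T) : R := \sum_(i <- s) (d i * X i x + lam i * X i x ^+ 2).
Definition wsum (s : seq I) (x : T) : R := \sum_(i <- s) w i * X i x.

Definition sA s t : R := \sum_(i <- s) tA eta (lam i) (d i) t.
Definition sB s t : R := \sum_(i <- s) tB eta (lam i) (d i) t.
Definition sM s : R := \prod_(i <- s) tM eta (lam i) (d i).
Definition sre s t : R := \sum_(i <- s) w i * tre eta (lam i) (d i) t.
Definition sim s t : R := \sum_(i <- s) w i * tim eta (lam i) (d i) t.

Definition swap_add (i : I) (z : (R * R) * R) : R * R :=
  ((d i * z.2 + lam i * z.2 ^+ 2) + z.1.1, w i * z.2 + z.1.2).

Let mswap i : measurable_fun setT (swap_add i).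
Proof.
apply/measurable_fun_pairP; split => /=.
  apply: measurable_funD; last by apply: measurableT_comp => //; exact: measurable_fst.
  apply: measurable_funD; apply: measurable_funM => //.
  by apply: measurable_funX; exact: measurable_snd.
apply: measurable_funD; first exact: measurable_funM.
by apply: measurableT_comp => //; exact: measurable_snd.
Qed.

(** Both sums occur in the same expectation, so the induction has to carry them jointly in one
    vector-valued variable. *)
Lemma sum_pair_indep s : uniq s ->
  exists2 V : {mfun T >-> (R * R)%type}, indep_outside X s V &
    forall x, V x = (qsum s x, wsum s x).
Proof.
elim: s => [_|i s IH /= /andP[si us]].
  exists (cst (0, 0) : {mfun T >-> (R * R)%type}).
    exact: (indep_outside_cst X).
  by move=> x; rewrite /qsum /wsum !big_nil.
have [V hV VE] := IH us.
have mVX : measurable_fun setT (fun x => (V x, X i x)) by exact: measurable_fun_pair.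
pose VX : {mfun T >-> ((R * R) * R)%type} :=
  HB.pack (fun x => (V x, X i x)) (isMeasurableFun.Build _ _ _ _ _ mVX).
pose g : {mfun ((R * R) * R)%type >-> (R * R)%type} :=
  HB.pack (swap_add i) (isMeasurableFun.Build _ _ _ _ _ (mswap i)).
have mW : measurable_fun setT (fun x => g (VX x)) by exact: measurableT_comp.
pose W : {mfun T >-> (R * R)%type} :=
  HB.pack (fun x => g (VX x)) (isMeasurableFun.Build _ _ _ _ _ mW).
exists W.
  apply: (@indep_outside_comp _ _ _ _ _ X _ _ _ _ _ VX g W) => //.
  exact: (@indep_outside_pair _ _ _ _ _ X indepX _ _ s V i VX).
by move=> x; rewrite /W /= /swap_add/= VE /qsum /wsum !big_cons.
Qed.

Let mtrig (f : R -> R) t : continuous f ->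
  measurable_fun setT (fun z : R * R => expR (eta * z.1) * f (t * z.1)).
Proof.
move=> cf; apply: measurable_funM; apply: measurableT_comp => //.
- exact: measurable_funM.
- exact: continuous_measurable_fun.
- exact: measurable_funM.
Qed.

Let mtrig1 (f : R -> R) i t k : continuous f -> measurable_fun setT (fun z : R =>
  z ^+ k * (expR (eta * (d i * z + lam i * z ^+ 2)) * f (t * (d i * z + lam i * z ^+ 2)))).
Proof.
have mq : measurable_fun setT (fun z : R => d i * z + lam i * z ^+ 2).
  by apply: measurable_funD; apply: measurable_funM => //; exact: measurable_funX.
move=> cf; apply: measurable_funM; first exact: measurable_funX.
apply: measurable_funM; apply: measurableT_comp => //.
- exact: measurable_funM.
- exact: continuous_measurable_fun.
- exact: measurable_funM.
Qed.

(** Induction on the list. The complex exponentials multiply, and the weight w_i X_i + [wsum s]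
    splits the weighted transform into two products of independent factors; hence logarithms and
    ratios both add up over the coordinates. Integrability is proved along with the values, since
    each product formula needs it. *)
Lemma sum_transform s t : uniq s ->
  [/\ intg P (fun x => expR (eta * qsum s x) * cos (t * qsum s x)),
      intg P (fun x => expR (eta * qsum s x) * sin (t * qsum s x)),
      intg P (fun x => wsum s x * (expR (eta * qsum s x) * cos (t * qsum s x))) &
      intg P (fun x => wsum s x * (expR (eta * qsum s x) * sin (t * qsum s x)))] /\
  [/\ \int[P]_x (expR (eta * qsum s x) * cos (t * qsum s x)) =
        sM s * expR (sA s t) * cos (sB s t),
      \int[P]_x (expR (eta * qsum s x) * sin (t * qsum s x)) =
        sM s * expR (sA s t) * sin (sB s t),
      \int[P]_x (wsum s x * (expR (eta * qsum s x) * cos (t * qsum s x))) =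
        sM s * expR (sA s t) * (sre s t * cos (sB s t) - sim s t * sin (sB s t)) &
      \int[P]_x (wsum s x * (expR (eta * qsum s x) * sin (t * qsum s x))) =
        sM s * expR (sA s t) * (sre s t * sin (sB s t) + sim s t * cos (sB s t))].
Proof.
elim: s => [_|i s IH /= /andP[si us]].
  have e (f : T -> R) k : (forall x, f x = k) -> intg P f /\ \int[P]_x f x = k.
    move=> /funext ->; split; first exact: finite_measure_integrable_cst.
    rewrite Rintegral_cst// [fine _](_ : _ = 1) ?mulr1//.
  exact: (congr1 fine (probability_setT P)).
  rewrite /sM /sA /sB /sre /sim !big_nil expR0 cos0 sin0.
  have e1 x : expR (eta * qsum [::] x) * cos (t * qsum [::] x) = 1.
    by rewrite /qsum big_nil !mulr0 expR0 cos0 mul1r.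
  have e2 x : expR (eta * qsum [::] x) * sin (t * qsum [::] x) = 0.
    by rewrite /qsum big_nil !mulr0 sin0 mulr0.
  have e3 (y : R) x : wsum [::] x * y = 0 by rewrite /wsum big_nil mul0r.
  have [i1 ->] := e _ _ e1; have [i2 ->] := e _ _ e2.
  have [i3 ->] := e _ _ (fun x => e3 (expR (eta * qsum [::] x) * cos (t * qsum [::] x)) x).
  have [i4 ->] := e _ _ (fun x => e3 (expR (eta * qsum [::] x) * sin (t * qsum [::] x)) x).
  by split; split => //; ring.
have [[i1 i2 i3 i4] [h1 h2 h3 h4]] := IH us.
have [V hV VE] := sum_pair_indep us.
have mVX : measurable_fun setT (fun x => (V x, X i x)) by exact: measurable_fun_pair.
pose VX : {mfun T >-> ((R * R) * R)%type} :=
  HB.pack (fun x => (V x, X i x)) (isMeasurableFun.Build _ _ _ _ _ mVX).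
have key := @indep_outside_expectation _ _ _ P _ X indepX _ _ s V i VX (fun=> erefl) hV si.
have [g1 g2 g3 g4] := tilted_transform (d i) (q0 i) (normalX i) t.
pose y x := d i * X i x + lam i * X i x ^+ 2.
pose a1 x := expR (eta * qsum s x) * cos (t * qsum s x).
pose a2 x := expR (eta * qsum s x) * sin (t * qsum s x).
pose a3 x := wsum s x * a1 x.
pose a4 x := wsum s x * a2 x.
pose b1 x := X i x ^+ 0 * (expR (eta * y x) * cos (t * y x)).
pose b2 x := X i x ^+ 0 * (expR (eta * y x) * sin (t * y x)).
pose b3 x := X i x ^+ 1 * (expR (eta * y x) * cos (t * y x)).
pose b4 x := X i x ^+ 1 * (expR (eta * y x) * sin (t * y x)).
have cC := @continuous_cos R; have cS := @continuous_sin R.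
have key' (a b : T -> R) : 
    (exists2 f : R * R -> R, measurable_fun setT f & forall x, a x = f (V x)) -> intg P a ->
    (exists2 g : R -> R, measurable_fun setT g & forall x, b x = g (X i x)) -> intg P b ->
    intg P (fun x => a x * b x) /\ \int[P]_x (a x * b x) = \int[P]_x a x * \int[P]_x b x.
  move=> [f mf /funext ->] ia [g mg /funext ->] ib; exact: key.
have msnd : measurable_fun setT (fun z : R * R => z.2) by exact: measurable_snd.
have A1 : exists2 f : R * R -> R, measurable_fun setT f & forall x, a1 x = f (V x).
  by exists (fun z : R * R => expR (eta * z.1) * cos (t * z.1)); [exact: mtrig|move=> x; rewrite VE].
have A2 : exists2 f : R * R -> R, measurable_fun setT f & forall x, a2 x = f (V x).
  by exists (fun z : R * R => expR (eta * z.1) * sin (t * z.1)); [exact: mtrig|move=> x; rewrite VE].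
have A3 : exists2 f : R * R -> R, measurable_fun setT f & forall x, a3 x = f (V x).
  exists (fun z : R * R => z.2 * (expR (eta * z.1) * cos (t * z.1))); last by move=> x; rewrite VE.
  by apply: measurable_funM => //; exact: mtrig.
have A4 : exists2 f : R * R -> R, measurable_fun setT f & forall x, a4 x = f (V x).
  exists (fun z : R * R => z.2 * (expR (eta * z.1) * sin (t * z.1))); last by move=> x; rewrite VE.
  by apply: measurable_funM => //; exact: mtrig.
have B1 : exists2 g : R -> R, measurable_fun setT g & forall x, b1 x = g (X i x).
  by eexists; [exact: (mtrig1 i t 0 cC)|].
have B2 : exists2 g : R -> R, measurable_fun setT g & forall x, b2 x = g (X i x).
  by eexists; [exact: (mtrig1 i t 0 cS)|].
have B3 : exists2 g : R -> R, measurable_fun setT g & forall x, b3 x = g (X i x).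
  by eexists; [exact: (mtrig1 i t 1 cC)|].
have B4 : exists2 g : R -> R, measurable_fun setT g & forall x, b4 x = g (X i x).
  by eexists; [exact: (mtrig1 i t 1 cS)|].
have j1 : intg P b1 by exact: (tilted_cos (d i) (q0 i) (normalX i) 0 t).1.
have j2 : intg P b2 by exact: (tilted_sin (d i) (q0 i) (normalX i) 0 t).1.
have j3 : intg P b3 by exact: (tilted_cos (d i) (q0 i) (normalX i) 1 t).1.
have j4 : intg P b4 by exact: (tilted_sin (d i) (q0 i) (normalX i) 1 t).1.
have [k11 e11] := key' _ _ A1 i1 B1 j1; have [k12 e12] := key' _ _ A1 i1 B2 j2.
have [k13 e13] := key' _ _ A1 i1 B3 j3; have [k14 e14] := key' _ _ A1 i1 B4 j4.
have [k21 e21] := key' _ _ A2 i2 B1 j1; have [k22 e22] := key' _ _ A2 i2 B2 j2.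
have [k23 e23] := key' _ _ A2 i2 B3 j3; have [k24 e24] := key' _ _ A2 i2 B4 j4.
have [k31 e31] := key' _ _ A3 i3 B1 j1; have [k32 e32] := key' _ _ A3 i3 B2 j2.
have [k41 e41] := key' _ _ A4 i4 B1 j1; have [k42 e42] := key' _ _ A4 i4 B2 j2.
have qE x : qsum (i :: s) x = y x + qsum s x by rewrite /qsum big_cons.
have wE x : wsum (i :: s) x = w i * X i x + wsum s x by rewrite /wsum big_cons.
have F1 : (fun x => expR (eta * qsum (i :: s) x) * cos (t * qsum (i :: s) x)) =
    fun x => a1 x * b1 x - a2 x * b2 x.
  apply/funext => x; rewrite qE (mulrDr eta) (mulrDr t) expRD cosD /a1 /a2 /b1 /b2; ring.
have F2 : (fun x => expR (eta * qsum (i :: s) x) * sin (t * qsum (i :: s) x)) =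
    fun x => a1 x * b2 x + a2 x * b1 x.
  apply/funext => x; rewrite qE (mulrDr eta) (mulrDr t) expRD sinD /a1 /a2 /b1 /b2; ring.
have F3 : (fun x => wsum (i :: s) x * (expR (eta * qsum (i :: s) x) * cos (t * qsum (i :: s) x))) =
    fun x => (a3 x * b1 x - a4 x * b2 x) + w i * (a1 x * b3 x - a2 x * b4 x).
  apply/funext => x; rewrite qE wE (mulrDr eta) (mulrDr t) expRD cosD /a3 /a4 /a1 /a2 /b1 /b2 /b3 /b4; ring.
have F4 : (fun x => wsum (i :: s) x * (expR (eta * qsum (i :: s) x) * sin (t * qsum (i :: s) x))) =
    fun x => (a3 x * b2 x + a4 x * b1 x) + w i * (a1 x * b4 x + a2 x * b3 x).
  apply/funext => x; rewrite qE wE (mulrDr eta) (mulrDr t) expRD sinD /a3 /a4 /a1 /a2 /b1 /b2 /b3 /b4; ring.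
rewrite F1 F2 F3 F4; split.
  by split; [exact: intgB|exact: intgD|apply: intgD; [exact: intgB|by apply: intgZl; exact: intgB]
    |apply: intgD; [exact: intgD|by apply: intgZl; exact: intgD]].
have sAE : sA (i :: s) t = tA eta (lam i) (d i) t + sA s t by rewrite /sA big_cons.
have sBE : sB (i :: s) t = tB eta (lam i) (d i) t + sB s t by rewrite /sB big_cons.
have sME : sM (i :: s) = tM eta (lam i) (d i) * sM s by rewrite /sM big_cons.
have sreE : sre (i :: s) t = w i * tre eta (lam i) (d i) t + sre s t by rewrite /sre big_cons.
have simE : sim (i :: s) t = w i * tim eta (lam i) (d i) t + sim s t by rewrite /sim big_cons.
rewrite sAE sBE sME sreE simE expRD cosD sinD.
split.
- rewrite RintegralB// e11 e22 h1 h2 g1 g2; ring.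
- rewrite RintegralD// e12 e21 h1 h2 g1 g2; ring.
- rewrite RintegralD//; [|exact: intgB|by apply: intgZl; exact: intgB].
  rewrite RintegralZl//; last exact: intgB.
  rewrite !RintegralB// e31 e42 e13 e24 h1 h2 h3 h4 g1 g2 g3 g4; ring.
- rewrite RintegralD//; [|exact: intgD|by apply: intgZl; exact: intgD].
  rewrite RintegralZl//; last exact: intgD.
  rewrite !RintegralD// e32 e41 e14 e23 h1 h2 h3 h4 g1 g2 g3 g4; ring.
Qed.

End tilted_sum.

(** * Fourier inversion *)

(** Almost everywhere convergence is what windows and half-lines allow: at a jump of the test
    function its mollifications need not converge to its value. *)
Lemma Rint_dct_ae (R : realType) dT (T : measurableType dT) (mu : {measure set T -> \bar R})
    (F : nat -> T -> R) (f g : T -> R) :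
  (forall n, measurable_fun setT (F n)) -> measurable_fun setT f ->
  {ae mu, forall x, F n x @[n --> \oo] --> f x} ->
  intg mu g -> (forall n x, `|F n x| <= g x) ->
  \int[mu]_x F n x @[n --> \oo] --> \int[mu]_x f x.
Proof.
move=> mF mf Ff hg Fg.
have [] := @dominated_convergence _ _ _ mu setT measurableT
  (fun n => EFin \o F n) (EFin \o f) (EFin \o g) => //.
- by move=> n; exact/measurable_EFinP.
- exact/measurable_EFinP.
- by apply: filterS Ff => x h _; apply: cvg_EFin h; exact: nearW.
- by apply: aeW => x n _; rewrite /= lee_fin.
move=> hf _ cv.
by apply: fine_cvg; rewrite fineK; [exact: cv|exact: integrable_fin_num].
Qed.

Section gaussian_moments.
Context {R : realType}.
Notation leb := (@lebesgue_measure R).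
Implicit Types q b : R.

Definition gmom q b k : R := \int[leb]_z (z ^+ k * gw q b z).

Lemma intg_gmom q b k : 0 < q -> intg leb (fun z => z ^+ k * gw q b z).
Proof.
move=> q0; apply: (@eq_intg _ _ _ leb _ _ _ (intg_gcos b 0 0 q0 k 0)) => z.
by rewrite mul0r cos0 mulr1.
Qed.

(** Stein's identity at t = 0. It supplies the variance of the mollifier and the even moments for
    Laplace's method. *)
Lemma gmom_rec q b k : 0 < q -> q * gmom q b k.+1 = k%:R * gmom q b k.-1 + b * gmom q b k.
Proof.
move=> q0; have e j : gcos q b 0 0 j 0 = gmom q b j.
  by apply: eq_Rintegral => z _; rewrite mul0r cos0 mulr1.
by have := stein_cos b 0 0 q0 k 0; rewrite !e; lra.
Qed.

Lemma gmom0 q b : 0 < q -> gmom q b 0 = gmass q b.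
Proof. by move=> q0; rewrite -Rint_gw//; apply: eq_Rintegral => z _; rewrite mul1r. Qed.

Lemma gmass_gt0 q b : 0 < q -> 0 < gmass q b.
Proof.
by move=> q0; rewrite mulr_gt0 ?expR_gt0// sqrtr_gt0 divr_gt0// mulr_gt0// pi_gt0.
Qed.

Lemma gw_translate q b z : gw q 0 (b - z) = expR (- (q / 2) * b ^+ 2) * gw q (q * b) z.
Proof. by rewrite /gw -expRD; congr expR; field. Qed.

Lemma gmass_translate q b : 0 < q -> expR (- (q / 2) * b ^+ 2) * gmass q (q * b) = gmass q 0.
Proof.
move=> q0; rewrite /gmass mulrCA -expRD; congr (_ * expR _).
by field; exact: lt0r_neq0.
Qed.

Lemma Rint_gw_translate q b : 0 < q -> \int[leb]_z gw q 0 (b - z) = gmass q 0.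
Proof.
move=> q0; under eq_Rintegral do rewrite gw_translate.
by rewrite RintegralZl//; [rewrite Rint_gw// gmass_translate|exact: intg_gw].
Qed.

Lemma intg_gw_translate q b : 0 < q -> intg leb (fun z => gw q 0 (b - z)).
Proof.
move=> q0; apply: (@eq_intg _ _ _ leb _ _ _ (intgZl (expR (- (q / 2) * b ^+ 2)) (intg_gw (q * b) q0))) => z.
by rewrite gw_translate.
Qed.

Lemma Rint_sqr_gw_translate q b : 0 < q ->
  intg leb (fun z => (z - b) ^+ 2 * gw q 0 (b - z)) /\
  \int[leb]_z ((z - b) ^+ 2 * gw q 0 (b - z)) = gmass q 0 / q.
Proof.
move=> q0; pose E := expR (- (q / 2) * b ^+ 2).
have i k := intg_gmom (q * b) k q0.
have FE z : (z - b) ^+ 2 * gw q 0 (b - z) =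
  E * ((z ^+ 2 * gw q (q * b) z - (2 * b) * (z ^+ 1 * gw q (q * b) z)) + b ^+ 2 * (z ^+ 0 * gw q (q * b) z)).
  by rewrite gw_translate -/E; ring.
have i' : intg leb (fun z => (z ^+ 2 * gw q (q * b) z - (2 * b) * (z ^+ 1 * gw q (q * b) z)) + b ^+ 2 * (z ^+ 0 * gw q (q * b) z)).
  by apply: intgD; [apply: intgB => //; exact: intgZl|exact: intgZl].
split.
  by apply: (@eq_intg _ _ _ leb _ _ _ (intgZl E i')) => z; rewrite FE.
under eq_Rintegral do rewrite FE.
rewrite RintegralZl// RintegralD//; [|by apply: intgB => //; exact: intgZl|exact: intgZl].
rewrite RintegralB//; last exact: intgZl.
rewrite !RintegralZl// -!/(gmom _ _ _).
have q1 := lt0r_neq0 q0.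
have m1 : gmom q (q * b) 1 = b * gmom q (q * b) 0.
  by apply: (mulfI q1); rewrite gmom_rec//= mul0r add0r mulrA.
have m2 : gmom q (q * b) 2 = (q^-1 + b ^+ 2) * gmom q (q * b) 0.
  by apply: (mulfI q1); rewrite gmom_rec//= m1; field.
rewrite m1 m2 gmom0// -(gmass_translate b q0) -/E.
  by rewrite Rint_gw//; field.
exact: intg_gw.
Qed.

(** The case lam = 0, d = 1 of [gcos_gsinE], where the exponent is purely quadratic and the phase
    vanishes. *)
Lemma gw_fourier p u : 0 < p ->
  \int[leb]_t (cos (u * t) * gw p^-1 0 t) = 2 * pi / gmass p 0 * gw p 0 u.
Proof.
move=> p0; have p0' : 0 < p^-1 by rewrite invr_gt0.
have p1 := lt0r_neq0 p0.
transitivity (gcos p^-1 0 0 1 0 u).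
  by apply: eq_Rintegral => z _; rewrite expr0 mul1r mul1r mul0r addr0.
rewrite (gcos_gsinE 0 0 1 p0' u).1.
have -> : gB p^-1 0 0 1 u = 0.
  by rewrite /gB !(mul0r, mulr0, atan0, addr0, subr0).
have -> : gA p^-1 0 0 1 u = - (p / 2) * u ^+ 2 + 0 * u.
  by rewrite /gA !(mul0r, mulr0, expr0n, addr0, ln1, invrK, expr1n)/=; field.
rewrite cos0 mulr1 -/(gw p 0 u); congr (_ * _).
rewrite /gmass expr0n/= !mul0r expR0 !mulr1 invrK.
have P0 : 0 <= 2 * pi / p by rewrite divr_ge0 ?mulr_ge0 ?pi_ge0// ltW.
have P1 : Num.sqrt (2 * pi / p) != 0.
  by rewrite gt_eqF// sqrtr_gt0 divr_gt0// mulr_gt0// pi_gt0.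
apply: (mulIf P1); rewrite divfK// -sqrtrM; last by rewrite mulr_ge0 ?mulr_ge0 ?pi_ge0// ltW.
have -> : 2 * pi * p * (2 * pi / p) = (2 * pi) ^+ 2 by field.
by rewrite sqrtr_sqr ger0_norm// mulr_ge0 ?pi_ge0.
Qed.

End gaussian_moments.

(** * Inversion by Gaussian mollification *)

Section fourier_inversion.
Context {R : realType} {dT : measure_display} {T : measurableType dT}.
Notation leb := (@lebesgue_measure R).
Variable P : probability T R.
Variables (X S : T -> R) (hC hS M : R -> R).
Hypothesis iX : intg P X.
Hypothesis mS : measurable_fun setT S.
Hypothesis hCE : forall t, \int[P]_x (X x * cos (t * S x)) = hC t.
Hypothesis hSE : forall t, \int[P]_x (X x * sin (t * S x)) = hS t.
Hypothesis mC : measurable_fun setT hC.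
Hypothesis mSn : measurable_fun setT hS.
Hypothesis CM : forall t, `|hC t| <= M t.
Hypothesis SM : forall t, `|hS t| <= M t.
Hypothesis iM : intg leb M.
Hypothesis iM1 : intg leb (fun t => `|t| * M t).

(** When C + i Sn is the transform E[X e^{itS}], this is 2 pi times the density at y of the signed
    measure E[X; S in .]. The factor 2 pi is kept on the other side of every identity. *)
Definition density (C Sn : R -> R) (y : R) : R :=
  \int[leb]_t (cos (t * y) * C t + sin (t * y) * Sn t).

Let mX : measurable_fun setT X. Proof. exact: intg_measurable iX. Qed.

Let mcos : measurable_fun setT (@cos R).
Proof. by apply: continuous_measurable_fun; exact: continuous_cos. Qed.

Let msin : measurable_fun setT (@sin R).
Proof. by apply: continuous_measurable_fun; exact: continuous_sin. Qed.

Lemma cos_sin_norm_le (y c s m : R) : `|c| <= m -> `|s| <= m -> `|cos y * c + sin y * s| <= 2 * m.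
Proof.
move=> cm sm; rewrite (le_trans (ler_normD _ _))// mulrDl mul1r lerD// normrM.
  by rewrite (le_trans _ cm)// ler_piMl// ler_norml cos_geN1 cos_le1.
by rewrite (le_trans _ sm)// ler_piMl// ler_norml sin_geN1 sin_le1.
Qed.

Lemma cos_lipschitz (x y : R) : `|cos x - cos y| <= `|x - y|.
Proof.
wlog xy : x y / x <= y.
  by move=> h; case: (leP x y) => [/h//|/ltW/h]; rewrite distrC [leRHS]distrC.
have [z _ e] := @MVT_segment R cos (fun z => - sin z) x y xy (fun z _ => is_derive_cos z)
  (continuous_subspaceT (@continuous_cos R)).
rewrite distrC e normrM normrN [leRHS]distrC ler_piMl//.
by rewrite ler_norml sin_geN1 sin_le1.
Qed.

Lemma sin_lipschitz (x y : R) : `|sin x - sin y| <= `|x - y|.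
Proof.
wlog xy : x y / x <= y.
  by move=> h; case: (leP x y) => [/h//|/ltW/h]; rewrite distrC [leRHS]distrC.
have [z _ e] := @MVT_segment R sin cos x y xy (fun z _ => is_derive_sin z)
  (continuous_subspaceT (@continuous_sin R)).
rewrite distrC e normrM [leRHS]distrC ler_piMl//.
by rewrite ler_norml cos_geN1 cos_le1.
Qed.

Let density_int (C Sn : R -> R) (y : R) : measurable_fun setT C -> measurable_fun setT Sn ->
  (forall t, `|C t| <= M t) -> (forall t, `|Sn t| <= M t) ->
  intg leb (fun t => cos (t * y) * C t + sin (t * y) * Sn t).
Proof.
move=> mC' mS' C' S'; apply: (@intg_le _ _ _ leb _ (fun t => 2 * M t)).
- apply: measurable_funD; apply: measurable_funM => //; apply: measurableT_comp => //;
    exact: measurable_funM.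
- by move=> t; exact: cos_sin_norm_le.
- exact: intgZl.
Qed.

Lemma density_bound (C Sn : R -> R) (y : R) : measurable_fun setT C -> measurable_fun setT Sn ->
  (forall t, `|C t| <= M t) -> (forall t, `|Sn t| <= M t) ->
  `|density C Sn y| <= 2 * \int[leb]_t M t.
Proof.
move=> mC' mS' C' S'; rewrite -RintegralZl//; apply: Rint_norm_le.
- exact: intg_measurable (density_int y mC' mS' C' S').
- by move=> t; exact: cos_sin_norm_le.
- exact: intgZl.
Qed.

(** Cosine and sine are 1-Lipschitz, so the integrand changes by at most 2 |t| |y - z| M(t). *)
Lemma density_lipschitz (C Sn : R -> R) (y z : R) : measurable_fun setT C -> measurable_fun setT Sn ->
  (forall t, `|C t| <= M t) -> (forall t, `|Sn t| <= M t) ->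
  `|density C Sn y - density C Sn z| <= `|y - z| * (2 * \int[leb]_t (`|t| * M t)).
Proof.
move=> mC' mS' C' S'; have i1 := density_int y mC' mS' C' S'.
have i2 := density_int z mC' mS' C' S'.
have i3 := intgZl 2 iM1.
rewrite /density -RintegralB// -RintegralZl// -RintegralZl//.
apply: Rint_norm_le.
- exact: intg_measurable (intgB i1 i2).
- move=> t.
  have -> : cos (t * y) * C t + sin (t * y) * Sn t - (cos (t * z) * C t + sin (t * z) * Sn t) =
    (cos (t * y) - cos (t * z)) * C t + (sin (t * y) - sin (t * z)) * Sn t by ring.
  have -> : `|y - z| * (2 * (`|t| * M t)) = `|t * (y - z)| * M t + `|t * (y - z)| * M t.
    by rewrite normrM; ring.
  rewrite (le_trans (ler_normD _ _))// lerD// normrM ler_pM//.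
    by rewrite mulrBr cos_lipschitz.
  by rewrite mulrBr sin_lipschitz.
- exact: intgZl.
Qed.

Lemma lipschitz_measurable (f : R -> R) (L : R) :
  (forall x y, `|f x - f y| <= `|x - y| * L) -> measurable_fun setT f.
Proof.
move=> fL; apply: continuous_measurable_fun => x; apply/cvgrPdist_le => e e0.
have L1 : 0 < `|L| + 1 by rewrite ltr_wpDl.
near=> y; rewrite (le_trans (fL x y))//.
rewrite (@le_trans _ _ (`|x - y| * (`|L| + 1)))//.
  by rewrite ler_wpM2l// (le_trans (ler_norm L))// lerDl.
rewrite -ler_pdivlMr//; near: y.
by apply: cvgr_dist_le; [exact: cvg_id|rewrite divr_gt0].
Unshelve. all: by end_near. Qed.

(** The Gaussian in S - y is written as a Fourier integral and the two integrals are exchanged. The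
    Gaussian factor in t makes this legitimate whatever the law of [S]. *)
Lemma mollified_weight p y : 0 < p ->
  2 * pi / gmass p 0 * \int[P]_x (X x * gw p 0 (S x - y)) =
  density (fun t => gw p^-1 0 t * hC t) (fun t => gw p^-1 0 t * hS t) y.
Proof.
move=> p0; have p0' : 0 < p^-1 by rewrite invr_gt0.
have mgw := @measurable_gw R.
pose F (z : T * measurableTypeR R) := X z.1 * (cos ((S z.1 - y) * z.2) * gw p^-1 0 z.2).
have mF : measurable_fun setT F.
  apply: measurable_funM; first exact: measurableT_comp.
  apply: measurable_funM.
    apply: measurableT_comp => //; apply: measurable_funM => //.
    by apply: measurable_funB => //; exact: measurableT_comp.
  by apply: measurableT_comp => //; exact: mgw.
have Fle x t : `|F (x, t)| <= `|X x| * gw p^-1 0 t.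
  rewrite /F/= !normrM (ger0_norm (gw_ge0 _ _ _)) ler_wpM2l// ler_piMl ?gw_ge0//.
  by rewrite ler_norml cos_geN1 cos_le1.
have [e _ _ _] := @Rint_fubini R _ _ _ _ P leb F _ _ mF (intg_norm iX) (intg_gw 0 p0') Fle.
have icos u : intg leb (fun t => cos (u * t) * gw p^-1 0 t).
  have mm : measurable_fun setT (fun t : R => cos (u * t) * gw p^-1 0 t).
    apply: measurable_funM; last exact: mgw.
    by apply: measurableT_comp => //; exact: measurable_funM.
  apply: (@intg_le _ _ _ leb _ (gw p^-1 0)) => //.
  - move=> t; rewrite normrM (ger0_norm (gw_ge0 _ _ _)) ler_piMl ?gw_ge0//.
    by rewrite ler_norml cos_geN1 cos_le1.
  - exact: intg_gw.
have iXg : intg P (fun x => X x * gw p 0 (S x - y)).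
  apply: (@intg_le _ _ _ P _ (fun x => `|X x|)).
  - apply: measurable_funM => //; apply: measurableT_comp; first exact: mgw.
    exact: measurable_funB.
  - move=> x; rewrite normrM (ger0_norm (gw_ge0 _ _ _)) ler_piMr//.
    rewrite /gw -expR0 ler_expR mul0r addr0 mulNr oppr_le0.
    by rewrite mulr_ge0 ?sqr_ge0// divr_ge0// ltW.
  - exact: intg_norm.
rewrite -RintegralZl//.
transitivity (\int[P]_x (\int[leb]_t F (x, t))).
  apply: eq_Rintegral => x _; rewrite /F/= RintegralZl// gw_fourier//.
  by ring.
rewrite e; apply: eq_Rintegral => t _.
have iXt (f : R -> R) : measurable_fun setT f -> (forall x, `|f x| <= 1) ->
    intg P (fun x => X x * f (t * S x)).
  move=> mf f1; apply: (@intg_le _ _ _ P _ (fun x => `|X x|)).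
  - apply: measurable_funM => //; apply: measurableT_comp => //.
    exact: measurable_funM.
  - by move=> x; rewrite normrM ler_piMr.
  - exact: intg_norm.
have iXc : intg P (fun x => X x * cos (t * S x)).
  by apply: iXt => // x; rewrite ler_norml cos_geN1 cos_le1.
have iXs : intg P (fun x => X x * sin (t * S x)).
  by apply: iXt => // x; rewrite ler_norml sin_geN1 sin_le1.
rewrite -hCE -hSE.
transitivity (\int[P]_x (gw p^-1 0 t * (cos (t * y) * (X x * cos (t * S x)) + sin (t * y) * (X x * sin (t * S x))))).
  apply: eq_Rintegral => x _; rewrite /F/=.
  have -> : (S x - y) * t = t * S x - t * y by ring.
  by rewrite cosB; ring.
rewrite RintegralZl//; last by apply: intgD; exact: intgZl.
rewrite RintegralD//; [|exact: intgZl|exact: intgZl].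
by rewrite !RintegralZl//; ring.
Qed.

(** Convolution with the normal density of mean 0 and variance 1/p. *)
Definition mollify (f : R -> R) (p x : R) : R :=
  (gmass p 0)^-1 * \int[leb]_y (f y * gw p 0 (x - y)).

Let gw_le1 (p z : R) : 0 < p -> gw p 0 z <= 1.
Proof.
move=> p0; rewrite /gw -expR0 ler_expR mul0r addr0 mulNr oppr_le0.
by rewrite mulr_ge0 ?sqr_ge0// divr_ge0// ltW.
Qed.

Let mgwx (p x : R) : measurable_fun setT (fun y : R => gw p 0 (x - y)).
Proof.
by apply: measurableT_comp; [exact: measurable_gw|exact: measurable_funB].
Qed.

Section mollification.
Variables (f : R -> R) (K : R).
Hypothesis mf : measurable_fun setT f.
Hypothesis fK : forall y, `|f y| <= K.

Let intg_fgw (p x : R) : 0 < p -> intg leb (fun y => f y * gw p 0 (x - y)).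
Proof.
move=> p0; have mm : measurable_fun setT (fun y => f y * gw p 0 (x - y)) by exact: measurable_funM.
apply: (@intg_le _ _ _ leb _ (fun y => K * gw p 0 (x - y))) => //.
- by move=> y; rewrite normrM (ger0_norm (gw_ge0 _ _ _)) ler_wpM2r ?gw_ge0.
- by apply: intgZl; exact: intg_gw_translate.
Qed.

Lemma mollify_bound (p x : R) : 0 < p -> `|mollify f p x| <= K.
Proof.
move=> p0; have g0 := gmass_gt0 0 p0.
rewrite /mollify normrM gtr0_norm ?invr_gt0// mulrC ler_pdivrMr//.
rewrite -(Rint_gw_translate x p0) -RintegralZl//; last exact: intg_gw_translate.
apply: Rint_norm_le.
- exact: intg_measurable (intg_fgw x p0).
- by move=> y; rewrite normrM (ger0_norm (gw_ge0 _ _ _)) ler_wpM2r ?gw_ge0.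
- by apply: intgZl; exact: intg_gw_translate.
Qed.

(** A modulus k + L (y - x)^2 integrates exactly against the mollifier, whose variance is 1/p; no
    splitting into near and far points is required. *)
Lemma mollify_dist (p x k L : R) : 0 < p ->
  (forall y, `|f y - f x| <= k + L * (y - x) ^+ 2) -> `|mollify f p x - f x| <= k + L / p.
Proof.
move=> p0 h; have g0 := gmass_gt0 0 p0.
have [i2 e2] := Rint_sqr_gw_translate x p0.
have i0 := intg_gw_translate x p0.
have -> : f x = (gmass p 0)^-1 * \int[leb]_y (f x * gw p 0 (x - y)).
  by rewrite RintegralZl// Rint_gw_translate// mulrC mulfK// gt_eqF.
rewrite /mollify -mulrBr normrM gtr0_norm ?invr_gt0// mulrC ler_pdivrMr//.
rewrite -RintegralB//; [|exact: intg_fgw|exact: intgZl].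
have -> : (k + L / p) * gmass p 0 =
    \int[leb]_y (k * gw p 0 (x - y) + L * ((y - x) ^+ 2 * gw p 0 (x - y))).
  rewrite RintegralD//; [|exact: intgZl|exact: intgZl].
  by rewrite !RintegralZl// e2 Rint_gw_translate//; ring.
apply: Rint_norm_le.
- by apply: intg_measurable (intgB (intg_fgw x p0) (intgZl _ i0)).
- move=> y; rewrite -mulrBl normrM (ger0_norm (gw_ge0 _ _ _)) mulrA -mulrDl.
  by rewrite ler_wpM2r ?gw_ge0.
- by apply: intgD; exact: intgZl.
Qed.

Hypothesis if_ : intg leb f.

Let gwM (p t : R) (h : R -> R) : 0 < p -> `|h t| <= M t -> `|gw p 0 t * h t| <= M t.
Proof.
move=> p0 hM; rewrite normrM (ger0_norm (gw_ge0 _ _ _)) (le_trans _ hM)//.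
by rewrite ler_piMl// gw_le1.
Qed.

Lemma mollified_inversion (p : R) : 0 < p ->
  intg P (fun x => X x * mollify f p (S x)) /\
  2 * pi * \int[P]_x (X x * mollify f p (S x)) =
  \int[leb]_y (f y * density (fun t => gw p^-1 0 t * hC t) (fun t => gw p^-1 0 t * hS t) y).
Proof.
move=> p0; have g0 := gmass_gt0 0 p0.
have mgw := @measurable_gw R.
pose F (z : T * measurableTypeR R) := X z.1 * (f z.2 * gw p 0 (S z.1 - z.2)).
have mF : measurable_fun setT F.
  apply: measurable_funM; first exact: measurableT_comp.
  apply: measurable_funM; first exact: measurableT_comp.
  apply: measurableT_comp; first exact: mgw.
  by apply: measurable_funB => //; exact: measurableT_comp.
have Fle x t : `|F (x, t)| <= `|X x| * `|f t|.
  rewrite /F/= !normrM (ger0_norm (gw_ge0 _ _ _)) ler_wpM2l// ler_piMr//.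
  exact: gw_le1.
have [e _ _ i1] := @Rint_fubini R _ _ _ _ P leb F _ _ mF (intg_norm iX) (intg_norm if_) Fle.
have FE x : X x * mollify f p (S x) = (gmass p 0)^-1 * \int[leb]_y F (x, y).
  rewrite /F/= RintegralZl//; last exact: intg_fgw.
  by rewrite /mollify; ring.
split; first by apply: eq_intg (intgZl (gmass p 0)^-1 i1) => x; rewrite FE.
under eq_Rintegral do rewrite FE.
rewrite RintegralZl// e mulrA -RintegralZl//; last first.
  have F2 : measurable_fun setT (fun z : measurableTypeR R * T => F (z.2, z.1)).
    by apply: (@measurableT_comp _ _ _ _ _ _ F _ (fun z => (z.2, z.1))) => //; exact: measurable_fun_pair.
  have F2le y x : `|F (x, y)| <= `|f y| * `|X x| by rewrite mulrC.
  by have [_ _ _] := @Rint_fubini R _ _ _ _ leb P _ _ _ F2 (intg_norm if_) (intg_norm iX) F2le.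
apply: eq_Rintegral => y _; rewrite -mollified_weight//.
have -> : \int[P]_x F (x, y) = f y * \int[P]_x (X x * gw p 0 (S x - y)).
  rewrite -RintegralZl//; first by apply: eq_Rintegral => x _; rewrite /F/=; ring.
  apply: (@intg_le _ _ _ P _ (fun x => `|X x|)).
  - apply: measurable_funM => //; apply: measurableT_comp; first exact: mgw.
    exact: measurable_funB.
  - by move=> x; rewrite normrM (ger0_norm (gw_ge0 _ _ _)) ler_piMr// gw_le1.
  - exact: intg_norm.
by ring.
Qed.

(** Almost sure continuity of [f] at S x, in the quadratic form consumed by [mollify_dist]; for
    bounded [f] it follows from ordinary continuity by [continuous_quadratic_modulus]. *)
Hypothesis fcont : {ae P, forall x, forall k, 0 < k ->
  exists2 L, 0 <= L & forall y, `|f y - f (S x)| <= k + L * (y - S x) ^+ 2}.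

(** The precision p = n + 1 tends to infinity in [mollified_inversion]. On the left the mollified
    function converges at almost every S x; on the right the damping factor e^{-t^2/(2p)} tends to
    1. Both limits are dominated, by K |X| and by multiples of M and |f|. *)
Lemma fourier_inversion :
  2 * pi * \int[P]_x (X x * f (S x)) = \int[leb]_y (f y * density hC hS y).
Proof.
pose p (n : nat) : R := n.+1%:R.
have p0 n : 0 < p n by rewrite ltr0n.
have pV0 n : 0 < (p n)^-1 by rewrite invr_gt0.
have harm : (p n)^-1 @[n --> \oo] --> (0 : R) by exact: cvg_harmonic.
have cvL : 2 * pi * \int[P]_x (X x * mollify f (p n) (S x)) @[n --> \oo] -->
    2 * pi * \int[P]_x (X x * f (S x)).
  apply: cvgMr.
  apply: (@Rint_dct_ae _ _ _ P (fun n x => X x * mollify f (p n) (S x)) _ (fun x => K * `|X x|)).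
  - by move=> n; exact: intg_measurable (mollified_inversion (p0 n)).1.
  - by apply: measurable_funM => //; exact: measurableT_comp.
  - apply: filterS fcont => x h; apply: cvgMr.
    apply/cvgrPdist_le => e e0; have e2 : 0 < e / 2 by rewrite divr_gt0.
    have [L L0 hL] := h _ e2.
    have L1 : 0 < L + 1 by rewrite ltr_wpDl.
    near=> n; rewrite distrC (le_trans (mollify_dist (p0 n) hL))//.
    rewrite [leRHS]splitr lerD2l (@le_trans _ _ ((L + 1) / p n))//.
      by rewrite ler_wpM2r ?lerDl// ltW.
    rewrite mulrC -ler_pdivlMr//; near: n.
    move/cvgrPdist_le : harm => /(_ _ (divr_gt0 e2 L1)) [N _ HN].
    by exists N => // j /HN /=; rewrite sub0r normrN ger0_norm// ltW//; exact: pV0.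
  - by apply: intgZl; exact: intg_norm.
  - by move=> n x; rewrite normrM mulrC ler_wpM2r// mollify_bound.
have mden (C Sn : R -> R) : measurable_fun setT C -> measurable_fun setT Sn ->
  (forall t, `|C t| <= M t) -> (forall t, `|Sn t| <= M t) ->
  measurable_fun setT (density C Sn).
  move=> *; apply: (@lipschitz_measurable _ (2 * \int[leb]_t (`|t| * M t))) => x y.
  exact: density_lipschitz.
have mgC n : measurable_fun setT (fun t => gw (p n)^-1 0 t * hC t).
  by apply: measurable_funM => //; exact: measurable_gw.
have mgS n : measurable_fun setT (fun t => gw (p n)^-1 0 t * hS t).
  by apply: measurable_funM => //; exact: measurable_gw.
have cvR : \int[leb]_y (f y * density (fun t => gw (p n)^-1 0 t * hC t)
      (fun t => gw (p n)^-1 0 t * hS t) y) @[n --> \oo] -->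
    \int[leb]_y (f y * density hC hS y).
  apply: (@Rint_dct _ _ _ leb (fun n y => f y * density (fun t => gw (p n)^-1 0 t * hC t)
      (fun t => gw (p n)^-1 0 t * hS t) y) _ (fun y => `|f y| * (2 * \int[leb]_t M t))).
  - move=> n; apply: measurable_funM => //; apply: mden => // t; exact: gwM.
  - move=> y; apply: cvgMr.
    apply: (@Rint_dct _ _ _ leb (fun n t => cos (t * y) * (gw (p n)^-1 0 t * hC t) +
       sin (t * y) * (gw (p n)^-1 0 t * hS t)) _ (fun t => 2 * M t)).
    + move=> n; apply: intg_measurable (density_int y _ _ _ _) => // t; exact: gwM.
    + move=> t.
      have gt1 : gw (p n)^-1 0 t @[n --> \oo] --> (1 : R).
        have -> : (fun n => gw (p n)^-1 0 t) = (fun n => expR (- (t ^+ 2 / 2) * (p n)^-1)).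
          by apply/funext => n; rewrite /gw; congr expR; ring.
        rewrite -[X in _ --> X](expR0 R); apply: continuous_cvg; first exact: continuous_expR.
        by rewrite -[X in _ --> X](mulr0 (- (t ^+ 2 / 2))); exact: cvgMr.
      apply: cvgD; apply: cvgMr; rewrite -[X in _ --> X]mul1r; exact: cvgMl.
    + exact: intgZl.
    + by move=> n t; apply: cos_sin_norm_le; exact: gwM.
  - by apply: intgZr; exact: intg_norm.
  - move=> n y; rewrite normrM ler_wpM2l// density_bound//= => t; exact: gwM.
have E : (fun n => 2 * pi * \int[P]_x (X x * mollify f (p n) (S x))) =
    (fun n => \int[leb]_y (f y * density (fun t => gw (p n)^-1 0 t * hC t)
      (fun t => gw (p n)^-1 0 t * hS t) y)).
  by apply/funext => n; rewrite (mollified_inversion (p0 n)).2.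
by move: cvL; rewrite E => cvL; exact: cvg_unique cvL cvR.
Unshelve. all: by end_near. Qed.

End mollification.

End fourier_inversion.

(** * Laplace's method *)

Section elementary_bounds.
Context {R : realType}.

Lemma der_ge0_le (f f' : R -> R) (x : R) : (forall y, 0 <= y -> der f y (f' y)) ->
  (forall y, 0 <= y -> 0 <= f' y) -> 0 <= x -> f 0 <= f x.
Proof.
move=> df f0 x0.
have itv y : y \in `]0, x[ -> 0 <= y by rewrite in_itv/= => /andP[/ltW].
have itv' y : y \in `[0, x] -> 0 <= y by rewrite in_itv/= => /andP[].
have [z zx e] : exists2 z, z \in `[0, x] & f x - f 0 = f' z * (x - 0).
  apply: (@MVT_segment R f f' 0 x x0) => [y /itv /df//|].
  apply: derivable_within_continuous => y /itv' y0.
  exact: (@ex_derive _ _ _ _ _ _ _ (df _ y0)).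
by rewrite -subr_ge0 e subr0 mulr_ge0// f0// itv'.
Qed.

(** Both differences vanish at 0 and have the nonnegative derivatives z^2/(1 + z) and z^3/(1 + z).
    Like the other estimates of this section it assumes nothing small, so the expansions hold at all
    frequencies and no cut-off is introduced. *)
Lemma ln1D_bounds (z : R) : 0 <= z ->
  z - z ^+ 2 / 2 <= ln (1 + z) <= z - z ^+ 2 / 2 + z ^+ 3 / 3.
Proof.
move=> z0; have p (y : R) : 0 <= y -> 0 < 1 + y by move=> ?; rewrite ltr_wpDr.
apply/andP; split; rewrite -subr_ge0.
- have := @der_ge0_le (fun y => ln (1 + y) - (y - y ^+ 2 / 2)) (fun y => y ^+ 2 / (1 + y)) z.
  rewrite addr0 ln1 expr0n/= mul0r !subr0; apply=> // y y0; last first.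
    by rewrite divr_ge0 ?sqr_ge0// ltW// p.
  have py := p _ y0; have py' := lt0r_neq0 py.
  by eapply der_eq; [der|rewrite /=; field].
- pose f (y : R) := y - y ^+ 2 / 2 + y ^+ 3 / 3 - ln (1 + y).
  have f0 : f 0 = 0 by rewrite /f !expr0n/= !mul0r subr0 !addr0 ln1 subr0.
  rewrite -/(f z) -f0; apply: (@der_ge0_le f (fun y => y ^+ 3 / (1 + y)) z _ _ z0) => y y0; last first.
    by apply: divr_ge0; [exact: exprn_ge0|exact: ltW (p _ y0)].
  have py := p _ y0; have py' := lt0r_neq0 py.
  by rewrite /f; eapply der_eq; [der|rewrite /=; field].
Qed.

Let atan_pos (x : R) : 0 <= x -> `|atan x - x + x ^+ 3 / 3| <= `|x| ^+ 5.
Proof.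
move=> x0; have p (y : R) : 0 < 1 + y ^+ 2 by rewrite ltr_wpDr// sqr_ge0.
have h1 : 0 <= atan x - x + x ^+ 3 / 3.
  have := @der_ge0_le (fun y => atan y - y + y ^+ 3 / 3) (fun y => y ^+ 4 / (1 + y ^+ 2)) x.
  rewrite atan0 expr0n/= mul0r subrr addr0; apply=> // y y0; last first.
    by rewrite divr_ge0 ?exprn_ge0// ltW// p.
  have py := lt0r_neq0 (p y).
  by eapply der_eq; [der|rewrite /=; field].
have h2 : 0 <= x ^+ 5 - (atan x - x + x ^+ 3 / 3).
  have := @der_ge0_le (fun y => y ^+ 5 - (atan y - y + y ^+ 3 / 3))
    (fun y => 4 * y ^+ 4 + y ^+ 6 / (1 + y ^+ 2)) x.
  rewrite atan0 !expr0n/= mul0r !subrr addr0 subrr; apply=> // y y0; last first.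
    by rewrite addr_ge0 ?mulr_ge0 ?exprn_ge0// invr_ge0 ltW// p.
  have py := lt0r_neq0 (p y).
  by eapply der_eq; [der|rewrite /=; field].
by rewrite ger0_norm// ger0_norm// -subr_ge0.
Qed.

Lemma atan_taylor (x : R) : `|atan x - x + x ^+ 3 / 3| <= `|x| ^+ 5.
Proof.
have [x0|/ltW x0] := leP 0 x; first exact: atan_pos.
have Nx : 0 <= - x by rewrite oppr_ge0.
have := atan_pos Nx; rewrite atanN (normrN x).
have -> : atan x - x + x ^+ 3 / 3 = - (- atan x - - x + (- x) ^+ 3 / 3) by ring.
by rewrite normrN.
Qed.

(** Each bound follows by integrating the previous one from 0, starting from 1 - cos >= 0. *)
Let sin_cos_pos (x : R) : 0 <= x ->
  [/\ sin x <= x, 1 - x ^+ 2 / 2 <= cos x, x - x ^+ 3 / 6 <= sin x &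
      cos x <= 1 - x ^+ 2 / 2 + x ^+ 4 / 24].
Proof.
have h1 (y : R) : 0 <= y -> sin y <= y.
  move=> y0; rewrite -subr_ge0.
  have := @der_ge0_le (fun y => y - sin y) (fun y => 1 - cos y) y.
  rewrite sin0 subrr; apply=> // z z0.
  by eapply der_eq; [der|rewrite /=; ring].
have h2 (y : R) : 0 <= y -> 1 - y ^+ 2 / 2 <= cos y.
  move=> y0; rewrite -subr_ge0.
  have := @der_ge0_le (fun y => cos y - (1 - y ^+ 2 / 2)) (fun y => y - sin y) y.
  rewrite cos0 expr0n/= mul0r subr0 subrr; apply=> // z z0; last by rewrite /= subr_ge0 h1.
  by eapply der_eq; [der|rewrite /=; field].
have h3 (y : R) : 0 <= y -> y - y ^+ 3 / 6 <= sin y.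
  move=> y0; rewrite -subr_ge0.
  have := @der_ge0_le (fun y => sin y - (y - y ^+ 3 / 6)) (fun y => cos y - (1 - y ^+ 2 / 2)) y.
  rewrite sin0 expr0n/= mul0r subr0 subrr; apply=> // z z0; last by rewrite /= subr_ge0 h2.
  by eapply der_eq; [der|rewrite /=; field].
have h4 (y : R) : 0 <= y -> cos y <= 1 - y ^+ 2 / 2 + y ^+ 4 / 24.
  move=> y0; rewrite -subr_ge0.
  have := @der_ge0_le (fun y => 1 - y ^+ 2 / 2 + y ^+ 4 / 24 - cos y) (fun y => sin y - (y - y ^+ 3 / 6)) y.
  rewrite cos0 !expr0n/= !mul0r subr0 addr0 subrr; apply=> // z z0; last by rewrite /= subr_ge0 h3.
  by eapply der_eq; [der|rewrite /=; field].
by move=> x0; split; [exact: h1|exact: h2|exact: h3|exact: h4].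
Qed.

Lemma sin_taylor (x : R) : `|sin x - x| <= `|x| ^+ 3.
Proof.
wlog x0 : x / 0 <= x.
  move=> h; have [x0|/ltW x0] := leP 0 x; first exact: h.
  have Nx : 0 <= - x by rewrite oppr_ge0.
  by have := h _ Nx; rewrite sinN normrN -opprD normrN.
have [h1 _ h3 _] := sin_cos_pos x0.
rewrite distrC ger0_norm ?subr_ge0// ger0_norm//.
have := exprn_ge0 3 x0; lra.
Qed.

Lemma cos_taylor (x : R) :
  `|cos x - 1| <= `|x| ^+ 2 /\ `|cos x - 1 + x ^+ 2 / 2| <= `|x| ^+ 4.
Proof.
wlog x0 : x / 0 <= x.
  move=> h; have [x0|/ltW x0] := leP 0 x; first exact: h.
  have Nx : 0 <= - x by rewrite oppr_ge0.
  by have := h _ Nx; rewrite cosN normrN sqrrN.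
have [_ h2 _ h4] := sin_cos_pos x0.
rewrite (ger0_norm x0); have := exprn_ge0 2 x0; have := exprn_ge0 4 x0 => a b.
split; first by rewrite ler0_norm ?subr_le0 ?cos_le1//; lra.
by rewrite ger0_norm; lra.
Qed.

(** The factor 1 + e^D serves both signs of D. Multiplied by the Gaussian factor, it becomes the sum
    of the two exponentials in [laplace_error]. *)
Lemma exp_taylor (D : R) : `|expR D - 1 - D| <= D ^+ 2 * (1 + expR D).
Proof.
have h0 : 0 <= expR D - 1 - D by have := expR_ge1Dx D; lra.
have E0 := expR_gt0 D.
have h1 : expR D - 1 <= D * expR D.
  have := expR_ge1Dx (- D); rewrite expRN => h.
  have := ler_wpM2r (ltW E0) h; rewrite mulVf ?gt_eqF//; lra.
rewrite ger0_norm//.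
have [D0|D0] := leP 0 D.
  have h2 : D * (expR D - 1) <= D * (D * expR D) by exact: ler_wpM2l.
  have := sqr_ge0 D; rewrite expr2; lra.
have h2 : - D * (1 - expR D) <= - D * (- D).
  have D0' : 0 <= - D by rewrite oppr_ge0 ltW.
  by rewrite ler_wpM2l//; have := expR_ge1Dx D; lra.
have : 0 <= D ^+ 2 * expR D by rewrite mulr_ge0 ?sqr_ge0// ltW.
rewrite expr2; lra.
Qed.

(** Bernoulli's inequality 1 + a y <= (1 + y)^a in logarithmic form; the derivative of the
    difference is a/(1 + y) - a/(1 + a y) >= 0. *)
Lemma ln_bernoulli (a y : R) : 1 <= a -> 0 <= y -> ln (1 + a * y) <= a * ln (1 + y).
Proof.
move=> a1 y0; have a0 : 0 <= a by rewrite (le_trans _ a1).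
have p (z : R) : 0 <= z -> 0 < 1 + z by move=> ?; rewrite ltr_wpDr.
rewrite -subr_ge0.
have := @der_ge0_le (fun y => a * ln (1 + y) - ln (1 + a * y))
  (fun y => a / (1 + y) - a / (1 + a * y)) y.
rewrite mulr0 addr0 ln1 mulr0 subrr; apply=> // z z0.
  have q1 := p _ z0; have q2 := p _ (mulr_ge0 a0 z0).
  by eapply der_eq; [der|rewrite /=; field; rewrite !lt0r_neq0].
have q1 := p _ z0; have q2 := p _ (mulr_ge0 a0 z0).
by rewrite subr_ge0 ler_wpM2l// lef_pV2 ?posrE// lerD2l ler_peMl.
Qed.

End elementary_bounds.

(** * Orders of magnitude in the rescaled frequency *)

Section bigO_calculus.
Context {R : realType}.
Implicit Types (f g h : R -> R -> R) (j k l : nat).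

(* Here s stands for sqrt n, and s * t for the rescaled frequency. *)
Definition bigO j h := exists i : nat, exists2 C : R, 0 <= C &
  forall s t, 1 <= s -> `|h s t| <= C * (s^-1) ^+ j * (1 + s * `|t|) ^+ i.

Let u1 (s t : R) : 1 <= s -> 1 <= 1 + s * `|t|.
Proof. by move=> s1; rewrite lerDl mulr_ge0// (le_trans _ s1). Qed.

Let s0 (s : R) : 1 <= s -> 0 <= s^-1.
Proof. by move=> s1; rewrite invr_ge0 (le_trans _ s1). Qed.

Lemma bigO_le j h g : bigO j g -> (forall s t, 1 <= s -> `|h s t| <= `|g s t|) -> bigO j h.
Proof.
by move=> [i [C C0 H]] hg; exists i, C => // s t s1; exact: le_trans (hg s t s1) (H s t s1).
Qed.

Lemma bigO_ext j h g : (forall s t, h s t = g s t) -> bigO j g -> bigO j h.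
Proof. by move=> e /bigO_le; apply => s t _; rewrite e. Qed.

Lemma bigO_weak k j h : (j <= k)%N -> bigO k h -> bigO j h.
Proof.
move=> jk [i [C C0 H]]; exists i, C => // s t s1; rewrite (le_trans (H s t s1))//.
rewrite ler_wpM2r//; first by rewrite exprn_ge0// (le_trans _ (u1 t s1)).
by rewrite ler_wpM2l// ler_wiXn2l// ?s0// invf_le1// (lt_le_trans _ s1).
Qed.

Lemma bigOD j f g : bigO j f -> bigO j g -> bigO j (fun s t => f s t + g s t).
Proof.
move=> [i [C C0 H]] [i' [C' C0' H']]; exists (i + i')%N, (C + C'); first exact: addr_ge0.
move=> s t s1; rewrite (le_trans (ler_normD _ _))// -mulrA mulrDl lerD//.
  rewrite (le_trans (H s t s1))// mulrA ler_wpM2l//.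
    by rewrite mulr_ge0// exprn_ge0// s0.
  by apply: ler_weXn2l; [exact: u1|exact: leq_addr].
rewrite (le_trans (H' s t s1))// mulrA ler_wpM2l//.
  by rewrite mulr_ge0// exprn_ge0// s0.
by apply: ler_weXn2l; [exact: u1|exact: leq_addl].
Qed.

Lemma bigON j f : bigO j f -> bigO j (fun s t => - f s t).
Proof. by move=> /bigO_le; apply => s t _; rewrite normrN. Qed.

Lemma bigOB j f g : bigO j f -> bigO j g -> bigO j (fun s t => f s t - g s t).
Proof. by move=> hf /bigON; exact: bigOD. Qed.

Lemma bigO_norm j f : bigO j f -> bigO j (fun s t => `|f s t|).
Proof. by move=> /bigO_le; apply => s t _; rewrite normr_id. Qed.

Lemma bigOM j k l f g : bigO j f -> bigO k g -> (l <= j + k)%N ->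
  bigO l (fun s t => f s t * g s t).
Proof.
move=> [i [C C0 H]] [i' [C' C0' H']] ljk; apply: bigO_weak ljk _.
exists (i + i')%N, (C * C'); first exact: mulr_ge0.
move=> s t s1; rewrite normrM (le_trans (ler_pM _ _ (H s t s1) (H' s t s1)))//.
by rewrite !exprD le_eqVlt; apply/orP; left; apply/eqP; ring.
Qed.

Lemma bigO_cst (c : R) : bigO 0 (fun _ _ => c).
Proof. by exists 0%N, `|c| => // s t _; rewrite !expr0 !mulr1. Qed.

Lemma bigO_X (a : nat) j k f : bigO j f -> (k <= a * j)%N -> bigO k (fun s t => f s t ^+ a).
Proof.
move=> hf kaj; apply: bigO_weak kaj _; elim: a => [|a IH].
  by apply: bigO_ext (bigO_cst 1) => s t; rewrite expr0.
by apply: bigO_ext (fun s t => exprS _ _) _; apply: bigOM hf IH _; rewrite mulSn.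
Qed.

(** Each factor |t| is worth one order, because |t| <= (1 + s |t|) / s. *)
Lemma bigO_pow (h : R -> R) (C : R) k : 0 <= C -> (forall t, `|h t| <= C * `|t| ^+ k) ->
  bigO k (fun _ t => h t).
Proof.
move=> C0 H; exists k, C => // s t s1; rewrite (le_trans (H t))// -mulrA ler_wpM2l//.
rewrite -exprMn lerXn2r ?nnegrE//.
  by rewrite mulr_ge0 ?s0// (le_trans _ (u1 t s1)).
have sp : 0 < s by rewrite (lt_le_trans _ s1).
rewrite mulrDr mulr1 mulKf ?gt_eqF// lerDr s0//.
Qed.

Lemma bigO_id k : bigO k (fun _ t => t ^+ k).
Proof. by apply: (@bigO_pow _ 1) => // t; rewrite mul1r normrX. Qed.

Lemma bigO_scale k j f : bigO (k + j) f -> bigO j (fun s t => s ^+ k * f s t).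
Proof.
move=> [i [C C0 H]]; exists i, C => // s t s1.
have sp : 0 < s by rewrite (lt_le_trans _ s1).
have sk := exprn_ge0 k (ltW sp).
rewrite normrM (ger0_norm sk) (le_trans (ler_wpM2l sk (H s t s1)))//.
rewrite exprD le_eqVlt; apply/orP; left; apply/eqP.
have e : s ^+ k * (s^-1) ^+ k = 1 by rewrite -exprMn divff ?gt_eqF// expr1n.
by rewrite -[RHS]mul1r -e; ring.
Qed.

End bigO_calculus.

Section laplace_integrand.
Context {R : realType}.
Variables (A B rho sigma : R -> R) (k2 k3 k4 rho0 rho2 sigma1 C : R).
Hypothesis C0 : 0 <= C.
Hypothesis A_taylor : forall t, `|A t + k2 * t ^+ 2 / 2 - k4 * t ^+ 4 / 24| <= C * `|t| ^+ 6.
Hypothesis B_taylor : forall t, `|B t + k3 * t ^+ 3 / 6| <= C * `|t| ^+ 5.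
Hypothesis rho_taylor : forall t, `|rho t - rho0 - rho2 * t ^+ 2| <= C * `|t| ^+ 4.
Hypothesis sigma_taylor : forall t, `|sigma t - sigma1 * t| <= C * `|t| ^+ 3.

(** Real part of (rho + i sigma) e^{s^2 (A + i B)}. *)
Definition laplace_main (s t : R) : R := expR (s ^+ 2 * A t) *
  (rho t * cos (s ^+ 2 * B t) - sigma t * sin (s ^+ 2 * B t)).

(** The terms of order s^{-2} that correct rho0 are the second coefficient of rho, the quartic term
    of A, the product of sigma1 t with the cubic phase, and minus half the square of that phase,
    which accounts for 72 = 2 * 6^2. *)
Definition laplace_approx (s t : R) : R := expR (- (s ^+ 2 * (k2 * t ^+ 2 / 2))) *
  (rho0 + rho2 * t ^+ 2 + s ^+ 2 * ((rho0 * k4 / 24 + sigma1 * k3 / 6) * t ^+ 4)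
   - s ^+ 4 * (rho0 * k3 ^+ 2 / 72 * t ^+ 6)).

(** With t counted as order 1, u = s^2 B has order 1 and equals -w up to order 3, while D = s^2 (A +
    k2 t^2/2) has order 2 and equals D4 up to order 4. The trigonometric factor is replaced by rho0
    + Q and the exponential by G (1 + D). The two exponentials are kept in the bound because the
    remainder of e^D is controlled by both. *)
Lemma laplace_error : exists2 H : R -> R -> R, bigO 4 H & forall s t,
  `|laplace_main s t - laplace_approx s t| <=
    `|H s t| * (expR (s ^+ 2 * A t) + expR (- (s ^+ 2 * (k2 * t ^+ 2 / 2)))).
Proof.
pose w s t := s ^+ 2 * (k3 / 6 * t ^+ 3).
pose u s t := s ^+ 2 * B t.
pose D s t := s ^+ 2 * (A t + k2 * t ^+ 2 / 2).
pose D4 s t := s ^+ 2 * (k4 / 24 * t ^+ 4).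
pose Q s t := rho2 * t ^+ 2 + s ^+ 2 * (sigma1 * k3 / 6 * t ^+ 4) - s ^+ 4 * (rho0 * k3 ^+ 2 / 72 * t ^+ 6).
have mono (c : R) k : bigO k (fun _ t => c * t ^+ k).
  by apply: bigOM (bigO_cst c) (bigO_id k) _.
have Ow : bigO 1 w by apply: bigO_scale; exact: mono.
have Ouw : bigO 3 (fun s t => u s t + w s t).
  apply: (@bigO_ext _ _ _ (fun s t => s ^+ 2 * (B t + k3 * t ^+ 3 / 6))).
    by move=> s t; rewrite /u /w; ring.
  by apply: bigO_scale; exact: (bigO_pow C0).
have Ou : bigO 1 u.
  apply: (@bigO_ext _ _ _ (fun s t => (u s t + w s t) - w s t)) => [s t|]; first by ring.
  by apply: bigOB => //; exact: bigO_weak Ouw.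
have OD4 : bigO 2 D4 by apply: bigO_scale; exact: mono.
have ODD4 : bigO 4 (fun s t => D s t - D4 s t).
  apply: (@bigO_ext _ _ _ (fun s t => s ^+ 2 * (A t + k2 * t ^+ 2 / 2 - k4 * t ^+ 4 / 24))).
    by move=> s t; rewrite /D /D4; ring.
  by apply: bigO_scale; exact: (bigO_pow C0).
have OD : bigO 2 D.
  apply: (@bigO_ext _ _ _ (fun s t => (D s t - D4 s t) + D4 s t)) => [s t|]; first by ring.
  by apply: bigOD => //; exact: bigO_weak ODD4.
have OQ : bigO 2 Q.
  apply: bigOB; last by apply: bigO_scale; exact: mono.
  by apply: bigOD; [exact: mono|apply: bigO_scale; exact: mono].
have Or : bigO 4 (fun _ t => rho t - rho0 - rho2 * t ^+ 2) by exact: (bigO_pow C0).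
have Os : bigO 3 (fun _ t => sigma t - sigma1 * t ^+ 1) by exact: (bigO_pow C0).
have Osig : bigO 1 (fun _ t => sigma t).
  apply: (@bigO_ext _ _ _ (fun s t => (sigma t - sigma1 * t ^+ 1) + sigma1 * t ^+ 1)) => [s t|]; first by ring.
  by apply: bigOD; [exact: bigO_weak Os|exact: mono].
have Oupow a : bigO a (fun s t => u s t ^+ a).
  by apply: bigO_X Ou _; rewrite muln1.
have Ocos : bigO 0 (fun s t => cos (u s t)).
  by apply: bigO_le (bigO_cst 1) _ => s t _; rewrite normr1 ler_norml cos_geN1 cos_le1.
have Ocos2 : bigO 2 (fun s t => cos (u s t) - 1).
  apply: (bigO_le (Oupow 2%N)) => s t _.
  by rewrite normrX; exact: (cos_taylor _).1.
have Ocos4 : bigO 4 (fun s t => cos (u s t) - 1 + u s t ^+ 2 / 2).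
  apply: (bigO_le (Oupow 4%N)) => s t _.
  by rewrite normrX; exact: (cos_taylor _).2.
have Osin : bigO 3 (fun s t => sin (u s t) - u s t).
  apply: (bigO_le (Oupow 3%N)) => s t _.
  by rewrite normrX; exact: sin_taylor.
pose e1 s t := rho t * cos (u s t) - sigma t * sin (u s t) - (rho0 + Q s t).
have Oe1 : bigO 4 e1.
  (* Telescoping sum in which every summand contains a remainder. The product of u + w and u - w
     trades u^2 for w^2 in the second term of the cosine. *)
  apply: (@bigO_ext _ _ _ (fun s t =>
    (rho t - rho0 - rho2 * t ^+ 2) * cos (u s t)
    + rho0 * (cos (u s t) - 1 + u s t ^+ 2 / 2)
    - rho0 / 2 * ((u s t + w s t) * (u s t - w s t))
    + (rho2 * t ^+ 2) * (cos (u s t) - 1)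
    - sigma t * (sin (u s t) - u s t)
    - sigma t * (u s t + w s t)
    + (sigma t - sigma1 * t ^+ 1) * w s t)).
    by move=> s t; rewrite /e1 /Q /w; field.
  apply: bigOD; last exact: bigOM Os Ow _.
  apply: bigOB; last exact: bigOM Osig Ouw _.
  apply: bigOB; last exact: bigOM Osig Osin _.
  apply: bigOD; last exact: bigOM (mono rho2 2) Ocos2 _.
  apply: bigOB; last first.
    have Ouu : bigO 4 (fun s t => (u s t + w s t) * (u s t - w s t)).
      exact: bigOM Ouw (bigOB Ou Ow) _.
    exact: bigOM (bigO_cst _) Ouu _.
  apply: bigOD; first exact: bigOM Or Ocos _.
  exact: bigOM (bigO_cst _) Ocos4 _.
pose H s t := `|e1 s t| + D s t ^+ 2 * `|rho0 + Q s t| + `|(D s t - D4 s t) * (rho0 + Q s t) + D4 s t * Q s t|.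
exists H.
  have ORQ : bigO 0 (fun s t => rho0 + Q s t).
    by apply: bigOD; [exact: bigO_cst|exact: bigO_weak OQ].
  rewrite /H; apply: bigOD.
    apply: bigOD; first exact: bigO_norm.
    have OD2 : bigO 4 (fun s t => D s t ^+ 2) by exact: bigO_X OD _.
    by apply: bigOM OD2 (bigO_norm ORQ) _.
  apply: bigO_norm; apply: bigOD; first exact: bigOM ODD4 ORQ _.
  exact: bigOM OD4 OQ _.
move=> s t; pose E := expR (s ^+ 2 * A t); pose G := expR (- (s ^+ 2 * (k2 * t ^+ 2 / 2))).
rewrite -/E -/G.
have E0 : 0 <= E by exact: expR_ge0. have G0 : 0 <= G by exact: expR_ge0.
have EG : E = G * expR (D s t) by rewrite /E /G /D -expRD; congr expR; ring.
have H0 : 0 <= H s t by rewrite !addr_ge0// mulr_ge0// sqr_ge0.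
have hE : `|E - G * (1 + D s t)| <= D s t ^+ 2 * (E + G).
  have -> : E - G * (1 + D s t) = G * (expR (D s t) - 1 - D s t) by rewrite EG; ring.
  rewrite normrM (ger0_norm G0) (le_trans (ler_wpM2l G0 (exp_taylor _)))//.
  by rewrite EG le_eqVlt; apply/orP; left; apply/eqP; ring.
have -> : laplace_main s t - laplace_approx s t =
    E * e1 s t + (E - G * (1 + D s t)) * (rho0 + Q s t)
    + G * ((D s t - D4 s t) * (rho0 + Q s t) + D4 s t * Q s t).
  by rewrite /laplace_main /laplace_approx -/E -/G /e1 /u /Q /D4; field.
rewrite (ger0_norm H0) /H.
set X := (_ - D4 s t) * _ + _; set Y := rho0 + Q s t in hE *.
rewrite (le_trans (ler_normD _ _))// (le_trans (lerD (ler_normD _ _) (lexx _)))//.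
rewrite !normrM (ger0_norm E0) (ger0_norm G0).
have h1 : `|E - G * (1 + D s t)| * `|Y| <= D s t ^+ 2 * (E + G) * `|Y| by rewrite ler_wpM2r.
have h2 : 0 <= G * `|e1 s t| by rewrite mulr_ge0.
have h3 : 0 <= E * `|X| by rewrite mulr_ge0.
rewrite -subr_ge0 in h1; rewrite -subr_ge0.
rewrite [leRHS](_ : _ = (D s t ^+ 2 * (E + G) * `|Y| - `|E - G * (1 + D s t)| * `|Y|)
   + G * `|e1 s t| + E * `|X|); last by ring.
by apply: addr_ge0 => //; exact: addr_ge0.
Qed.

End laplace_integrand.

(** * Integrable majorants *)

Section cauchy_integral.
Context {R : realType}.
Notation leb := (@lebesgue_measure R).

Let D (s t : R) : 0 < 1 + (s * t) ^+ 2.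
Proof. by rewrite ltr_pwDl// sqr_ge0. Qed.

Let der_atan_scale (s t : R) : 0 < s -> der (fun t => atan (s * t) / s) t (1 + (s * t) ^+ 2)^-1.
Proof.
move=> s0; have s1 := lt0r_neq0 s0; have := lt0r_neq0 (D s t) => d.
by eapply der_eq; [der|rewrite /=; field; rewrite d s1].
Qed.

Let der_cauchy (s t : R) : der (fun t => (1 + (s * t) ^+ 2)^-1) t
  (- (2 * s * (s * t)) / (1 + (s * t) ^+ 2) ^+ 2).
Proof.
have := lt0r_neq0 (D s t) => d.
by eapply der_eq; [der|rewrite /=; field].
Qed.

(** Common envelope of all remainders, with primitive atan(s t)/s. The factor 1/s in its integral is
    the extra 1/sqrt n of the Laplace error. *)
Lemma integral_cauchy (s : R) : 0 < s ->
  intg leb (fun t => (1 + (s * t) ^+ 2)^-1) /\ \int[leb]_t (1 + (s * t) ^+ 2)^-1 = pi / s.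
Proof.
move=> s0; pose f (t : R) := (1 + (s * t) ^+ 2)^-1.
have f0 t : 0 <= f t by rewrite invr_ge0 ltW.
have cf : continuous f by apply: der_continuous => t; exact: der_cauchy.
have E : (\int[leb]_t (f t)%:E = (pi / s)%:E)%E.
  rewrite ge0_symfun_integralT//; last by move=> t /=; rewrite /f mulrN sqrrN.
  rewrite (_ : [set x | _] = `[0, +oo[%classic); last first.
    by apply/seteqP; split => x/=; rewrite in_itv/= andbT.
  rewrite (@ge0_continuous_FTC2y _ f (fun t => atan (s * t) / s) 0 (pi / 2 / s))//.
  - rewrite mulr0 atan0 mul0r sube0 -EFinM; congr EFin; field; rewrite lt0r_neq0//.
  - exact: continuous_subspaceT.
  - apply: cvgMl; apply: (cvg_comp (fun t => s * t) _ _ (@cvgy_atan R)).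
    by apply: gt0_cvgMry => //; exact: cvg_id.
  - apply: cvg_at_right_filter; apply: (@der_continuous _ (fun t => atan (s * t) / s) f) => x.
    exact: der_atan_scale.
  - by move=> x _; apply: der_derive1; exact: der_atan_scale.
split; last by rewrite /Rintegral E.
apply/integrableP; split.
  by apply/measurable_EFinP; exact: continuous_measurable_fun.
rewrite (_ : (fun x => _) = fun t => (f t)%:E); first by rewrite E ltry.
by apply/funext => t; rewrite /= ger0_norm; first by []; exact: f0.
Qed.

End cauchy_integral.

Section majorant.
Context {R : realType}.
Notation leb := (@lebesgue_measure R).

(** The constant (1 + 1/c)^i reflects 1 + x <= (1 + 1/c) (1 + c x). *)
Let exp_majorant (c : R) (i : nat) : 0 < c -> exists2 K, 0 <= K & forall x X : R, 0 <= x ->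
  X <= - i%:R * ln (1 + c * x) -> expR X <= K * ((1 + x) ^+ i)^-1.
Proof.
move=> c0; exists ((1 + c^-1) ^+ i).
  by rewrite exprn_ge0// addr_ge0// invr_ge0 ltW.
move=> x X x0 HX; have cx : 0 < 1 + c * x by rewrite ltr_pwDl// mulr_ge0// ltW.
have x1 : 0 < 1 + x by rewrite ltr_pwDl.
have e : expR X <= ((1 + c * x) ^+ i)^-1.
  rewrite (le_trans (_ : _ <= expR (- i%:R * ln (1 + c * x)))) ?ler_expR//.
  by rewrite mulNr expRN -[i%:R * _]mulrC expRM_natr lnK// posrE.
rewrite (le_trans e)// ler_pdivlMr ?exprn_gt0// mulrC.
rewrite ler_pdivrMr ?exprn_gt0// -exprMn.
have e2 : (1 + c^-1) * (1 + c * x) = 1 + x + (c^-1 + c * x).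
  by field; rewrite lt0r_neq0.
have e3 : 0 <= c^-1 + c * x by rewrite addr_ge0 ?invr_ge0 ?mulr_ge0// ltW.
have e4 : 1 + x <= 1 + x + (c^-1 + c * x) by rewrite lerDl.
rewrite e2; apply: lerXn2r => //; rewrite nnegrE; first exact: ltW.
exact: le_trans (ltW x1) e4.
Qed.

Variables (A : R -> R) (a b k2 : R).
Hypotheses (a0 : 0 < a) (b0 : 0 < b) (k20 : 0 < k2).
Hypothesis A_decay : forall t, A t <= - a * ln (1 + b * t ^+ 2).

(** Once s^2 a >= i + 1, Bernoulli's inequality turns (1 + b t^2)^{-s^2 a} into a fixed power of 1 +
    c (s t)^2 with c = a b/(i + 1); this fixes the threshold (i + 1)/a. The Gaussian term obeys a
    bound of the same kind because ln(1 + y) <= y. *)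
Lemma laplace_majorant (i : nat) : exists2 K, 0 <= K & exists N : R, forall s t,
  1 <= s -> N <= s ^+ 2 ->
  expR (s ^+ 2 * A t) + expR (- (s ^+ 2 * (k2 * t ^+ 2 / 2))) <= K * ((1 + (s * t) ^+ 2) ^+ i)^-1.
Proof.
have i0 : 0 < i.+1%:R :> R by rewrite ltr0n.
have c1 : 0 < a * b / i.+1%:R by rewrite divr_gt0// mulr_gt0.
have c2 : 0 < k2 / (2 * i.+1%:R) by rewrite divr_gt0// mulr_gt0.
have [K1 K10 H1] := exp_majorant i.+1 c1; have [K2 K20 H2] := exp_majorant i.+1 c2.
exists (K1 + K2); first exact: addr_ge0.
exists (i.+1%:R / a) => s t s1 Ns.
have x0 : 0 <= (s * t) ^+ 2 by exact: sqr_ge0.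
have x1 : 1 <= 1 + (s * t) ^+ 2 by rewrite lerDl.
rewrite (@le_trans _ _ ((K1 + K2) * ((1 + (s * t) ^+ 2) ^+ i.+1)^-1))//; last first.
  rewrite ler_wpM2l ?addr_ge0// lef_pV2 ?posrE ?exprn_gt0// ?(lt_le_trans _ x1)//.
  exact: ler_weXn2l.
rewrite mulrDl lerD//.
- apply: H1 => //; have al : 1 <= s ^+ 2 * a / i.+1%:R.
    by rewrite ler_pdivlMr// mul1r mulrC -ler_pdivrMl// mulrC.
  have bt : 0 <= b * t ^+ 2 by rewrite mulr_ge0 ?sqr_ge0// ltW.
  have h := ln_bernoulli al bt.
  rewrite (le_trans (ler_wpM2l (sqr_ge0 s) (A_decay t)))//.
  have -> : a * b / i.+1%:R * (s * t) ^+ 2 = s ^+ 2 * a / i.+1%:R * (b * t ^+ 2).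
    by field; rewrite lt0r_neq0.
  rewrite -lerN2 [leLHS](_ : _ = i.+1%:R * ln (1 + s ^+ 2 * a / i.+1%:R * (b * t ^+ 2))); last by ring.
  rewrite (le_trans (ler_wpM2l (ltW i0) h))// le_eqVlt; apply/orP; left; apply/eqP.
  by field; rewrite lt0r_neq0.
- apply: H2 => //; rewrite mulNr lerN2.
  have cx : 0 <= k2 / (2 * i.+1%:R) * (s * t) ^+ 2 by rewrite mulr_ge0// ltW.
  have h : ln (1 + k2 / (2 * i.+1%:R) * (s * t) ^+ 2) <= k2 / (2 * i.+1%:R) * (s * t) ^+ 2.
    rewrite -ler_expR lnK ?posrE; first exact: expR_ge1Dx.
    by rewrite ltr_pwDl.
  rewrite (le_trans (ler_wpM2l (ltW i0) h))// le_eqVlt; apply/orP; left; apply/eqP.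
  by field; rewrite lt0r_neq0.
Qed.

(** Of the i + 1 powers available, i absorb the growth (1 + s |t|)^i <= 2^i (1 + (s t)^2)^i, and one
    is left to make the bound integrable. *)
Lemma bigO_majorant (j : nat) (h : R -> R -> R) : bigO j h ->
  exists2 K, 0 <= K & exists N : R, forall s t, 1 <= s -> N <= s ^+ 2 ->
  `|h s t| * (expR (s ^+ 2 * A t) + expR (- (s ^+ 2 * (k2 * t ^+ 2 / 2)))) <=
    K * s^-1 ^+ j * (1 + (s * t) ^+ 2)^-1.
Proof.
move=> [i [C C0 Hh]]; have [K K0 [N HN]] := laplace_majorant i.+1.
exists (C * K * 2 ^+ i); first by rewrite !mulr_ge0// exprn_ge0.
exists N => s t s1 Ns; have sp : 0 < s by rewrite (lt_le_trans _ s1).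
have x0 : 0 <= (s * t) ^+ 2 by exact: sqr_ge0.
have y0 : 0 < 1 + (s * t) ^+ 2 by rewrite ltr_pwDl.
have u0 : 0 <= s * `|t| by rewrite mulr_ge0// ltW.
have h1 : (1 + s * `|t|) ^+ i <= 2 ^+ i * (1 + (s * t) ^+ 2) ^+ i.
  have hb : 1 + s * `|t| <= 2 * (1 + (s * t) ^+ 2).
    have -> : (s * t) ^+ 2 = (s * `|t|) ^+ 2 by rewrite !exprMn real_normK ?num_real.
    have := sqr_ge0 (s * `|t| - 1); have := sqr_ge0 (s * `|t|); move: (s * `|t|) => u; lra.
  rewrite -exprMn; apply: lerXn2r => //; rewrite nnegrE; first exact: addr_ge0.
  exact: le_trans (addr_ge0 ler01 u0) hb.
rewrite (le_trans (ler_pM _ _ (Hh s t s1) (HN s t s1 Ns)))// ?addr_ge0 ?expR_ge0//.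
have sj : 0 <= s^-1 ^+ j by rewrite exprn_ge0// invr_ge0 ltW.
have g0 : 0 <= K * ((1 + (s * t) ^+ 2) ^+ i.+1)^-1 by rewrite mulr_ge0// invr_ge0 exprn_ge0// ltW.
have Csj : 0 <= C * s^-1 ^+ j by exact: mulr_ge0.
rewrite (le_trans (ler_wpM2r g0 (ler_wpM2l Csj h1)))//.
rewrite le_eqVlt; apply/orP; left; apply/eqP.
rewrite [_ ^+ i.+1]exprS.
have := lt0r_neq0 (exprn_gt0 i y0); have := lt0r_neq0 y0.
move: (1 + (s * t) ^+ 2) => y; move: (y ^+ i) (2 ^+ i) (s^-1 ^+ j) => p r v y1 p1.
by field; rewrite y1 p1.
Qed.

End majorant.

(** * Laplace's method with an explicit error *)

Section laplace.
Context {R : realType}.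
Notation leb := (@lebesgue_measure R).
Variables (A B rho sigma : R -> R) (k2 k3 k4 rho0 rho2 sigma1 C a b : R).
Hypotheses (a0 : 0 < a) (b0 : 0 < b) (k20 : 0 < k2) (C0 : 0 <= C).
Hypotheses (mA : measurable_fun setT A) (mB : measurable_fun setT B).
Hypotheses (mrho : measurable_fun setT rho) (msigma : measurable_fun setT sigma).
Hypothesis A_decay : forall t, A t <= - a * ln (1 + b * t ^+ 2).
Hypothesis A_taylor : forall t, `|A t + k2 * t ^+ 2 / 2 - k4 * t ^+ 4 / 24| <= C * `|t| ^+ 6.
Hypothesis B_taylor : forall t, `|B t + k3 * t ^+ 3 / 6| <= C * `|t| ^+ 5.
Hypothesis rho_taylor : forall t, `|rho t - rho0 - rho2 * t ^+ 2| <= C * `|t| ^+ 4.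
Hypothesis sigma_taylor : forall t, `|sigma t - sigma1 * t| <= C * `|t| ^+ 3.

Lemma nat_bound (N : R) : exists n0 : nat, forall n : nat, (n0 <= n)%N ->
  1 <= Num.sqrt n%:R :> R /\ N <= Num.sqrt n%:R ^+ 2.
Proof.
exists (Num.bound `|N|).+1 => n hn.
have n1 : 1 <= n%:R :> R by rewrite ler1n (leq_trans _ hn).
split; first by have := ler_wsqrtr n1; rewrite sqrtr1.
rewrite sqr_sqrtr ?ler0n// (le_trans (ler_norm N))// (le_trans (ltW (archi_boundP (normr_ge0 N))))//.
by rewrite ler_nat (leq_trans (leqnSn _) hn).
Qed.

Lemma intg_bigO (h : R -> R -> R) (j : nat) : bigO j h ->
  exists n0 : nat, forall n : nat, (n0 <= n)%N -> measurable_fun setT (h (Num.sqrt n%:R)) ->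
  intg leb (fun t => expR (Num.sqrt n%:R ^+ 2 * A t) * h (Num.sqrt n%:R) t).
Proof.
move=> hO; have [K K0 [N HN]] := bigO_majorant a0 b0 k20 A_decay hO.
have [n0 Hn0] := nat_bound N; exists n0 => n /Hn0 [s1 Ns] mh.
set s := Num.sqrt _ in s1 Ns mh *; have sp : 0 < s by rewrite (lt_le_trans _ s1).
have me : measurable_fun setT (fun t => expR (s ^+ 2 * A t) * h s t).
  by apply: measurable_funM => //; apply: measurableT_comp => //; exact: measurable_funM.
apply: (@intg_le _ _ _ leb _ (fun t => K * s^-1 ^+ j * (1 + (s * t) ^+ 2)^-1)) => //.
  move=> t; rewrite (le_trans _ (HN s t s1 Ns))// normrM mulrC ler_wpM2l//.
  by rewrite ger0_norm ?expR_ge0// lerDl expR_ge0.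
by apply: intgZl; exact: (integral_cauchy sp).1.
Qed.

Let gaussE s t : expR (- (s ^+ 2 * (k2 * t ^+ 2 / 2))) = gw (s ^+ 2 * k2) 0 t.
Proof. by rewrite /gw; congr expR; ring. Qed.

Let approxE s t : laplace_approx k2 k3 k4 rho0 rho2 sigma1 s t =
  rho0 * (t ^+ 0 * gw (s ^+ 2 * k2) 0 t) + rho2 * (t ^+ 2 * gw (s ^+ 2 * k2) 0 t)
  + s ^+ 2 * (rho0 * k4 / 24 + sigma1 * k3 / 6) * (t ^+ 4 * gw (s ^+ 2 * k2) 0 t)
  - s ^+ 4 * (rho0 * k3 ^+ 2 / 72) * (t ^+ 6 * gw (s ^+ 2 * k2) 0 t).
Proof. by rewrite /laplace_approx gaussE; ring. Qed.

(** For precision q = s^2 k2 the moments of orders 2, 4, 6 are 1/q, 3/q^2, 15/q^3 times the mass;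
    thus 3/24 = 1/8, 15/72 = 5/24 and 3/6 = 1/2. *)
Let integral_approx s : 0 < s ->
  intg leb (laplace_approx k2 k3 k4 rho0 rho2 sigma1 s) /\
  \int[leb]_t laplace_approx k2 k3 k4 rho0 rho2 sigma1 s t = gmass (s ^+ 2 * k2) 0 *
   (rho0 + (rho0 * (k4 / (8 * k2 ^+ 2) - 5 * k3 ^+ 2 / (24 * k2 ^+ 3)) + rho2 / k2
    + sigma1 * k3 / (2 * k2 ^+ 2)) / s ^+ 2).
Proof.
move=> s0; pose q := s ^+ 2 * k2; have q0 : 0 < q by rewrite mulr_gt0// exprn_gt0.
have i k := intg_gmom 0 k q0.
have j c k := intgZl c (i k).
split.
  apply: (@eq_intg _ _ _ leb _ _ (fun t => esym (approxE s t))).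
  by apply: intgB => //; do 2 (apply: intgD => //).
under eq_Rintegral do rewrite approxE.
rewrite RintegralB//; last by do 2 (apply: intgD => //).
rewrite RintegralD//; last by apply: intgD.
rewrite RintegralD// !RintegralZl// -!/(gmom _ _ _) -/q.
have q1 := lt0r_neq0 q0; have s1 := lt0r_neq0 s0; have k1 := lt0r_neq0 k20.
have m2 : gmom q 0 2 = gmom q 0 0 / q.
  by apply: (mulfI q1); rewrite gmom_rec//=; field.
have m4 : gmom q 0 4 = 3 * gmom q 0 0 / q ^+ 2.
  by apply: (mulfI q1); rewrite gmom_rec//= m2; field.
have m6 : gmom q 0 6 = 15 * gmom q 0 0 / q ^+ 3.
  by apply: (mulfI q1); rewrite gmom_rec//= m4; field.
rewrite m2 m4 m6 gmom0// Rint_gw// /q; move: (gmass _ _) => g; field.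
  by rewrite s1 k1.
exact: intg_gw.
Qed.

Definition laplace_limit (n : nat) : R := gmass (n%:R * k2) 0 *
   (rho0 + (rho0 * (k4 / (8 * k2 ^+ 2) - 5 * k3 ^+ 2 / (24 * k2 ^+ 3)) + rho2 / k2
    + sigma1 * k3 / (2 * k2 ^+ 2)) / n%:R).

(** The remainder has order s^{-4} under an envelope of integral pi/s. The main term is itself of
    size 1/s through [gmass], so the relative error is of order n^{-2}. *)
Lemma laplace : exists2 K : R, 0 <= K & exists n0 : nat, forall n : nat, (n0 <= n)%N ->
  intg leb (laplace_main A B rho sigma (Num.sqrt n%:R)) /\
  `|\int[leb]_t laplace_main A B rho sigma (Num.sqrt n%:R) t - laplace_limit n|
    <= K / (n%:R ^+ 2 * Num.sqrt n%:R).
Proof.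
have [H HO HE] := laplace_error C0 A_taylor B_taylor rho_taylor sigma_taylor.
have [K K0 [N HN]] := bigO_majorant a0 b0 k20 A_decay HO.
exists (K * pi); first by rewrite mulr_ge0 ?pi_ge0.
have [n0 Hn0] := nat_bound N; exists n0 => n /Hn0 [s1 Ns].
set s := Num.sqrt _ in s1 Ns *; have sp : 0 < s by rewrite (lt_le_trans _ s1).
have s2 : n%:R = s ^+ 2 by rewrite sqr_sqrtr ?ler0n.
have [ia ea] := integral_approx sp.
have mcos : measurable_fun setT (fun t => cos (s ^+ 2 * B t)).
  apply: measurableT_comp; last exact: measurable_funM.
  by apply: continuous_measurable_fun; exact: continuous_cos.
have msin : measurable_fun setT (fun t => sin (s ^+ 2 * B t)).
  apply: measurableT_comp; last exact: measurable_funM.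
  by apply: continuous_measurable_fun; exact: continuous_sin.
have mm : measurable_fun setT (laplace_main A B rho sigma s).
  apply: measurable_funM; first by apply: measurableT_comp => //; exact: measurable_funM.
  by apply: measurable_funB; exact: measurable_funM.
have ma : measurable_fun setT (laplace_approx k2 k3 k4 rho0 rho2 sigma1 s).
  exact: intg_measurable ia.
have md : measurable_fun setT (fun t => laplace_main A B rho sigma s t - laplace_approx k2 k3 k4 rho0 rho2 sigma1 s t).
  exact: measurable_funB.
have [ic ec] := integral_cauchy sp.
pose g (t : R) := K * s^-1 ^+ 4 * (1 + (s * t) ^+ 2)^-1.
have ig : intg leb g by exact: intgZl.
have le t : `|laplace_main A B rho sigma s t - laplace_approx k2 k3 k4 rho0 rho2 sigma1 s t| <= g t.
  exact: le_trans (HE s t) (HN s t s1 Ns).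
have id := @intg_le _ _ _ leb _ g md le ig.
have im : intg leb (laplace_main A B rho sigma s).
  by apply: (@eq_intg _ _ _ leb _ _ _ (intgD id ia)) => t; rewrite subrK.
split => //.
have -> : laplace_limit n = \int[leb]_t laplace_approx k2 k3 k4 rho0 rho2 sigma1 s t.
  by rewrite ea /laplace_limit s2.
rewrite -RintegralB//; apply: (le_trans (@Rint_norm_le _ _ _ leb _ g md le ig)).
rewrite RintegralZl// ec s2 le_eqVlt; apply/orP; left; apply/eqP.
by field; rewrite lt0r_neq0.
Qed.

End laplace.

(** * Cumulants and the expansion of the exponent *)

Section cumulants.
Context {R : realType}.
Variables (m : nat) (c : R) (lam d : 'I_m -> R).

Definition admissible (y : R) := forall k, 0 < 1 - 2 * lam k * y.

Lemma near_admissible y : admissible y -> \forall z \near y, admissible z.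
Proof.
move=> hy.
suff H (s : seq 'I_m) : \forall z \near y, forall k, k \in s -> 0 < 1 - 2 * lam k * z.
  by apply: filterS (H (enum 'I_m)) => z hz k; apply: hz; rewrite mem_enum.
elim: s => [|k s IH]; first by near=> z.
have ck : {for y, continuous (fun z => 1 - 2 * lam k * z)}.
  apply: (@der_continuous _ _ (fun=> - (2 * lam k))) => z.
  by eapply der_eq; [der|rewrite /=; ring].
have hk : \forall z \near y, 0 < 1 - 2 * lam k * z.
  by apply: (cvgr_gt (1 - 2 * lam k * y) ck); exact: hy.
apply: filterS2 IH hk => z h1 h2 k'.
by rewrite inE => /orP[/eqP->//|/h1].
Unshelve. all: by end_near. Qed.

(** The formula for the j-th derivative is known only for admissible points; these form a
    neighbourhood of y, so it may be differentiated there. The part [C] comes from the linear term c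
    y. *)
Lemma KYn_step j (F F' : 'I_m -> R -> R) (C C' : R -> R) :
  (forall y, admissible y -> KYn j c lam d y = C y + \sum_(k < m) F k y) ->
  (forall y, der C y (C' y)) ->
  (forall k y, 0 < 1 - 2 * lam k * y -> der (F k) y (F' k y)) ->
  forall y, admissible y -> KYn j.+1 c lam d y = C' y + \sum_(k < m) F' k y.
Proof.
move=> hj hC hF y hy; rewrite /KYn derive1nS derive1E.
rewrite (@near_eq_derive _ _ _ _ (fun z => C z + \sum_(k < m) F k z)) -?derive1E; last first.
  by apply: filterS (near_admissible hy) => z hz; exact: hj.
apply: der_derive1; apply: derD; first exact: hC.
by apply: der_sum => k; apply: hF; exact: hy.
Qed.

Lemma KYn0 y : admissible y -> KYn 0 c lam d y = c * y +
  \sum_(k < m) (- 2^-1 * ln (1 - 2 * lam k * y) + 2^-1 * (d k ^+ 2 * y ^+ 2 / (1 - 2 * lam k * y))).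
Proof.
move=> _; rewrite /KYn derive1n0 /KY big_split/= -!mulr_sumr addrA; congr (_ + _ + _).
by rewrite mulNr.
Qed.

Lemma KYn1 y : admissible y -> KYn 1 c lam d y = c +
  \sum_(k < m) (lam k / (1 - 2 * lam k * y) + d k ^+ 2 * (y - lam k * y ^+ 2) / (1 - 2 * lam k * y) ^+ 2).
Proof.
move=> hy; apply: (@KYn_step 0 (fun k y => - 2^-1 * ln (1 - 2 * lam k * y) + 2^-1 * (d k ^+ 2 * y ^+ 2 / (1 - 2 * lam k * y)))
  (fun k y => lam k / (1 - 2 * lam k * y) + d k ^+ 2 * (y - lam k * y ^+ 2) / (1 - 2 * lam k * y) ^+ 2) (fun z => c * z) (fun=> c) KYn0) hy => [z|k z qz].
  by eapply der_eq; [der|rewrite /=; ring].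
have q1 := lt0r_neq0 qz.
by eapply der_eq; [der|rewrite /=; field].
Qed.

Lemma KYn2 y : admissible y -> KYn 2 c lam d y =
  \sum_(k < m) (2 * lam k ^+ 2 / (1 - 2 * lam k * y) ^+ 2 + d k ^+ 2 / (1 - 2 * lam k * y) ^+ 3).
Proof.
move=> hy; rewrite -[RHS]add0r; apply: (@KYn_step 1 (fun k y => lam k / (1 - 2 * lam k * y) + d k ^+ 2 * (y - lam k * y ^+ 2) / (1 - 2 * lam k * y) ^+ 2)
  (fun k y => 2 * lam k ^+ 2 / (1 - 2 * lam k * y) ^+ 2 + d k ^+ 2 / (1 - 2 * lam k * y) ^+ 3) (fun=> c) (fun=> 0) KYn1) hy => [z|k z qz].
  exact: der_cst.
have q1 := lt0r_neq0 qz.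
by eapply der_eq; [der; rewrite ?expf_neq0|rewrite /=; field].
Qed.

Lemma KYn3 y : admissible y -> KYn 3 c lam d y =
  \sum_(k < m) (8 * lam k ^+ 3 / (1 - 2 * lam k * y) ^+ 3 + 6 * lam k * d k ^+ 2 / (1 - 2 * lam k * y) ^+ 4).
Proof.
have h z : admissible z -> KYn 2 c lam d z = 0 +
  \sum_(k < m) (2 * lam k ^+ 2 / (1 - 2 * lam k * z) ^+ 2 + d k ^+ 2 / (1 - 2 * lam k * z) ^+ 3).
  by rewrite add0r; exact: KYn2.
move=> hy; rewrite -[RHS]add0r; apply: (@KYn_step 2 (fun k y => 2 * lam k ^+ 2 / (1 - 2 * lam k * y) ^+ 2 + d k ^+ 2 / (1 - 2 * lam k * y) ^+ 3)
  (fun k y => 8 * lam k ^+ 3 / (1 - 2 * lam k * y) ^+ 3 + 6 * lam k * d k ^+ 2 / (1 - 2 * lam k * y) ^+ 4) (fun=> 0) (fun=> 0) h) hy => [z|k z qz].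
  exact: der_cst.
have q1 := lt0r_neq0 qz.
by eapply der_eq; [der; rewrite ?expf_neq0|rewrite /=; field].
Qed.

Lemma KYn4 y : admissible y -> KYn 4 c lam d y =
  \sum_(k < m) (48 * lam k ^+ 4 / (1 - 2 * lam k * y) ^+ 4 + 48 * lam k ^+ 2 * d k ^+ 2 / (1 - 2 * lam k * y) ^+ 5).
Proof.
have h z : admissible z -> KYn 3 c lam d z = 0 +
  \sum_(k < m) (8 * lam k ^+ 3 / (1 - 2 * lam k * z) ^+ 3 + 6 * lam k * d k ^+ 2 / (1 - 2 * lam k * z) ^+ 4).
  by rewrite add0r; exact: KYn3.
move=> hy; rewrite -[RHS]add0r; apply: (@KYn_step 3 (fun k y => 8 * lam k ^+ 3 / (1 - 2 * lam k * y) ^+ 3 + 6 * lam k * d k ^+ 2 / (1 - 2 * lam k * y) ^+ 4)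
  (fun k y => 48 * lam k ^+ 4 / (1 - 2 * lam k * y) ^+ 4 + 48 * lam k ^+ 2 * d k ^+ 2 / (1 - 2 * lam k * y) ^+ 5) (fun=> 0) (fun=> 0) h) hy => [z|k z qz].
  exact: der_cst.
have q1 := lt0r_neq0 qz.
by eapply der_eq; [der; rewrite ?expf_neq0|rewrite /=; field].
Qed.

End cumulants.

(** * Taylor bounds for one coordinate *)

Section coordinate_taylor.
Context {R : realType}.
Variables (eta lam d : R).
Hypothesis q0 : 0 < tq eta lam.
Notation q := (tq eta lam).

(** [tbeta] and [tdelta] are the beta and delta of log G_0 for the tilted coordinate. All its
    cumulants from the second on are polynomials in them: beta^2/2 + delta, beta^3 + 3 delta beta, 3
    beta^4 + 12 delta beta^2, and so on. *)
Definition tbeta : R := 2 * lam / q.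
Definition tdelta : R := (d + 2 * lam * (eta * d / q)) ^+ 2 / q.

Let q1 : q != 0. Proof. exact: lt0r_neq0. Qed.

Let z0 (t : R) : 0 <= (tbeta * t) ^+ 2. Proof. exact: sqr_ge0. Qed.

Let D0 (t : R) : 0 < 1 + (tbeta * t) ^+ 2. Proof. by rewrite ltr_pwDl. Qed.

Let Dinv (t : R) : `|(1 + (tbeta * t) ^+ 2)^-1| <= 1.
Proof. by rewrite ger0_norm ?invr_ge0 ?(ltW (D0 t))// invf_le1// lerDl. Qed.

Lemma tdeltaE : tdelta = d ^+ 2 / q ^+ 3.
Proof.
have e : d + 2 * lam * (eta * d / q) = d / q.
  by have q1' := q1; rewrite /tq in q1' *; field.
by rewrite /tdelta e; field.
Qed.

Lemma tdelta_ge0 : 0 <= tdelta.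
Proof. by rewrite /tdelta divr_ge0 ?sqr_ge0// ltW. Qed.

Lemma tA_E t : tA eta lam d t = - 4^-1 * ln (1 + (tbeta * t) ^+ 2)
  - 2^-1 * tdelta * t ^+ 2 / (1 + (tbeta * t) ^+ 2).
Proof. by []. Qed.

Let frac (t z : R) : 0 <= z -> `|(1 + z)^-1 - 1 + z| <= z ^+ 2.
Proof.
move=> hz; have p : 0 < 1 + z by rewrite ltr_pwDl.
have -> : (1 + z)^-1 - 1 + z = z ^+ 2 / (1 + z) by field; rewrite lt0r_neq0.
rewrite ger0_norm; last by rewrite divr_ge0 ?sqr_ge0// ltW.
by rewrite ler_pdivrMr// ler_peMr ?sqr_ge0// lerDl.
Qed.

Let frac1 (z : R) : 0 <= z -> `|(1 + z)^-1 - 1| <= z.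
Proof.
move=> hz; have p : 0 < 1 + z by rewrite ltr_pwDl.
have -> : (1 + z)^-1 - 1 = - (z / (1 + z)) by field; rewrite lt0r_neq0.
rewrite normrN ger0_norm; last by rewrite divr_ge0// ltW.
by rewrite ler_pdivrMr// ler_peMr// lerDl.
Qed.

Lemma tA_taylor t :
  `|tA eta lam d t + (tbeta ^+ 2 / 2 + tdelta) * t ^+ 2 / 2
    - (3 * tbeta ^+ 4 + 12 * tdelta * tbeta ^+ 2) * t ^+ 4 / 24|
  <= (tbeta ^+ 6 + tdelta * tbeta ^+ 4) * `|t| ^+ 6.
Proof.
rewrite tA_E; set z := (tbeta * t) ^+ 2.
have zz : 0 <= z by exact: z0.
have t6 : `|t| ^+ 6 = t ^+ 6 by rewrite -normrX ger0_norm// (exprM t 3 2) sqr_ge0.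
have [l1 l2] := andP (ln1D_bounds zz).
have h1 : `|- 4^-1 * (ln (1 + z) - (z - z ^+ 2 / 2))| <= z ^+ 3.
  have z3 : 0 <= z ^+ 3 by exact: exprn_ge0.
  rewrite ler_norml; apply/andP; split; lra.
have h2 : `|- 2^-1 * tdelta * t ^+ 2 * ((1 + z)^-1 - 1 + z)| <= tdelta * t ^+ 2 * z ^+ 2.
  rewrite normrM; apply: ler_pM => //; last exact: frac.
  have : 0 <= tdelta * t ^+ 2 by rewrite mulr_ge0 ?tdelta_ge0 ?sqr_ge0.
  have -> : - 2^-1 * tdelta * t ^+ 2 = - 2^-1 * (tdelta * t ^+ 2) by ring.
  by move: (tdelta * t ^+ 2) => y y0; rewrite ler_norml; apply/andP; split; lra.
have -> : - 4^-1 * ln (1 + z) - 2^-1 * tdelta * t ^+ 2 / (1 + z)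
    + (tbeta ^+ 2 / 2 + tdelta) * t ^+ 2 / 2
    - (3 * tbeta ^+ 4 + 12 * tdelta * tbeta ^+ 2) * t ^+ 4 / 24 =
    - 4^-1 * (ln (1 + z) - (z - z ^+ 2 / 2)) + - 2^-1 * tdelta * t ^+ 2 * ((1 + z)^-1 - 1 + z).
  have -> : (3 * tbeta ^+ 4 + 12 * tdelta * tbeta ^+ 2) * t ^+ 4 / 24 = z ^+ 2 / 8 + tdelta * t ^+ 2 * z / 2.
    by rewrite /z; field.
  have -> : (tbeta ^+ 2 / 2 + tdelta) * t ^+ 2 / 2 = z / 4 + tdelta * t ^+ 2 / 2.
    by rewrite /z; field.
  by move: (1 + z)^-1 => iz; field.
rewrite (le_trans (ler_normD _ _))// (le_trans (lerD h1 h2))//.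
by rewrite t6 /z le_eqVlt; apply/orP; left; apply/eqP; ring.
Qed.

Lemma tA_decay1 t : tA eta lam d t <= - 4^-1 * ln (1 + tbeta ^+ 2 * t ^+ 2).
Proof.
have h : 0 <= 2^-1 * tdelta * t ^+ 2 / (1 + (tbeta * t) ^+ 2).
  apply: divr_ge0; last exact: ltW.
  by apply: mulr_ge0; [apply: mulr_ge0 => //; exact: tdelta_ge0|exact: sqr_ge0].
by rewrite tA_E -exprMn lerBlDr lerDl.
Qed.

(** A coordinate that is linear in Z decays like a Gaussian. This is weakened to logarithmic decay,
    so that one shape of majorant covers both kinds of coordinates. *)
Lemma tA_decay2 t : tbeta = 0 -> tA eta lam d t <= - 2^-1 * ln (1 + tdelta * t ^+ 2).
Proof.
move=> b0; rewrite tA_E b0 mul0r expr0n/= addr0 ln1 mulr0 divr1 sub0r.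
have h : 0 <= tdelta * t ^+ 2 by rewrite mulr_ge0 ?tdelta_ge0 ?sqr_ge0.
have : ln (1 + tdelta * t ^+ 2) <= tdelta * t ^+ 2.
  rewrite -ler_expR lnK ?posrE; first exact: expR_ge1Dx.
  by rewrite ltr_pwDl.
lra.
Qed.

Lemma tA_le0 t : tA eta lam d t <= 0.
Proof.
apply: (le_trans (tA_decay1 t)); rewrite mulNr oppr_le0 mulr_ge0// ln_ge0//.
by rewrite lerDl mulr_ge0 ?sqr_ge0.
Qed.

(** Mean of d Z + lam Z^2 under the tilted law, written as the summand of the saddlepoint
    equation. *)
Definition tmean : R := lam / q + d ^+ 2 * (1 - lam * eta) * eta / q ^+ 2.

Lemma tB_taylor t :
  `|tB eta lam d t - tmean * t + (tbeta ^+ 3 + 3 * tdelta * tbeta) * t ^+ 3 / 6|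
  <= (`|tbeta| ^+ 5 + `|tdelta * tbeta ^+ 3|) * `|t| ^+ 5.
Proof.
pose z := (tbeta * t) ^+ 2.
have m0 : d * (eta * d / q) + lam * (eta * d / q) ^+ 2 = tmean - tbeta / 2.
  by rewrite /tmean /tbeta; have q1' := q1; rewrite /tq in q1' *; field.
have h1 : `|2^-1 * (atan (tbeta * t) - tbeta * t + (tbeta * t) ^+ 3 / 3)| <= `|tbeta * t| ^+ 5.
  rewrite normrM (ger0_norm (_ : 0 <= 2^-1))// (le_trans _ (atan_taylor (tbeta * t)))//.
  by rewrite ler_piMl//; lra.
have h2 : `|- 2^-1 * tdelta * tbeta * t ^+ 3 * ((1 + z)^-1 - 1)| <= `|tdelta * tbeta * t ^+ 3| * z.
  rewrite normrM ler_pM//; last exact/frac1/z0.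
  have -> : - 2^-1 * tdelta * tbeta * t ^+ 3 = - 2^-1 * (tdelta * tbeta * t ^+ 3) by ring.
  by rewrite normrM ler_piMl// normrN ger0_norm; lra.
have -> : tB eta lam d t - tmean * t + (tbeta ^+ 3 + 3 * tdelta * tbeta) * t ^+ 3 / 6 =
    2^-1 * (atan (tbeta * t) - tbeta * t + (tbeta * t) ^+ 3 / 3)
    + - 2^-1 * tdelta * tbeta * t ^+ 3 * ((1 + z)^-1 - 1).
  have -> : tB eta lam d t = (d * (eta * d / q) + lam * (eta * d / q) ^+ 2) * t
     + 2^-1 * atan (tbeta * t) - 2^-1 * tdelta * tbeta * t ^+ 3 * (1 + z)^-1 by [].
  by rewrite m0; move: (1 + z)^-1 (atan _) => iz at'; field.
rewrite (le_trans (ler_normD _ _))// (le_trans (lerD h1 h2))//.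
have -> : z = `|tbeta ^+ 2 * t ^+ 2|.
  rewrite ger0_norm; first by rewrite /z exprMn.
  by apply: mulr_ge0; exact: sqr_ge0.
rewrite -normrM le_eqVlt; apply/orP; left; apply/eqP.
have -> : tdelta * tbeta * t ^+ 3 * (tbeta ^+ 2 * t ^+ 2) = tdelta * tbeta ^+ 3 * t ^+ 5 by ring.
by rewrite (normrM tbeta) exprMn (normrM (tdelta * tbeta ^+ 3)) normrX; ring.
Qed.

Lemma tre_taylor t :
  `|tre eta lam d t - eta * d / q - (- (d * tbeta / q ^+ 2)) * t ^+ 2|
  <= `|d * tbeta ^+ 3 / q ^+ 2| * `|t| ^+ 4.
Proof.
have D1 := lt0r_neq0 (D0 t).
have e : tre eta lam d t - eta * d / q - (- (d * tbeta / q ^+ 2)) * t ^+ 2 =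
    (d * tbeta ^+ 3 / q ^+ 2) * t ^+ 4 / (1 + (tbeta * t) ^+ 2).
  have D2 : q ^+ 2 + (2 * lam * t) ^+ 2 != 0.
    by rewrite gt_eqF// ltr_pwDl ?exprn_gt0// sqr_ge0.
  rewrite /tre /tbeta.
  have q1' := q1; rewrite /tq in q1' D2 *; field.
  by rewrite q1' D2.
by rewrite e normrM normrM -normrX ler_piMr ?mulr_ge0// Dinv.
Qed.

Lemma tim_taylor t :
  `|tim eta lam d t - d / q ^+ 2 * t| <= `|d * tbeta ^+ 2 / q ^+ 2| * `|t| ^+ 3.
Proof.
have D1 := lt0r_neq0 (D0 t).
have e : tim eta lam d t - d / q ^+ 2 * t =
    - (d * tbeta ^+ 2 / q ^+ 2 * t ^+ 3 / (1 + (tbeta * t) ^+ 2)).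
  have D2 : q ^+ 2 + (2 * lam * t) ^+ 2 != 0.
    by rewrite gt_eqF// ltr_pwDl ?exprn_gt0// sqr_ge0.
  by rewrite /tim /tbeta; field; rewrite q1 D2.
by rewrite e normrN normrM normrM -normrX ler_piMr ?mulr_ge0// Dinv.
Qed.

(* tre + i tim = s d / (1 - 2 lam s) at s = eta + i t; dividing by s gives hre + i him. *)
Definition hre (t : R) : R := d / q / (1 + (tbeta * t) ^+ 2).
Definition him (t : R) : R := d / q * tbeta * t / (1 + (tbeta * t) ^+ 2).

Lemma hre_taylor t :
  `|hre t - d / q - (- (d / q * tbeta ^+ 2)) * t ^+ 2| <= `|d / q * tbeta ^+ 4| * `|t| ^+ 4.
Proof.
have D1 := lt0r_neq0 (D0 t).
have e : hre t - d / q - (- (d / q * tbeta ^+ 2)) * t ^+ 2 =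
    (d / q * tbeta ^+ 4) * t ^+ 4 / (1 + (tbeta * t) ^+ 2).
  by rewrite /hre; field; rewrite D1 q1.
by rewrite e normrM normrM -normrX ler_piMr ?mulr_ge0// Dinv.
Qed.

Lemma him_taylor t :
  `|him t - d / q * tbeta * t| <= `|d / q * tbeta ^+ 3| * `|t| ^+ 3.
Proof.
have D1 := lt0r_neq0 (D0 t).
have e : him t - d / q * tbeta * t = - (d / q * tbeta ^+ 3 * t ^+ 3 / (1 + (tbeta * t) ^+ 2)).
  by rewrite /him; field; rewrite D1 q1.
by rewrite e normrN normrM normrM -normrX ler_piMr ?mulr_ge0// Dinv.
Qed.

(** The factor s cancels and leaves d / (1 - 2 lam s). The Taylor bounds of the quotient thus
    contain no negative power of eta. *)
Lemma hre_him_div t : eta ^+ 2 + t ^+ 2 != 0 ->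
  (tre eta lam d t * eta + tim eta lam d t * t) / (eta ^+ 2 + t ^+ 2) = hre t /\
  (tim eta lam d t * eta - tre eta lam d t * t) / (eta ^+ 2 + t ^+ 2) = him t.
Proof.
move=> e0; have D2 : q ^+ 2 + (2 * lam * t) ^+ 2 != 0.
  by rewrite gt_eqF// ltr_pwDl ?exprn_gt0// sqr_ge0.
have q1' := q1.
split; apply: (mulIf e0); rewrite divfK// /tre /tim /hre /him /tbeta.
  by rewrite /tq in q1' D2 *; field; rewrite q1' D2.
by rewrite /tq in q1' D2 *; field; rewrite q1' D2.
Qed.

End coordinate_taylor.

(** The derivative is existential so that [der] can produce it and it never has to be written
    down. *)
Lemma der_measurable_ex (R : realType) (f : R -> R) : (forall x, exists a, der f x a) ->
  measurable_fun setT f.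
Proof. by move=> /choice [df]; exact: der_measurable. Qed.

(** * Summation over the coordinates *)

Section totals.
Context {R : realType}.
Notation leb := (@lebesgue_measure R).
Variables (m : nat) (c v eta : R) (lam d w : 'I_m -> R).
Hypothesis q0 : forall k, 0 < tq eta (lam k).
Hypothesis saddle : \sum_(k < m) ((lam k * (1 - 2 * lam k * eta) + d k ^+ 2 * (1 - lam k * eta) * eta)
                / (1 - 2 * lam k * eta) ^+ 2) = v - c.

Definition totA (t : R) : R := \sum_(k < m) tA eta (lam k) (d k) t.
Definition totB (t : R) : R := \sum_(k < m) tB eta (lam k) (d k) t - t * (v - c).
Definition totre (t : R) : R := \sum_(k < m) w k * tre eta (lam k) (d k) t.
Definition totim (t : R) : R := \sum_(k < m) w k * tim eta (lam k) (d k) t.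
Definition tothre (t : R) : R := \sum_(k < m) w k * hre eta (lam k) (d k) t.
Definition tothim (t : R) : R := \sum_(k < m) w k * him eta (lam k) (d k) t.

Let beta k := tbeta eta (lam k).
Let delta k := tdelta eta (lam k) (d k).

Lemma sum_norm_le (f Cf : 'I_m -> R) (X : R) : (forall k, `|f k| <= Cf k * X) ->
  `|\sum_(k < m) f k| <= (\sum_(k < m) Cf k) * X.
Proof.
move=> h; rewrite mulr_suml; apply: le_trans (ler_norm_sum _ _ _) _.
exact: ler_sum.
Qed.

Lemma KYn2_sum : KYn 2 c lam d eta = \sum_(k < m) (beta k ^+ 2 / 2 + delta k).
Proof.
rewrite KYn2; last by move=> k; exact: q0.
apply: eq_bigr => k _; rewrite /delta tdeltaE// /beta /tbeta.
by have q1 := lt0r_neq0 (q0 k); rewrite /tq in q1 *; field.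
Qed.

Lemma KYn3_sum : KYn 3 c lam d eta = \sum_(k < m) (beta k ^+ 3 + 3 * delta k * beta k).
Proof.
rewrite KYn3; last by move=> k; exact: q0.
apply: eq_bigr => k _; rewrite /delta tdeltaE// /beta /tbeta.
by have q1 := lt0r_neq0 (q0 k); rewrite /tq in q1 *; field.
Qed.

Lemma KYn4_sum : KYn 4 c lam d eta = \sum_(k < m) (3 * beta k ^+ 4 + 12 * delta k * beta k ^+ 2).
Proof.
rewrite KYn4; last by move=> k; exact: q0.
apply: eq_bigr => k _; rewrite /delta tdeltaE// /beta /tbeta.
by have q1 := lt0r_neq0 (q0 k); rewrite /tq in q1 *; field.
Qed.

Lemma totA_taylor : exists2 C, 0 <= C & forall t,
  `|totA t + KYn 2 c lam d eta * t ^+ 2 / 2 - KYn 4 c lam d eta * t ^+ 4 / 24| <= C * `|t| ^+ 6.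
Proof.
exists (\sum_(k < m) (beta k ^+ 6 + delta k * beta k ^+ 4)).
  apply: sumr_ge0 => k _; rewrite addr_ge0//; first by rewrite (exprM _ 3 2) sqr_ge0.
  by rewrite mulr_ge0 ?tdelta_ge0// (exprM _ 2 2) sqr_ge0.
move=> t; rewrite KYn2_sum KYn4_sum.
have -> : totA t + (\sum_(k < m) (beta k ^+ 2 / 2 + delta k)) * t ^+ 2 / 2 -
    (\sum_(k < m) (3 * beta k ^+ 4 + 12 * delta k * beta k ^+ 2)) * t ^+ 4 / 24 =
    \sum_(k < m) (tA eta (lam k) (d k) t + (beta k ^+ 2 / 2 + delta k) * t ^+ 2 / 2
     - (3 * beta k ^+ 4 + 12 * delta k * beta k ^+ 2) * t ^+ 4 / 24).
  by rewrite /totA !mulr_suml -big_split/= -sumrB.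
by apply: sum_norm_le => k; exact: tA_taylor.
Qed.

Lemma totB_taylor : exists2 C, 0 <= C & forall t,
  `|totB t + KYn 3 c lam d eta * t ^+ 3 / 6| <= C * `|t| ^+ 5.
Proof.
exists (\sum_(k < m) (`|beta k| ^+ 5 + `|delta k * beta k ^+ 3|)).
  by apply: sumr_ge0 => k _; rewrite addr_ge0// exprn_ge0.
move=> t; rewrite KYn3_sum.
have -> : totB t + (\sum_(k < m) (beta k ^+ 3 + 3 * delta k * beta k)) * t ^+ 3 / 6 =
    \sum_(k < m) (tB eta (lam k) (d k) t - tmean eta (lam k) (d k) * t
     + (beta k ^+ 3 + 3 * delta k * beta k) * t ^+ 3 / 6).
  (* The saddlepoint equation, read as: the tilted means add up to v - c. *)
  have e : t * (v - c) = \sum_(k < m) tmean eta (lam k) (d k) * t.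
    rewrite -saddle mulr_sumr; apply: eq_bigr => k _; rewrite /tmean.
    by have q1 := lt0r_neq0 (q0 k); rewrite /tq in q1 *; field.
  rewrite /totB e !mulr_suml -sumrB -big_split/=.
  by [].
by apply: sum_norm_le => k; exact: tB_taylor.
Qed.

Let taylor_sum (f : 'I_m -> R -> R) (C0 C2 C4 : 'I_m -> R) :
  (forall k t, `|f k t - C0 k - C2 k * t ^+ 2| <= `|C4 k| * `|t| ^+ 4) ->
  exists2 C, 0 <= C & forall t, `|(\sum_(k < m) w k * f k t) - (\sum_(k < m) w k * C0 k)
    - (\sum_(k < m) w k * C2 k) * t ^+ 2| <= C * `|t| ^+ 4.
Proof.
move=> h; exists (\sum_(k < m) `|w k| * `|C4 k|).
  by apply: sumr_ge0 => k _; rewrite mulr_ge0.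
move=> t; have -> : (\sum_(k < m) w k * f k t) - (\sum_(k < m) w k * C0 k)
    - (\sum_(k < m) w k * C2 k) * t ^+ 2 = \sum_(k < m) w k * (f k t - C0 k - C2 k * t ^+ 2).
  by rewrite mulr_suml -!sumrB; apply: eq_bigr => k _; ring.
by apply: sum_norm_le => k; rewrite normrM -mulrA ler_wpM2l.
Qed.

Let taylor_sum1 (f : 'I_m -> R -> R) (C1 C3 : 'I_m -> R) :
  (forall k t, `|f k t - C1 k * t| <= `|C3 k| * `|t| ^+ 3) ->
  exists2 C, 0 <= C & forall t, `|(\sum_(k < m) w k * f k t)
    - (\sum_(k < m) w k * C1 k) * t| <= C * `|t| ^+ 3.
Proof.
move=> h; exists (\sum_(k < m) `|w k| * `|C3 k|).
  by apply: sumr_ge0 => k _; rewrite mulr_ge0.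
move=> t; have -> : (\sum_(k < m) w k * f k t) - (\sum_(k < m) w k * C1 k) * t
    = \sum_(k < m) w k * (f k t - C1 k * t).
  by rewrite mulr_suml -!sumrB; apply: eq_bigr => k _; ring.
by apply: sum_norm_le => k; rewrite normrM -mulrA ler_wpM2l.
Qed.

Lemma totre_taylor : exists2 C, 0 <= C & forall t, `|totre t
    - (\sum_(k < m) w k * (eta * d k / tq eta (lam k)))
    - (\sum_(k < m) w k * (- (d k * beta k / tq eta (lam k) ^+ 2))) * t ^+ 2| <= C * `|t| ^+ 4.
Proof. by apply: taylor_sum => k t; exact: tre_taylor. Qed.

Lemma totim_taylor : exists2 C, 0 <= C & forall t, `|totim t
    - (\sum_(k < m) w k * (d k / tq eta (lam k) ^+ 2)) * t| <= C * `|t| ^+ 3.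
Proof. by apply: taylor_sum1 => k t; exact: tim_taylor. Qed.

Lemma tothre_taylor : exists2 C, 0 <= C & forall t, `|tothre t
    - (\sum_(k < m) w k * (d k / tq eta (lam k)))
    - (\sum_(k < m) w k * (- (d k / tq eta (lam k) * beta k ^+ 2))) * t ^+ 2| <= C * `|t| ^+ 4.
Proof. by apply: taylor_sum => k t; exact: hre_taylor. Qed.

Lemma tothim_taylor : exists2 C, 0 <= C & forall t, `|tothim t
    - (\sum_(k < m) w k * (d k / tq eta (lam k) * beta k)) * t| <= C * `|t| ^+ 3.
Proof. by apply: taylor_sum1 => k t; exact: him_taylor. Qed.

(** If the second cumulant is positive, some coordinate has beta or delta nonzero. Its decay
    suffices, since every other coordinate contributes a nonpositive amount. *)
Lemma totA_decay : 0 < KYn 2 c lam d eta -> exists2 a, 0 < a & exists2 b, 0 < b &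
  forall t, totA t <= - a * ln (1 + b * t ^+ 2).
Proof.
rewrite KYn2_sum => K2.
have h k : 0 <= beta k ^+ 2 / 2 + delta k.
  by rewrite addr_ge0 ?tdelta_ge0// divr_ge0 ?sqr_ge0.
have [k hk] : exists k, beta k ^+ 2 / 2 + delta k != 0.
  apply: contrapT => no; move: K2; rewrite big1 ?ltxx// => k _.
  by apply: contrapT => nk; apply: no; exists k; apply/eqP.
have le t : totA t <= tA eta (lam k) (d k) t.
  rewrite /totA (bigD1 k)//= gerDl; apply: sumr_le0 => i _.
  exact: tA_le0.
have [b0|b0] := eqVneq (beta k) 0.
  exists 2^-1 => //; exists (delta k).
    by move: hk; rewrite b0 expr0n/= mul0r add0r lt0r => ->; exact: tdelta_ge0.
  by move=> t; rewrite (le_trans (le t))// tA_decay2.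
exists 4^-1 => //; exists (beta k ^+ 2); first by rewrite exprn_even_gt0.
by move=> t; rewrite (le_trans (le t))// tA_decay1.
Qed.

Let D1 k (t : R) : 0 < 1 + (tbeta eta (lam k) * t) ^+ 2.
Proof. by rewrite ltr_pwDl// sqr_ge0. Qed.

Lemma measurable_totA : measurable_fun setT totA.
Proof.
apply: der_measurable_ex => t; eexists; apply: der_sum => k.
by apply: der_gA; exact: q0.
Qed.

Lemma measurable_totB : measurable_fun setT totB.
Proof.
apply: der_measurable_ex => t; eexists; apply: derB.
  by apply: der_sum => k; apply: der_gB; exact: q0.
by der.
Qed.

Let D2 k (t : R) : tq eta (lam k) ^+ 2 + (2 * lam k * t) ^+ 2 != 0.
Proof. by rewrite gt_eqF// ltr_pwDl ?exprn_gt0// sqr_ge0. Qed.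

Let measurable_wsum (f : 'I_m -> R -> R) : (forall k, measurable_fun setT (f k)) ->
  measurable_fun setT (fun t => \sum_(k < m) w k * f k t).
Proof. by move=> h; apply: measurable_sum => k; exact: measurable_funM. Qed.

Lemma measurable_totre : measurable_fun setT totre.
Proof.
apply: measurable_wsum => k; apply: der_measurable_ex => t; eexists.
by have D := D2 k t; rewrite /tre; der.
Qed.

Lemma measurable_totim : measurable_fun setT totim.
Proof.
apply: measurable_wsum => k; apply: der_measurable_ex => t; eexists.
by have D := D2 k t; rewrite /tim; der.
Qed.

Lemma measurable_tothre : measurable_fun setT tothre.
Proof.
apply: measurable_wsum => k; apply: der_measurable_ex => t; eexists.
by have D := lt0r_neq0 (D1 k t); rewrite /hre; der.
Qed.

Lemma measurable_tothim : measurable_fun setT tothim.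
Proof.
apply: measurable_wsum => k; apply: der_measurable_ex => t; eexists.
by have D := lt0r_neq0 (D1 k t); rewrite /him; der.
Qed.

End totals.

(** * Inversion on windows and half-lines *)

Lemma der_continuous_ex (R : realType) (f : R -> R) : (forall x, exists a, der f x a) -> continuous f.
Proof. by move=> /choice [df]; exact: der_continuous. Qed.

Lemma continuous_patch (R : realType) (g : R -> R) (A : set R) (x : R) : continuous g ->
  nbhs x A \/ nbhs x (~` A) -> {for x, continuous (g \_ A)}.
Proof.
move=> cg [nA|nA].
  have gx : (g \_ A) x = g x by rewrite patchE mem_set//; exact: nbhs_singleton nA.
  rewrite /prop_for /continuous_at gx; apply: cvg_trans (cg x).
  by apply: near_eq_cvg; apply: filterS nA => y Ay; rewrite patchE mem_set.
have gx : (g \_ A) x = 0 by rewrite patchE memNset//; exact: nbhs_singleton nA.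
rewrite /prop_for /continuous_at gx; apply: cvg_trans (@cvg_cst _ (0 : R) _ (nbhs x) _).
by apply: near_eq_cvg; apply: filterS nA => y Ay; rewrite patchE memNset.
Qed.

Lemma ftc_half (R : realType) (h h' : R -> R) : (forall x, der h x (h' x)) -> continuous h' ->
  intg (@lebesgue_measure R) (h' \_ `[0, +oo[) -> h n%:R @[n --> \oo] --> (0 : R) ->
  \int[@lebesgue_measure R]_x (h' \_ `[0, +oo[) x = - h 0.
Proof.
move=> dh ch ih hp.
have mh : measurable_fun setT h' by exact: continuous_measurable_fun.
have cv : \int[@lebesgue_measure R]_x ((h' \_ `[0, n%:R]) x) @[n --> \oo] -->
    \int[@lebesgue_measure R]_x (h' \_ `[0, +oo[) x.
  apply: (@Rint_dct _ _ _ (@lebesgue_measure R) (fun n => h' \_ `[0, n%:R]) _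
    (fun x => `|(h' \_ `[0, +oo[) x|)).
  - by move=> n; apply/measurable_restrict => //; exact: measurable_funS mh.
  - move=> x; apply: cvg_near_cst; near=> n.
    rewrite !patchE; have xn : x <= n%:R.
      by rewrite (le_trans (ler_norm x))//; near: n; exact: nbhs_infty_ger.
    have [x0|x0] := leP 0 x.
      by rewrite !mem_set//= in_itv/= ?x0// ?andbT.
    by rewrite !memNset//= in_itv/= leNgt x0.
  - exact: intg_norm.
  - move=> n x; rewrite !patchE; case: ifPn => [|_]; last by rewrite normr0.
    rewrite inE/= in_itv/= => /andP[x0 _]; rewrite mem_set//= in_itv/= x0//.
have cv2 : \int[@lebesgue_measure R]_x ((h' \_ `[0, n%:R]) x) @[n --> \oo] --> - h 0.
  have h0 : h n%:R - h 0 @[n --> \oo] --> - h 0.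
    by rewrite -[X in _ --> X]add0r; apply: cvgB => //; exact: cvg_cst.
  apply: cvg_trans h0; apply: near_eq_cvg; near=> n.
  rewrite -Rintegral_mkcond (ftc_interval _ dh)//.
  by rewrite ltr0n; near: n; exact: nbhs_infty_gt.
exact: cvg_unique cv cv2.
Unshelve. all: by end_near. Qed.

Section inversion_applications.
Context {R : realType} {dT : measure_display} {T : measurableType dT}.
Notation leb := (@lebesgue_measure R).
Variable P : probability T R.

(** Within distance e of x continuity gives [k]; beyond it, 2 K <= (2 K/e^2) (y - x)^2. *)
Lemma continuous_quadratic_modulus (f : R -> R) (K x : R) : (forall y, `|f y| <= K) ->
  {for x, continuous f} -> forall k, 0 < k ->
  exists2 L, 0 <= L & forall y, `|f y - f x| <= k + L * (y - x) ^+ 2.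
Proof.
move=> fK cf k k0.
have K0 : 0 <= K by rewrite (le_trans _ (fK x)).
have [e e0 He] : exists2 e : R, 0 < e & forall y, `|x - y| < e -> `|f x - f y| <= k.
  by move/cvgrPdist_le : cf => /(_ _ k0) [e /= e0 He]; exists e => // y /He.
have L0 : 0 <= 2 * K / e ^+ 2 by rewrite divr_ge0 ?sqr_ge0// mulr_ge0.
exists (2 * K / e ^+ 2) => //.
move=> y; rewrite distrC; have [xy|xy] := ltP `|x - y| e.
  by rewrite (le_trans (He _ xy))// lerDl mulr_ge0 ?sqr_ge0.
rewrite (@le_trans _ _ (2 * K))//.
  by rewrite (le_trans (ler_normB _ _))// mulrDl mul1r lerD.
have e2 : e ^+ 2 <= (y - x) ^+ 2.
  rewrite -[leRHS]real_normK ?num_real// distrC; apply: lerXn2r => //; rewrite nnegrE//.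
  exact: ltW.
rewrite -[leLHS]add0r lerD ?(ltW k0)// mulrAC ler_pdivlMr ?exprn_gt0//.
by rewrite ler_wpM2l// mulr_ge0.
Qed.

Variables (X S : T -> R) (hC hS M : R -> R).
Hypothesis iX : intg P X.
Hypothesis mS : measurable_fun setT S.
Hypothesis hCE : forall t, \int[P]_x (X x * cos (t * S x)) = hC t.
Hypothesis hSE : forall t, \int[P]_x (X x * sin (t * S x)) = hS t.
Hypothesis mC : measurable_fun setT hC.
Hypothesis mSn : measurable_fun setT hS.
Hypothesis CM : forall t, `|hC t| <= M t.
Hypothesis SM : forall t, `|hS t| <= M t.
Hypothesis iM : intg leb M.
Hypothesis iM1 : intg leb (fun t => `|t| * M t).

(* An atom at y keeps E[X gw_p(S - y)] bounded below as p grows, whereas by inversion it is O(gmass p 0). *)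
Lemma atom_free (y r : R) : 0 < r -> (forall x, 0 <= X x) -> (forall x, S x = y -> r <= X x) ->
  P [set x | S x = y] = 0%E.
Proof.
move=> r0 X0 Xr; pose A := [set x | S x = y].
have mA : measurable A.
  rewrite (_ : A = S @^-1` [set y])//; rewrite -[X in measurable X]setTI.
  by apply: mS => //; exact: measurable_set1.
have PA : P A \is a fin_num by exact: fin_num_measure.
pose u := fine (P A); suff u0 : u = 0 by rewrite -(fineK PA) -/u u0.
have u_ge0 : 0 <= u by rewrite fine_ge0.
apply/eqP; rewrite eq_le u_ge0 andbT leNgt; apply/negP => u_gt0.
have M0 : 0 <= \int[leb]_t M t by apply: Rintegral_ge0 => t _; rewrite (le_trans _ (CM t)).
pose B := 2 * \int[leb]_t M t.
have B0 : 0 <= B by rewrite mulr_ge0.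
have key p : 0 < p -> 2 * pi * (r * u) <= B * gmass p 0.
  move=> p0; have p0' : 0 < p^-1 by rewrite invr_gt0.
  have g0 := gmass_gt0 0 p0.
  have gle q z : 0 < q -> gw q 0 z <= 1 :> R.
    move=> q0; rewrite /gw -expR0 ler_expR mul0r addr0 mulNr oppr_le0.
    by rewrite mulr_ge0 ?sqr_ge0// divr_ge0// ltW.
  have h1 := mollified_weight iX mS hCE hSE y p0.
  have h2 : `|density (fun t => gw p^-1 0 t * hC t) (fun t => gw p^-1 0 t * hS t) y| <= B.
    have mg := @measurable_gw R p^-1 0.
    have bnd h t : `|h| <= M t -> `|gw p^-1 0 t * h| <= M t.
      by move=> hh; rewrite normrM (ger0_norm (gw_ge0 _ _ _)) (le_trans _ hh)// ler_piMl// gle.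
    apply: density_bound => //; try exact: measurable_funM; by move=> t; exact: bnd.
  have mXg : intg P (fun x => X x * gw p 0 (S x - y)).
    apply: (@intg_le _ _ _ P _ (fun x => `|X x|)).
    - apply: measurable_funM; first exact: intg_measurable iX.
      by apply: measurableT_comp; [exact: measurable_gw|exact: measurable_funB].
    - by move=> x; rewrite normrM (ger0_norm (gw_ge0 _ _ _)) ler_piMr// gle.
    - exact: intg_norm.
  have h3 : r * u <= \int[P]_x (X x * gw p 0 (S x - y)).
    have -> : r * u = \int[P]_x (r * \1_A x).
      rewrite RintegralZl//; last exact: integrable_indic.
      by rewrite /Rintegral integral_indic// setIT.
    apply: le_Rintegral => //; first by apply: intgZl; exact: integrable_indic.
    move=> x _; rewrite indicE; have [xA|xA] := boolP (x \in A).
      rewrite mulr1; move: xA; rewrite inE /A/= => xy; rewrite xy subrr.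
      by rewrite /gw expr0n/= !(mulr0, addr0) expR0 mulr1 Xr.
    by rewrite mulr0 mulr_ge0 ?gw_ge0.
  have pi0 : 0 <= 2 * pi :> R by rewrite mulr_ge0 ?pi_ge0.
  rewrite (le_trans (ler_wpM2l pi0 h3))// -ler_pdivrMr//.
  rewrite (le_trans _ h2)// -h1 (le_trans _ (ler_norm _))//.
  by rewrite le_eqVlt; apply/orP; left; apply/eqP; ring.
pose a := 2 * pi * (r * u).
have a0 : 0 < a by rewrite !mulr_gt0// pi_gt0.
(* Since the squared mass is 2 pi/p, this choice makes (B [gmass p 0])^2 equal to a^2 B^2/(B^2 + 1),
   which is less than a^2 and contradicts [key]. *)
pose p := 2 * pi * (B ^+ 2 + 1) / a ^+ 2.
have p0 : 0 < p by rewrite divr_gt0 ?exprn_gt0// mulr_gt0 ?mulr_gt0 ?pi_gt0// ltr_wpDl ?sqr_ge0.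
have := key _ p0; rewrite -/a leNgt => /negP; apply.
have g2 : gmass p 0 ^+ 2 = 2 * pi / p.
  rewrite /gmass expr0n/= mul0r expR0 mulr1 sqr_sqrtr//.
  by apply: divr_ge0; [rewrite mulr_ge0 ?pi_ge0|exact: ltW].
have B1 : 0 < B ^+ 2 + 1 by rewrite ltr_wpDl ?sqr_ge0.
have : (B * gmass p 0) ^+ 2 < a ^+ 2.
  rewrite exprMn g2 /p.
  have -> : B ^+ 2 * (2 * pi / (2 * pi * (B ^+ 2 + 1) / a ^+ 2)) = a ^+ 2 * (B ^+ 2 / (B ^+ 2 + 1)).
    have n1 := lt0r_neq0 B1; have n2 := lt0r_neq0 (pi_gt0 R); have n3 := lt0r_neq0 a0.
    by move: (pi : R) n2 => w n2; field; rewrite n1 n2 n3.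
  rewrite gtr_pMr ?exprn_gt0// ltr_pdivrMr// mul1r ltrDl//.
have g0 : 0 <= B * gmass p 0 by rewrite mulr_ge0// ltW// gmass_gt0.
by rewrite ltr_pXn2r// nnegrE// ltW.
Qed.

Hypothesis atoms : forall y, P [set x | S x = y] = 0%E.

Let mdens : measurable_fun setT (density hC hS).
Proof.
apply: (@lipschitz_measurable _ _ (2 * \int[leb]_t (`|t| * M t))) => x y.
exact: density_lipschitz.
Qed.

Let ae_ne (y : R) : {ae P, forall x, S x <> y}.
Proof.
exists [set x | S x = y]; split => //; last by move=> x /= /contrapT.
rewrite (_ : [set x | S x = y] = S @^-1` [set y])//; rewrite -[X in measurable X]setTI.
by apply: mS => //; exact: measurable_set1.
Qed.

(** The factor e^{-eta y} will undo the tilt. On the window it differs from 1 by O(|y|) and the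
    density is Lipschitz, so replacing both by their values at 0 costs O(b - a) pointwise and O((b -
    a)^2) after integration. Symmetric windows serve the conditional expectation, one-sided ones the
    positivity of the tail. *)
Lemma local_inversion (eta : R) : exists2 C, 0 <= C & forall a b, -1 <= a -> a <= 0 -> 0 <= b -> b <= 1 ->
  `|2 * pi * \int[P]_x (X x * ((fun y => expR (- (eta * y))) \_ `[a, b]) (S x))
    - (b - a) * density hC hS 0| <= C * (b - a) ^+ 2.
Proof.
pose E y := expR (- (eta * y)).
have dE y : der E y (- eta * E y) by eapply der_eq; [rewrite /E; der|rewrite /E/=; ring].
have cE : continuous E by exact: der_continuous dE.
have mE : measurable_fun setT E by exact: continuous_measurable_fun.
have Ele y : `|y| <= 1 -> `|E y| <= expR `|eta|.
  move=> y1; rewrite ger0_norm ?expR_ge0// ler_expR (le_trans (ler_norm _))//.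
  by rewrite normrN normrM ler_piMr.
pose D := density hC hS.
have D_b y : `|D y| <= 2 * \int[leb]_t M t by exact: density_bound.
have D_l y : `|D y - D 0| <= `|y| * (2 * \int[leb]_t (`|t| * M t)).
  by rewrite -[X in _ <= `|X| * _]subr0; exact: density_lipschitz.
pose C := `|eta| * expR `|eta| * (2 * \int[leb]_t M t) + 2 * \int[leb]_t (`|t| * M t).
have C0 : 0 <= C.
  rewrite addr_ge0// !mulr_ge0 ?expR_ge0//.
    by apply: Rintegral_ge0 => t _; rewrite (le_trans _ (CM t)).
  by apply: Rintegral_ge0 => t _; rewrite mulr_ge0// (le_trans _ (CM t)).
exists C => // a b a1 a0 b0 b1.
have ab : a <= b by rewrite (le_trans a0).
have itvP y : y \in `[a, b]%classic -> `|y| <= 1 /\ `|y| <= b - a.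
  rewrite inE/= in_itv/= => /andP[ay yb].
  by split; rewrite ler_norml; apply/andP; split; lra.
have mA : measurable `[a, b]%classic by exact: measurable_itv.
have i1 : intg leb (fun y => \1_`[a, b] y : R) by exact: integrable_indic_itv.
have b1A : \int[leb]_y \1_`[a, b] y = b - a.
  rewrite /Rintegral integral_indic//= setIT lebesgue_measure_itv/= lte_fin.
  by case: ltP => [_|ba] /=; [|have -> : a = b by apply/eqP; rewrite eq_le ab]; rewrite ?subrr.
rewrite (@fourier_inversion _ _ _ P X S hC hS M iX mS hCE hSE mC mSn CM SM iM iM1 (E \_ `[a, b]) (expR `|eta|)).
- have -> : (b - a) * density hC hS 0 = \int[leb]_y (D 0 * \1_`[a, b] y).
    by rewrite RintegralZl// b1A mulrC.
  have iED : intg leb (fun y => (E \_ `[a, b]) y * D y).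
    apply: (@intg_le _ _ _ leb _ (fun y => (expR `|eta| * (2 * \int[leb]_t M t)) * \1_`[a, b] y)).
    - by apply: measurable_funM => //; apply/measurable_restrict => //; exact: measurable_funS mE.
    - move=> y; rewrite patchE indicE; case: ifPn => [ya|_]; last by rewrite mul0r mulr0 normr0.
      rewrite mulr1 normrM ler_pM//; apply: Ele; exact: (itvP _ ya).1.
    - exact: intgZl.
  have iD0 : intg leb (fun y => D 0 * \1_`[a, b] y) by exact: intgZl.
  rewrite -RintegralB//.
  have -> : C * (b - a) ^+ 2 = \int[leb]_y (C * (b - a) * \1_`[a, b] y).
    by rewrite RintegralZl// b1A; ring.
  apply: Rint_norm_le; [exact: intg_measurable (intgB iED iD0)| |exact: intgZl].
  move=> y; rewrite patchE indicE; case: ifPn => [ya|_]; last by rewrite mul0r !mulr0 subrr normr0.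
  have [y1 yab] := itvP _ ya; rewrite !mulr1.
  have -> : E y * D y - D 0 = (E y - 1) * D y + (D y - D 0) by ring.
  have eb : `|E y - 1| <= `|y| * (`|eta| * expR `|eta|).
    have u1 := expR_ge1Dx (- (eta * y)); have u2 := expR_ge1Dx (eta * y).
    have EV : E y * expR (eta * y) = 1 by rewrite /E -expRD addNr expR0.
    have E0 : 0 <= E y by exact: expR_ge0.
    have u3 : E y * (1 + eta * y) <= 1 by have := ler_wpM2l E0 u2; rewrite EV.
    have e1 : 1 <= expR `|eta| :> R by rewrite -expR0 ler_expR.
    have Ey := Ele _ y1; rewrite (ger0_norm E0) in Ey.
    have ny : `|eta * y| = `|eta| * `|y| by rewrite normrM.
    have n0 : 0 <= `|eta| * `|y| by rewrite mulr_ge0.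
    have h1 : `|eta| * `|y| * 1 <= `|eta| * `|y| * expR `|eta| by rewrite ler_wpM2l.
    have h2 : - (eta * y) * E y <= `|eta| * `|y| * expR `|eta|.
      rewrite (le_trans (ler_norm _))// normrM normrN ny (ger0_norm E0) ler_wpM2l//.
    have h3 : - (eta * y) >= - (`|eta| * `|y|) by rewrite lerN2 -ny ler_norm.
    rewrite ler_norml; apply/andP; split; rewrite -/(E y) in u1; lra.
  rewrite (le_trans (ler_normD _ _))// normrM.
  have M0 : 0 <= 2 * \int[leb]_t M t by rewrite (le_trans _ (D_b 0)).
  apply: (@le_trans _ _ (`|y| * C)); last by rewrite mulrC ler_wpM2l.
  rewrite /C mulrDr lerD//.
  by rewrite [leRHS]mulrA ler_pM.
- by apply/measurable_restrict => //; exact: measurable_funS mE.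
- move=> y; rewrite patchE; case: ifPn => [ya|_]; last by rewrite normr0 expR_ge0.
  by apply: Ele; exact: (itvP _ ya).1.
- apply: (@intg_le _ _ _ leb _ (fun y => expR `|eta| * \1_`[a, b] y)); last exact: intgZl.
  + by apply/measurable_restrict => //; exact: measurable_funS mE.
  + move=> y; rewrite patchE indicE; case: ifPn => [ya|_]; last by rewrite mulr0 normr0.
    by rewrite mulr1; apply: Ele; exact: (itvP _ ya).1.
(* The test function jumps only at the two ends of the window, which S almost surely avoids. *)
- apply: filterS2 (ae_ne a) (ae_ne b) => x xa xb k k0.
  apply: (@continuous_quadratic_modulus _ (expR `|eta|)) => //.
    move=> y; rewrite patchE; case: ifPn => [ya|_]; last by rewrite normr0 expR_ge0.
    by apply: Ele; exact: (itvP _ ya).1.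
  apply: continuous_patch => //.
  have [xa'|xa'|] := ltgtP (S x) a; last by [].
    right; apply: filterS (cvgr_lt (S x) (@cvg_id _ (nbhs (S x))) _ xa') => y ya /=.
    by rewrite in_itv/= leNgt ya.
  have [xb'|xb'|] := ltgtP (S x) b; last by [].
    left; apply: filterS2 (cvgr_gt (S x) (@cvg_id _ (nbhs (S x))) _ xa') (cvgr_lt (S x) (@cvg_id _ (nbhs (S x))) _ xb') => y ya yb /=.
    by rewrite in_itv/= !ltW.
  right; apply: filterS (cvgr_gt (S x) (@cvg_id _ (nbhs (S x))) _ xb') => y yb /=.
  by rewrite in_itv/= (leNgt y b) yb andbF.
Qed.

(** From 1 + u^2/2 <= e^u one gets e^{-u} <= 2/(1 + u^2), an integrable envelope already at hand. *)
Lemma intg_exp_half (r : R) : 0 < r -> intg leb ((fun y => expR (- (r * y))) \_ `[0, +oo[).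
Proof.
move=> r0; apply: (@intg_le _ _ _ leb _ (fun y => 2 * (1 + (r * y) ^+ 2)^-1)).
- apply/measurable_restrict => //; apply: measurable_funTS.
  apply: measurableT_comp => //; apply: measurableT_comp => //; exact: measurable_funM.
- move=> y; rewrite patchE; case: ifPn => [|_]; last first.
    by rewrite normr0 mulr_ge0// invr_ge0 addr_ge0// sqr_ge0.
  rewrite inE/= in_itv/= andbT => y0; rewrite ger0_norm ?expR_ge0//.
  have u0 : 0 <= r * y by rewrite mulr_ge0// ltW.
  have h := expR_ge1Dxn 1 u0.
  have d0 : 0 < 1 + (r * y) ^+ 2 by rewrite ltr_pwDl// sqr_ge0.
  rewrite expRN ler_pdivlMr// mulrC ler_pdivrMr ?expR_gt0//.
  by move: h; rewrite (_ : (2`!)%:R = 2 :> R)//; lra.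
- by apply: intgZl; exact: (integral_cauchy r0).1.
Qed.

Let exp_cvg0 (r C : R) (h : R -> R) : 0 < r -> 0 <= C ->
  (forall y, `|h y| <= C * expR (- (r * y))) -> h n%:R @[n --> \oo] --> (0 : R).
Proof.
move=> r0 C0 hh.
have kh : C * (1 + r^-1) * harmonic n @[n --> \oo] --> (0 : R).
  by rewrite -[X in _ --> X](mulr0 (C * (1 + r^-1))); apply: cvgMr; exact: cvg_harmonic.
apply: norm_cvg0; apply: squeeze_cvgr (cvg_cst _) kh; apply: nearW => n.
rewrite normr_ge0/= (le_trans (hh _))// -mulrA ler_wpM2l//.
have u0 : 0 <= r * n%:R by rewrite mulr_ge0// ltW.
rewrite /harmonic /= expRN ler_pdivlMr ?ltr0n// mulrC ler_pdivrMr ?expR_gt0//.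
apply: (@le_trans _ _ ((1 + r^-1) * (1 + r * n%:R))); last first.
  by rewrite ler_wpM2l ?expR_ge1Dx// addr_ge0// invr_ge0 ltW.
have -> : (1 + r^-1) * (1 + r * n%:R) = 1 + n%:R + (r^-1 + r * n%:R).
  by field; exact: lt0r_neq0.
by rewrite -natr1 addrC lerDl addr_ge0// invr_ge0 ltW.
Qed.

(** Real and imaginary parts of 1/(r - i t), from explicit primitives that vanish at infinity. *)
Lemma exp_half_transform (r t : R) : 0 < r ->
  \int[leb]_y (((fun y => expR (- (r * y))) \_ `[0, +oo[) y * cos (t * y)) = r / (r ^+ 2 + t ^+ 2) /\
  \int[leb]_y (((fun y => expR (- (r * y))) \_ `[0, +oo[) y * sin (t * y)) = t / (r ^+ 2 + t ^+ 2).
Proof.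
move=> r0; pose E y := expR (- (r * y)).
have D0 : 0 < r ^+ 2 + t ^+ 2 by rewrite ltr_pwDl ?exprn_gt0// sqr_ge0.
have D1 := lt0r_neq0 D0.
pose A := `[(0:R), +oo[%classic.
have patchM (g : R -> R) : (fun y => (E \_ A) y * g y) = (fun y => E y * g y) \_ A.
  by apply/funext => y; rewrite !patchE; case: ifP => // _; rewrite mul0r.
have iE (g : R -> R) : measurable_fun setT g -> (forall y, `|g y| <= 1) ->
    intg leb ((fun y => E y * g y) \_ A).
  move=> mg g1; rewrite -patchM; have iEA := intg_exp_half r0.
  apply: (@intg_le _ _ _ leb _ (fun y => `|(E \_ A) y|)).
  - by apply: measurable_funM => //; exact: intg_measurable iEA.
  - by move=> y; rewrite normrM ler_piMr.
  - exact: intg_norm.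
have trig (u v s c : R) : `|s| <= 1 -> `|c| <= 1 -> `|u * s + v * c| <= `|u| + `|v|.
  move=> s1 c1; rewrite (le_trans (ler_normD _ _))// !normrM lerD// ler_piMr//.
have s1 y : `|sin (t * y)| <= 1 by rewrite ler_norml sin_geN1 sin_le1.
have c1 y : `|cos (t * y)| <= 1 by rewrite ler_norml cos_geN1 cos_le1.
have mt : measurable_fun setT (fun y : R => t * y) by exact: measurable_funM.
have cvg (u v : R) : (fun y => E y * (u * sin (t * y) + v * cos (t * y)) / (r ^+ 2 + t ^+ 2)) n%:R
    @[n --> \oo] --> (0 : R).
  apply: (@exp_cvg0 r ((`|u| + `|v|) / (r ^+ 2 + t ^+ 2))
    (fun y => E y * (u * sin (t * y) + v * cos (t * y)) / (r ^+ 2 + t ^+ 2))) => //.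
    by apply: divr_ge0; [exact: addr_ge0|exact: ltW].
  move=> y; rewrite normrM (gtr0_norm (_ : 0 < (r ^+ 2 + t ^+ 2)^-1)) ?invr_gt0//.
  rewrite normrM (ger0_norm (expR_ge0 _)).
  have h := ler_wpM2l (expR_ge0 (- (r * y))) (trig u v _ _ (s1 y) (c1 y)).
  have h' : 0 <= (r ^+ 2 + t ^+ 2)^-1 by rewrite invr_ge0 ltW.
  rewrite (le_trans (ler_wpM2r h' h))// le_eqVlt; apply/orP; left; apply/eqP; ring.
split; rewrite patchM.
- pose h y := E y * (t * sin (t * y) + (- r) * cos (t * y)) / (r ^+ 2 + t ^+ 2).
  have -> : r / (r ^+ 2 + t ^+ 2) = - h 0.
    by rewrite /h /E !mulr0 oppr0 expR0 sin0 cos0; ring.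
  apply: ftc_half => //.
  + move=> y; rewrite /h /E; eapply der_eq; [der|rewrite /=; field].
    by rewrite D1.
  + apply: der_continuous_ex => y; rewrite /E; eexists; der.
  + apply: iE => //; apply: measurableT_comp => //.
    by apply: continuous_measurable_fun; exact: continuous_cos.
  + exact: (cvg t (- r)).
- pose h y := E y * ((- r) * sin (t * y) + (- t) * cos (t * y)) / (r ^+ 2 + t ^+ 2).
  have -> : t / (r ^+ 2 + t ^+ 2) = - h 0.
    by rewrite /h /E !mulr0 oppr0 expR0 sin0 cos0; ring.
  apply: ftc_half => //.
  + move=> y; rewrite /h /E; eapply der_eq; [der|rewrite /=; field].
    by rewrite D1.
  + apply: der_continuous_ex => y; rewrite /E; eexists; der.
  + apply: iE => //; apply: measurableT_comp => //.
    by apply: continuous_measurable_fun; exact: continuous_sin.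
  + exact: (cvg (- r) (- t)).
Qed.

(** Inversion against e^{-r y} on y >= 0, followed by an exchange of integrals: integrating in y
    first divides the transform by r + i t, and the real part of the quotient is the integrand on
    the right. *)
Lemma halfline_inversion (r : R) : 0 < r ->
  2 * pi * \int[P]_x (X x * ((fun y => expR (- (r * y))) \_ `[0, +oo[) (S x)) =
  \int[leb]_t ((r * hC t + t * hS t) / (r ^+ 2 + t ^+ 2)).
Proof.
move=> r0; pose E y := expR (- (r * y)); pose A := `[(0:R), +oo[%classic.
have dE y : der E y (- r * E y) by eapply der_eq; [rewrite /E; der|rewrite /E/=; ring].
have cE : continuous E by exact: der_continuous dE.
have iE : intg leb (E \_ A) by exact: intg_exp_half.
have mE : measurable_fun setT (E \_ A) by exact: intg_measurable iE.
have E1 y : `|(E \_ A) y| <= 1.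
  rewrite patchE; case: ifPn => [|_]; last by rewrite normr0.
  rewrite inE /A /= in_itv/= andbT => y0; rewrite ger0_norm ?expR_ge0//.
  by rewrite expR_le1 oppr_le0 mulr_ge0// ltW.
rewrite (@fourier_inversion _ _ _ P X S hC hS M iX mS hCE hSE mC mSn CM SM iM iM1 (E \_ A) 1)//; last first.
  apply: filterS (ae_ne 0) => x x0 k k0; apply: (continuous_quadratic_modulus E1) => //.
  apply: continuous_patch => //.
  have [xa|xa|] := ltgtP (S x) 0; last by [].
    right; apply: filterS (cvgr_lt (S x) (@cvg_id _ (nbhs (S x))) _ xa) => y ya /=.
    by rewrite /A /= in_itv/= leNgt ya.
  left; apply: filterS (cvgr_gt (S x) (@cvg_id _ (nbhs (S x))) _ xa) => y ya /=.
  by rewrite /A /= in_itv/= andbT ltW.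
have mcos : measurable_fun setT (@cos R) by apply: continuous_measurable_fun; exact: continuous_cos.
have msin : measurable_fun setT (@sin R) by apply: continuous_measurable_fun; exact: continuous_sin.
pose F (z : measurableTypeR R * measurableTypeR R) : R :=
  (E \_ A) z.1 * (cos (z.2 * z.1) * hC z.2 + sin (z.2 * z.1) * hS z.2).
have mF : measurable_fun setT F.
  have m21 : measurable_fun setT (fun z : measurableTypeR R * measurableTypeR R => z.2 * z.1 : R).
    by apply: measurable_funM; [exact: measurable_snd|exact: measurable_fst].
  apply: measurable_funM; first exact: (measurableT_comp mE measurable_fst).
  apply: measurable_funD; apply: measurable_funM.
  - exact: (measurableT_comp mcos m21).
  - exact: (measurableT_comp mC measurable_snd).
  - exact: (measurableT_comp msin m21).
  - exact: (measurableT_comp mSn measurable_snd).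
have Fle y t : `|F (y, t)| <= `|(E \_ A) y| * (2 * M t).
  by rewrite /F/= normrM ler_wpM2l//; exact: cos_sin_norm_le.
have [e _ _ _] := @Rint_fubini R _ _ _ _ leb leb F _ _ mF (intg_norm iE) (intgZl 2 iM) Fle.
transitivity (\int[leb]_y \int[leb]_t F (y, t)).
  apply: eq_Rintegral => y _; rewrite /density -RintegralZl//.
  apply: (@intg_le _ _ _ leb _ (fun t => 2 * M t)); last exact: intgZl.
    apply: measurable_funD; apply: measurable_funM => //.
    - by apply: (measurableT_comp mcos); exact: measurable_funM.
    - by apply: (measurableT_comp msin); exact: measurable_funM.
  by move=> t; exact: cos_sin_norm_le.
rewrite e; apply: eq_Rintegral => t _.
have [tc ts] := exp_half_transform t r0.
have ic (g : R -> R) : measurable_fun setT g -> (forall y, `|g y| <= 1) ->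
    intg leb (fun y => (E \_ A) y * g y).
  move=> mg g1; apply: (@intg_le _ _ _ leb _ (fun y => `|(E \_ A) y|)).
  - exact: measurable_funM.
  - by move=> y; rewrite normrM ler_piMr.
  - exact: intg_norm.
have i1 : intg leb (fun y => (E \_ A) y * cos (t * y)).
  apply: ic; first by apply: (measurableT_comp mcos); exact: measurable_funM.
  by move=> y; rewrite ler_norml cos_geN1 cos_le1.
have i2 : intg leb (fun y => (E \_ A) y * sin (t * y)).
  apply: ic; first by apply: (measurableT_comp msin); exact: measurable_funM.
  by move=> y; rewrite ler_norml sin_geN1 sin_le1.
transitivity (\int[leb]_y (hC t * ((E \_ A) y * cos (t * y)) + hS t * ((E \_ A) y * sin (t * y)))).
  by apply: eq_Rintegral => y _; rewrite /F/=; ring.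
rewrite RintegralD//; [|exact: intgZl|exact: intgZl].
by rewrite !RintegralZl// tc ts; ring.
Qed.

End inversion_applications.

(** * Conditional expectations of the sample means *)

Section saddlepoint_laplace.
Context {R : realType}.
Notation leb := (@lebesgue_measure R).
Variables (m : nat) (c v eta : R) (lam d w : 'I_m -> R).
Hypothesis q0 : forall k, 0 < tq eta (lam k).
Hypothesis saddle : \sum_(k < m) ((lam k * (1 - 2 * lam k * eta) + d k ^+ 2 * (1 - lam k * eta) * eta)
                / (1 - 2 * lam k * eta) ^+ 2) = v - c.
Hypothesis K2 : 0 < KYn 2 c lam d eta.

Notation A := (totA eta lam d).
Notation B := (totB c v eta lam d).

(** Bounds the real and the imaginary part of (rho + i sigma) e^{s^2 (A + i B)} alike, so one
    integrability statement covers both halves of a transform. *)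
Definition majorant (rho sigma : R -> R) (s t : R) : R :=
  expR (s ^+ 2 * A t) * (`|rho t| + `|sigma t|).

Definition sp_limit (rho0 rho2 sigma1 : R) (n : nat) : R :=
  laplace_limit (KYn 2 c lam d eta) (KYn 3 c lam d eta) (KYn 4 c lam d eta) rho0 rho2 sigma1 n.

Lemma sp_laplace (rho sigma : R -> R) (rho0 rho2 sigma1 : R) :
  measurable_fun setT rho -> measurable_fun setT sigma ->
  (exists2 C, 0 <= C & forall t, `|rho t - rho0 - rho2 * t ^+ 2| <= C * `|t| ^+ 4) ->
  (exists2 C, 0 <= C & forall t, `|sigma t - sigma1 * t| <= C * `|t| ^+ 3) ->
  exists2 K : R, 0 <= K & exists n0 : nat, forall n : nat, (n0 <= n)%N ->
  [/\ intg leb (laplace_main A B rho sigma (Num.sqrt n%:R)),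
      `|\int[leb]_t laplace_main A B rho sigma (Num.sqrt n%:R) t - sp_limit rho0 rho2 sigma1 n|
        <= K / (n%:R ^+ 2 * Num.sqrt n%:R),
      intg leb (majorant rho sigma (Num.sqrt n%:R)) &
      intg leb (fun t => `|t| * majorant rho sigma (Num.sqrt n%:R) t)].
Proof.
move=> mr ms [Cr Cr0 hr] [Cs Cs0 hs].
have [CA CA0 hA] := @totA_taylor R m c eta lam d q0.
have [CB CB0 hB] := @totB_taylor R m c v eta lam d q0 saddle.
have [a a0 [b b0 dec]] := @totA_decay R m c eta lam d q0 K2.
have mA := @measurable_totA R m eta lam d q0.
have mB := @measurable_totB R m c v eta lam d q0.
(* [laplace] expects a single constant for its four Taylor bounds. *)
pose C := CA + CB + Cr + Cs.
have C0 : 0 <= C by rewrite /C; lra.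
have up (C' : R) k (t : R) : C' <= C -> C' * `|t| ^+ k <= C * `|t| ^+ k.
  by move=> CC; rewrite ler_wpM2r// exprn_ge0.
have hA' t := le_trans (hA t) (up CA 6%N t ltac:(rewrite /C; lra)).
have hB' t := le_trans (hB t) (up CB 5%N t ltac:(rewrite /C; lra)).
have hr' t := le_trans (hr t) (up Cr 4%N t ltac:(rewrite /C; lra)).
have hs' t := le_trans (hs t) (up Cs 3%N t ltac:(rewrite /C; lra)).
have [K K0 [n1 H1]] := @laplace R A B rho sigma _ _ _ _ _ _ C a b a0 b0 K2 C0 mA mB mr ms dec hA' hB' hr' hs'.
have mono (k : R) i : bigO 0 (fun _ t => k * t ^+ i).
  by apply: bigOM (bigO_cst k) (bigO_id i) _.
have Or : bigO 0 (fun _ t => rho t).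
  apply: (@bigO_ext _ _ _ (fun s t => (rho t - rho0 - rho2 * t ^+ 2) + (rho0 + rho2 * t ^+ 2))) => [s t|]; first by ring.
  apply: bigOD; first by apply: (bigO_weak _ (bigO_pow Cr0 hr)).
  by apply: bigOD; [exact: bigO_cst|exact: mono].
have Os : bigO 0 (fun _ t => sigma t).
  apply: (@bigO_ext _ _ _ (fun s t => (sigma t - sigma1 * t) + sigma1 * t ^+ 1)) => [s t|]; first by ring.
  by apply: bigOD; [apply: (bigO_weak _ (bigO_pow Cs0 hs))|exact: mono].
have Om : bigO 0 (fun _ t => `|rho t| + `|sigma t|).
  by apply: bigOD; exact: bigO_norm.
have Om1 : bigO 0 (fun _ t => `|t| * (`|rho t| + `|sigma t|)).
  apply: bigOM Om _ => //; apply: bigO_norm.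
  by apply: bigO_ext (mono 1 1%N) => s t; ring.
have [n2 H2] := intg_bigO a0 b0 K2 mA dec Om.
have [n3 H3] := intg_bigO a0 b0 K2 mA dec Om1.
exists K => //; exists (n1 + n2 + n3)%N => n hn.
have mm : measurable_fun setT (fun t => `|rho t| + `|sigma t|).
  by apply: measurable_funD; exact: measurableT_comp.
have [| i e] := H1 n; first by apply: leq_trans hn; rewrite -addnA leq_addr.
split => //.
- by apply: H2 => //; apply: leq_trans hn; rewrite addnAC leq_addl.
- apply: (@eq_intg _ _ _ leb _ _ _ (H3 n _ _)).
  + by move=> t; rewrite /majorant; ring.
  + by apply: leq_trans hn; rewrite leq_addl.
  + by apply: measurable_funM => //; exact: measurableT_comp.
Qed.

Lemma laplace_main_le (rho sigma : R -> R) s t :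
  `|laplace_main A B rho sigma s t| <= majorant rho sigma s t.
Proof.
rewrite /laplace_main /majorant normrM ger0_norm ?expR_ge0// ler_wpM2l ?expR_ge0//.
rewrite (le_trans (ler_normB _ _))// !normrM lerD// ler_piMr// ler_norml.
  by rewrite cos_geN1 cos_le1.
by rewrite sin_geN1 sin_le1.
Qed.

Lemma measurable_laplace_main (rho sigma : R -> R) s :
  measurable_fun setT rho -> measurable_fun setT sigma ->
  measurable_fun setT (laplace_main A B rho sigma s).
Proof.
move=> mr ms; have mA := @measurable_totA R m eta lam d q0.
have mB := @measurable_totB R m c v eta lam d q0.
have mcos : measurable_fun setT (fun t => cos (s ^+ 2 * B t)).
  apply: measurableT_comp; last exact: measurable_funM.
  by apply: continuous_measurable_fun; exact: continuous_cos.
have msin : measurable_fun setT (fun t => sin (s ^+ 2 * B t)).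
  apply: measurableT_comp; last exact: measurable_funM.
  by apply: continuous_measurable_fun; exact: continuous_sin.
apply: measurable_funM; first by apply: measurableT_comp => //; exact: measurable_funM.
by apply: measurable_funB; exact: measurable_funM.
Qed.

End saddlepoint_laplace.

(** * Transforms of the sample sums *)

Section sample.
Context {R : realType} {dT : measure_display} {T : measurableType dT}.
Notation leb := (@lebesgue_measure R).
Variables (P : probability T R) (m : nat) (Z : nat -> 'I_m -> {RV P >-> R}).
Variables (c w0 v eta : R) (lam d w : 'I_m -> R).
Hypothesis indepZ : mutually_independent (fun jk : nat * 'I_m => Z jk.1 jk.2).
Hypothesis normalZ : forall j k, std_normal_rv (Z j k).
Hypothesis q0 : forall k, 0 < tq eta (lam k).

(** The double family of normals is flattened into one duplicate-free list, so that the induction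
    over coordinates also covers the sample. *)
Definition sample_idx (n : nat) : seq (nat * 'I_m) :=
  [seq (j, k) | j <- iota 0 n, k <- index_enum 'I_m].

Lemma uniq_sample_idx n : uniq (sample_idx n).
Proof.
apply: allpairs_uniq; [exact: iota_uniq|exact: index_enum_uniq|].
by move=> [? ?] [? ?].
Qed.

Lemma sum_sample_idx n (F : nat * 'I_m -> R) :
  \sum_(i <- sample_idx n) F i = \sum_(j < n) \sum_(k < m) F (j : nat, k).
Proof.
by rewrite big_allpairs (_ : iota 0 n = index_iota 0 n) ?big_mkord// /index_iota subn0.
Qed.

Lemma sum_sample_idx2 n (f : 'I_m -> R) :
  \sum_(i <- sample_idx n) f i.2 = n%:R * \sum_(k < m) f k.
Proof. by rewrite sum_sample_idx/= sumr_const card_ord mulr_natl. Qed.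

Definition sampleX (i : nat * 'I_m) : {RV P >-> R} := Z i.1 i.2.
Definition sampleQ n : T -> R :=
  qsum sampleX (fun i => lam i.2) (fun i => d i.2) (sample_idx n).
Definition sampleW n : T -> R := wsum sampleX (fun i => w i.2) (sample_idx n).
Definition sampleS n (x : T) : R := sampleQ n x - n%:R * (v - c).
Definition sampleM n : R := sM eta (fun i => lam i.2) (fun i => d i.2) (sample_idx n).

Lemma smean_Ycopy n x : (0 < n)%N -> smean (Ycopy Z c lam d) n x = v + sampleS n x / n%:R.
Proof.
move=> n0; have n1 : n%:R != 0 :> R by rewrite pnatr_eq0 -lt0n.
rewrite /smean /Ycopy /sampleS /sampleQ /qsum sum_sample_idx/= big_split/= sumr_const card_ord.
by rewrite /sampleX/= -[c *+ n]mulr_natl; field.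
Qed.

Lemma smean_Wcopy n x : (0 < n)%N -> smean (Wcopy Z w0 w) n x = w0 + sampleW n x / n%:R.
Proof.
move=> n0; have n1 : n%:R != 0 :> R by rewrite pnatr_eq0 -lt0n.
rewrite /smean /Wcopy /sampleW /wsum sum_sample_idx/= big_split/= sumr_const card_ord.
by rewrite /sampleX/= -[w0 *+ n]mulr_natl; field.
Qed.

Lemma measurable_sampleS n : measurable_fun setT (sampleS n).
Proof.
apply: measurable_funB => //; apply: measurable_sum => i.
apply: measurable_funD; apply: measurable_funM => //.
by apply: measurable_funX.
Qed.

(** The case eta = 0, t = 0 of [sum_transform], in which the cosine and the tilt are both 1. *)
Lemma intg_sampleW n : intg P (sampleW n) /\ \int[P]_x sampleW n x = 0.
Proof.
have h0 : forall i : nat * 'I_m, 0 < tq 0 (lam i.2) by move=> i; rewrite /tq mulr0 subr0.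
have [[_ _ i3 _] [_ _ e3 _]] := @sum_transform R dT T P _ sampleX 0 (fun i => lam i.2)
  (fun i => d i.2) (fun i => w i.2) indepZ (fun i => normalZ i.1 i.2) h0 (sample_idx n) 0 (uniq_sample_idx n).
have E x : sampleW n x * (expR (0 * qsum sampleX (fun i => lam i.2) (fun i => d i.2) (sample_idx n) x)
   * cos (0 * qsum sampleX (fun i => lam i.2) (fun i => d i.2) (sample_idx n) x)) = sampleW n x.
  by rewrite !mul0r expR0 cos0 !mulr1.
split; first by apply: eq_intg i3 => x; exact: E.
transitivity (\int[P]_x (wsum sampleX (fun i => w i.2) (sample_idx n) x * (expR (0 * qsum sampleX (fun i => lam i.2) (fun i => d i.2) (sample_idx n) x)
   * cos (0 * qsum sampleX (fun i => lam i.2) (fun i => d i.2) (sample_idx n) x)))).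
  by apply: eq_Rintegral => x _; rewrite [RHS]E.
rewrite e3 /sre /sim !big1 ?mul0r ?subr0 ?mulr0// => i _.
  by rewrite /tim !mul0r mulr0.
by rewrite /tre expr0n/= !mulr0 !mul0r subr0 mul0r mulr0.
Qed.

Notation A := (totA eta lam d).
Notation B := (totB c v eta lam d).

Definition tilt n (x : T) : R := expR (eta * sampleQ n x).

Let sAE n t : sA eta (fun i : nat * 'I_m => lam i.2) (fun i => d i.2) (sample_idx n) t = n%:R * A t.
Proof. exact: (sum_sample_idx2 n (fun k => tA eta (lam k) (d k) t)). Qed.
Let sBE n t : sB eta (fun i : nat * 'I_m => lam i.2) (fun i => d i.2) (sample_idx n) t
  = n%:R * B t + t * (n%:R * (v - c)).
Proof.
rewrite /totB /sB (sum_sample_idx2 n (fun k => tB eta (lam k) (d k) t)); ring.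
Qed.
Let sreE n t : sre eta (fun i : nat * 'I_m => lam i.2) (fun i => d i.2) (fun i => w i.2) (sample_idx n) t
  = n%:R * totre eta lam d w t.
Proof. exact: (sum_sample_idx2 n (fun k => w k * tre eta (lam k) (d k) t)). Qed.
Let simE n t : sim eta (fun i : nat * 'I_m => lam i.2) (fun i => d i.2) (fun i => w i.2) (sample_idx n) t
  = n%:R * totim eta lam d w t.
Proof. exact: (sum_sample_idx2 n (fun k => w k * tim eta (lam k) (d k) t)). Qed.

(* E[X e^{itS}] = K (rho + i sigma)(t) e^{s^2 (A + i B)(t)}, split into real and imaginary parts. *)
Definition has_transform (X S : T -> R) (K : R) (rho sigma : R -> R) (s : R) : Prop :=
  [/\ intg P X,
   forall t, \int[P]_x (X x * cos (t * S x)) = K * laplace_main A B rho sigma s t &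
   forall t, \int[P]_x (X x * sin (t * S x)) = K * laplace_main A B sigma (fun t => - rho t) s t].

Lemma sample_transform n :
  has_transform (tilt n) (sampleS n) (sampleM n) (cst 1) (cst 0) (Num.sqrt n%:R) /\
  has_transform (fun x => sampleW n x * tilt n x) (sampleS n) (n%:R * sampleM n)
    (totre eta lam d w) (totim eta lam d w) (Num.sqrt n%:R).
Proof.
have s2 : Num.sqrt n%:R ^+ 2 = n%:R :> R by rewrite sqr_sqrtr.
have trs t := @sum_transform R dT T P _ sampleX eta (fun i => lam i.2)
  (fun i => d i.2) (fun i => w i.2) indepZ (fun i => normalZ i.1 i.2) (fun i => q0 i.2)
  (sample_idx n) t (uniq_sample_idx n).
have cosS t x : cos (t * sampleS n x) = cos (t * (n%:R * (v - c))) * cos (t * sampleQ n x)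
    + sin (t * (n%:R * (v - c))) * sin (t * sampleQ n x).
  by rewrite /sampleS mulrBr cosB; ring.
have sinS t x : sin (t * sampleS n x) = cos (t * (n%:R * (v - c))) * sin (t * sampleQ n x)
    + (- sin (t * (n%:R * (v - c)))) * cos (t * sampleQ n x).
  by rewrite /sampleS mulrBr sinB; ring.
have cosE t : cos (n%:R * B t + t * (n%:R * (v - c))) = cos (n%:R * B t) * cos (t * (n%:R * (v - c)))
  - sin (n%:R * B t) * sin (t * (n%:R * (v - c))) by rewrite cosD.
have sinE t : sin (n%:R * B t + t * (n%:R * (v - c))) = sin (n%:R * B t) * cos (t * (n%:R * (v - c)))
  + cos (n%:R * B t) * sin (t * (n%:R * (v - c))) by rewrite sinD.
(* Undoing the rotation by the deterministic phase t n (v - c) produces cos^2 + sin^2; the factor is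
   inserted on the right so that [ring] can match the two sides. *)
have cs t (a : R) : a = a * (cos (t * (n%:R * (v - c))) ^+ 2 + sin (t * (n%:R * (v - c))) ^+ 2).
  by rewrite cos2Dsin2 mulr1.
have split3 (X : T -> R) (u u' : R) (F G : T -> R) : intg P (fun x => X x * F x) -> intg P (fun x => X x * G x) ->
    \int[P]_x (X x * (u * F x + u' * G x)) = u * \int[P]_x (X x * F x) + u' * \int[P]_x (X x * G x).
  move=> i1 i2; rewrite -!RintegralZl// -RintegralD//; [|exact: intgZl|exact: intgZl].
  by apply: eq_Rintegral => x _; ring.
have assoc (F : T -> R) : (fun x => sampleW n x * (tilt n x * F x)) = (fun x => sampleW n x * tilt n x * F x).
  by apply/funext => x; ring.
split; split.
- have [[i _ _ _] _] := trs 0; apply: eq_intg i => x.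
  by rewrite mul0r cos0 mulr1.
- move=> t; have [[i1 i2 _ _] [e1 e2 _ _]] := trs t.
  under eq_Rintegral do rewrite cosS.
  rewrite split3// [X in _ * X + _]e1 [X in _ + _ * X]e2 sAE sBE /laplace_main s2 cosE sinE /cst/=.
  rewrite [RHS](cs t) /sampleM; ring.
- move=> t; have [[i1 i2 _ _] [e1 e2 _ _]] := trs t.
  under eq_Rintegral do rewrite sinS.
  rewrite split3// [X in _ * X + _]e2 [X in _ + _ * X]e1 sAE sBE /laplace_main s2 cosE sinE /cst/=.
  rewrite [RHS](cs t) /sampleM; ring.
- have [[_ _ i _] _] := trs 0; apply: eq_intg i => x.
  by rewrite mul0r cos0 mulr1.
- move=> t; have [[_ _ i1 i2] [_ _ e1 e2]] := trs t.
  under eq_Rintegral do rewrite cosS.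
  rewrite split3; [|by rewrite -assoc|by rewrite -assoc].
  rewrite -!assoc [X in _ * X + _]e1 [X in _ + _ * X]e2 sAE sBE sreE simE /laplace_main s2 cosE sinE.
  rewrite [RHS](cs t) /sampleM; ring.
- move=> t; have [[_ _ i1 i2] [_ _ e1 e2]] := trs t.
  under eq_Rintegral do rewrite sinS.
  rewrite split3; [|by rewrite -assoc|by rewrite -assoc].
  rewrite -!assoc [X in _ * X + _]e2 [X in _ + _ * X]e1 sAE sBE sreE simE /laplace_main s2 cosE sinE.
  rewrite [RHS](cs t) /sampleM; ring.
Qed.

Lemma sampleM_gt0 n : 0 < sampleM n.
Proof.
by apply: prodr_gt0 => i _; rewrite /tM divr_gt0// gmass_gt0//.
Qed.

End sample.

Section transform_inversion.
Context {R : realType} {dT : measure_display} {T : measurableType dT}.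
Notation leb := (@lebesgue_measure R).
Variables (P : probability T R) (m : nat).
Variables (c v eta : R) (lam d : 'I_m -> R).
Hypothesis q0 : forall k, 0 < tq eta (lam k).
Notation A := (totA eta lam d).
Notation B := (totB c v eta lam d).
Variables (X S : T -> R) (K s : R) (rho sigma : R -> R).
Hypothesis H : has_transform P c v eta lam d X S K rho sigma s.
Hypothesis mS : measurable_fun setT S.
Hypotheses (mr : measurable_fun setT rho) (ms : measurable_fun setT sigma).
Hypothesis iM : intg leb (majorant eta lam d rho sigma s).
Hypothesis iM1 : intg leb (fun t => `|t| * majorant eta lam d rho sigma s t).

Let hC (t : R) := K * laplace_main A B rho sigma s t.
Let hS (t : R) := K * laplace_main A B sigma (fun t => - rho t) s t.
Let M (t : R) := `|K| * majorant eta lam d rho sigma s t.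

Let mNr : measurable_fun setT (fun t => - rho t).
Proof. exact: measurableT_comp. Qed.

Let mC : measurable_fun setT hC.
Proof. by apply: measurable_funM => //; exact: measurable_laplace_main. Qed.
Let mSn : measurable_fun setT hS.
Proof. by apply: measurable_funM => //; exact: measurable_laplace_main. Qed.
Let CM t : `|hC t| <= M t.
Proof. by rewrite normrM ler_wpM2l//; exact: laplace_main_le. Qed.
Let SM t : `|hS t| <= M t.
Proof.
rewrite normrM ler_wpM2l// (le_trans (laplace_main_le _ _ _ _ _ _ _ _ _))//.
by rewrite /majorant normrN addrC.
Qed.
Let iMM : intg leb M. Proof. exact: intgZl. Qed.
Let iMM1 : intg leb (fun t => `|t| * M t).
Proof. by apply: (@eq_intg _ _ _ leb _ _ _ (intgZl `|K| iM1)) => t; rewrite /M; ring. Qed.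

Lemma transform_atom_free (y r : R) : 0 < r -> (forall x, 0 <= X x) -> (forall x, S x = y -> r <= X x) ->
  P [set x | S x = y] = 0%E.
Proof.
by case: H => iX e1 e2; exact: (@atom_free _ _ _ P X S hC hS M iX mS e1 e2 mC mSn CM SM iMM).
Qed.

Hypothesis atoms : forall y, P [set x | S x = y] = 0%E.

Lemma transform_local : exists2 C, 0 <= C & forall a b, -1 <= a -> a <= 0 -> 0 <= b -> b <= 1 ->
  `|2 * pi * \int[P]_x (X x * ((fun y => expR (- (eta * y))) \_ `[a, b]) (S x))
    - (b - a) * (K * \int[leb]_t laplace_main A B rho sigma s t)| <= C * (b - a) ^+ 2.
Proof.
case: H => iX e1 e2.
have [C C0 h] := @local_inversion _ _ _ P X S hC hS M iX mS e1 e2 mC mSn CM SM iMM iMM1 atoms eta.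
exists C => // a b a1 a0 b0 b1; move: (h a b a1 a0 b0 b1).
suff -> : density hC hS 0 = K * \int[leb]_t laplace_main A B rho sigma s t by [].
rewrite -RintegralZl//; last first.
  apply: (@intg_le _ _ _ leb _ (majorant eta lam d rho sigma s)) => //.
    exact: measurable_laplace_main.
  by move=> t; exact: laplace_main_le.
by rewrite /density; apply: eq_Rintegral => t _; rewrite mulr0 cos0 sin0 mul1r mul0r addr0.
Qed.

(** With [half_im], the quotient (rho + i sigma) / (eta + i t). *)
Definition half_re (t : R) : R := (rho t * eta + sigma t * t) / (eta ^+ 2 + t ^+ 2).
Definition half_im (t : R) : R := (sigma t * eta - rho t * t) / (eta ^+ 2 + t ^+ 2).

Let halfE t : (eta * hC t + t * hS t) / (eta ^+ 2 + t ^+ 2) = K * laplace_main A B half_re half_im s t.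
Proof. by rewrite /hC /hS /half_re /half_im /laplace_main; ring. Qed.

Hypothesis iH : intg leb (laplace_main A B half_re half_im s).

Lemma transform_half_pos : 0 < eta ->
  2 * pi * \int[P]_x (X x * ((fun y => expR (- (eta * y))) \_ `[0, +oo[) (S x))
  = K * \int[leb]_t laplace_main A B half_re half_im s t.
Proof.
move=> r0; case: H => iX e1 e2.
rewrite (@halfline_inversion _ _ _ P X S hC hS M iX mS e1 e2 mC mSn CM SM iMM iMM1 atoms eta r0).
by rewrite -RintegralZl//; apply: eq_Rintegral => t _; exact: halfE.
Qed.

(** Half-line inversion needs a positive rate, so it is applied to -S at rate -eta. This conjugates
    the transform and changes the sign of eta, and the two effects together give minus the integrand
    of the positive case. *)
Lemma transform_half_neg : eta < 0 ->
  2 * pi * \int[P]_x (X x * ((fun y => expR (- (- eta * y))) \_ `[0, +oo[) (- S x))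
  = - (K * \int[leb]_t laplace_main A B half_re half_im s t).
Proof.
move=> r0; case: H => iX e1 e2.
have mS' : measurable_fun setT (fun x => - S x) by exact: measurableT_comp.
have e1' t : \int[P]_x (X x * cos (t * - S x)) = hC t.
  by rewrite -[RHS]e1; apply: eq_Rintegral => x _; rewrite mulrN cosN.
have e2' t : \int[P]_x (X x * sin (t * - S x)) = - hS t.
  have i2 : intg P (fun x => X x * sin (t * S x)).
    apply: (@intg_le _ _ _ P _ (fun x => `|X x|)); last exact: intg_norm.
      apply: measurable_funM; first exact: intg_measurable iX.
      apply: measurableT_comp; last exact: measurable_funM.
      by apply: continuous_measurable_fun; exact: continuous_sin.
    by move=> x; rewrite normrM ler_piMr// ler_norml sin_geN1 sin_le1.
  rewrite -mulN1r -(e2 t : _ = hS t) -RintegralZl//.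
  by apply: eq_Rintegral => x _; rewrite mulrN sinN; ring.
have mSn' : measurable_fun setT (fun t => - hS t) by exact: measurableT_comp.
have SM' t : `|- hS t| <= M t by rewrite normrN.
have atoms' y : P [set x | - S x = y] = 0%E.
  rewrite -(atoms (- y)); congr (P _); apply/seteqP; split => x /=.
    by move=> <-; rewrite opprK.
  by move=> ->; rewrite opprK.
have r0' : 0 < - eta by rewrite oppr_gt0.
rewrite (@halfline_inversion _ _ _ P X _ hC _ M iX mS' e1' e2' mC mSn' CM SM' iMM iMM1 atoms' (- eta) r0').
rewrite -mulNr -RintegralZl//; apply: eq_Rintegral => t _.
by rewrite [RHS]mulNr -halfE sqrrN; ring.
Qed.

End transform_inversion.

(** Both functions are linear at 0 up to O(h^2), so the quotient of N/h by D/h converges. It turns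
    window estimates into the limit defining [cond_exp_at]. *)
Lemma ratio_limit (R : realType) (N D : R -> R) (a b C e : R) : 0 < e -> 0 < b ->
  (forall h, 0 < h -> h <= e -> `|N h - h * a| <= C * h ^+ 2 /\ `|D h - h * b| <= C * h ^+ 2) ->
  (\forall h \near 0^'+, 0 < D h) /\ N h / D h @[h --> 0^'+] --> a / b.
Proof.
move=> e0 b0 H.
have he : \forall h \near (0 : R)^'+, 0 < h <= e.
  near=> h; apply/andP; split; first by near: h; exact: nbhs_right_gt.
  by near: h; exact: nbhs_right_le.
have lim (F : R -> R) k : (forall h, 0 < h -> h <= e -> `|F h - h * k| <= C * h ^+ 2) ->
    F h / h @[h --> 0^'+] --> k.
  move=> HF; apply/cvgrPdist_le => d d0; near=> h.
  have /andP[h0 h1] : 0 < h <= e by near: h; exact: he.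
  have -> : k - F h / h = - ((F h - h * k) / h) by field; exact: lt0r_neq0.
  rewrite normrN normrM [X in _ * X]gtr0_norm ?invr_gt0// ler_pdivrMr//.
  apply: le_trans (HF h h0 h1) _; rewrite expr2 mulrA; apply: ler_wpM2r; first exact: ltW.
  have : h <= d / (`|C| + 1).
    by near: h; apply: nbhs_right_le; rewrite divr_gt0// ltr_pwDr.
  rewrite ler_pdivlMr ?ltr_pwDr// => hd; apply: le_trans hd.
  have := ler_norm C; nra.
have lN := lim N a (fun h h0 h1 => (H h h0 h1).1).
have lD := lim D b (fun h h0 h1 => (H h h0 h1).2).
have Dq : \forall h \near (0 : R)^'+, 0 < D h / h by exact: (cvgr_gt b lD _ b0).
have Dp : \forall h \near (0 : R)^'+, 0 < D h.
  near=> h; have h0 : 0 < h by near: h; exact: nbhs_right_gt.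
  have : 0 < D h / h by near: h; exact: Dq.
  by rewrite pmulr_lgt0// invr_gt0.
split => //.
apply: cvg_trans (cvgM lN (cvgV (lt0r_neq0 b0) lD)); apply: near_eq_cvg; near=> h.
have h0 : 0 < h by near: h; exact: nbhs_right_gt.
have D0 : 0 < D h by near: h; exact: Dp.
by rewrite /=; field; rewrite !lt0r_neq0.
Unshelve. all: by end_near. Qed.

(** * Windows and tails of the sample mean *)

Section sample_events.
Context {R : realType} {dT : measure_display} {T : measurableType dT}.
Notation leb := (@lebesgue_measure R).
Variables (P : probability T R) (m : nat) (Z : nat -> 'I_m -> {RV P >-> R}).
Variables (c w0 v eta : R) (lam d w : 'I_m -> R).
Hypothesis indepZ : mutually_independent (fun jk : nat * 'I_m => Z jk.1 jk.2).
Hypothesis normalZ : forall j k, std_normal_rv (Z j k).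
Hypothesis q0 : forall k, 0 < tq eta (lam k).

Notation S := (sampleS Z c v lam d).
Notation W := (sampleW Z w).

(** The tilt e^{eta Q} times e^{-eta S} is the constant e^{eta n (v - c)}, so the weighted event
    reduces to the original probability. *)
Lemma tilt_event n (F G : T -> R) (D : set T) : measurable D -> intg P F ->
  (forall x, G x = if x \in D then expR (- (eta * S n x)) else 0) ->
  \int[P]_x (F x * tilt Z eta lam d n x * G x) =
  expR (eta * (n%:R * (v - c))) * \int[P]_(x in D) F x.
Proof.
move=> mD iF GE; rewrite [in RHS]Rintegral_mkcond -RintegralZl//; last first.
  apply: (@intg_le _ _ _ P _ (fun x => `|F x|)); last exact: intg_norm.
    by apply/measurable_restrict => //; apply: measurable_funTS; exact: intg_measurable iF.
  by move=> x; rewrite patchE; case: ifP => // _; rewrite normr0.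
apply: eq_Rintegral => x _; rewrite GE patchE; case: ifP => _; last by rewrite !mulr0.
rewrite -mulrA /tilt -expRD mulrC; congr (expR _ * _).
by rewrite /sampleS; ring.
Qed.

Lemma Rint_cst1 (D : set T) : measurable D -> \int[P]_(x in D) cst 1 x = fine (P D) :> R.
Proof. by move=> mD; rewrite Rintegral_cst// mul1r. Qed.

Lemma cond_exp_Wbar n (D : set T) : (0 < n)%N -> measurable D -> 0 < fine (P D) ->
  cond_exp P (smean (Wcopy Z w0 w) n) D = w0 + n%:R^-1 * \int[P]_(x in D) W n x / fine (P D).
Proof.
move=> n0 mD p0; have [iW _] := intg_sampleW lam d w indepZ normalZ n.
have iWD : P.-integrable D (EFin \o W n) by apply: integrableS iW.
rewrite /cond_exp.
transitivity (\int[P]_(x in D) (w0 * cst 1 x + n%:R^-1 * W n x) / fine (P D)).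
  congr (_ / _); apply: eq_Rintegral => x _.
  by rewrite -[LHS]/(smean (Wcopy Z w0 w) n x) smean_Wcopy// mulr1 [X in _ + X]mulrC.
have i1 : P.-integrable D (EFin \o (cst 1 : T -> R)).
  by apply: (integrableS measurableT) => //; exact: finite_measure_integrable_cst.
have i2 : P.-integrable D (EFin \o (fun x => w0 * cst 1 x)).
  by apply: eq_integrable (integrableZl mD w0 i1).
have i3 : P.-integrable D (EFin \o (fun x => n%:R^-1 * W n x)).
  by apply: eq_integrable (integrableZl mD n%:R^-1 iWD).
rewrite RintegralD// !RintegralZl// Rint_cst1//; field.
by rewrite lt0r_neq0// pnatr_eq0 -lt0n.
Qed.

Notation A := (totA eta lam d).
Notation B := (totB c v eta lam d).
Notation mean_re := (totre eta lam d w).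
Notation mean_im := (totim eta lam d w).

Definition sp_integral (rho sigma : R -> R) n : R :=
  \int[leb]_t laplace_main A B rho sigma (Num.sqrt n%:R) t.

Variable n : nat.
Hypothesis n0 : (0 < n)%N.
Let s : R := Num.sqrt n%:R.
Hypothesis i1 : intg leb (majorant eta lam d (cst 1) (cst 0) s).
Hypothesis i1t : intg leb (fun t => `|t| * majorant eta lam d (cst 1) (cst 0) s t).
Hypothesis iW : intg leb (majorant eta lam d mean_re mean_im s).
Hypothesis iWt : intg leb (fun t => `|t| * majorant eta lam d mean_re mean_im s t).
Hypothesis J1 : 0 < sp_integral (cst 1) (cst 0) n.

Let n1 : 0 < n%:R :> R. Proof. by rewrite ltr0n. Qed.
Let mS := measurable_sampleS Z c v lam d n.
Let mre := measurable_totre d w q0.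
Let mim := measurable_totim d w q0.
Let tr1 := (sample_transform c v d w indepZ normalZ q0 n).1.
Let trW := (sample_transform c v d w indepZ normalZ q0 n).2.
Let M0 : 0 < sampleM eta lam d n. Proof. exact: sampleM_gt0. Qed.

Let mSset (E : set R) : measurable E -> measurable (S n @^-1` E).
Proof. by move=> mE; rewrite -[X in measurable X]setTI; exact: mS. Qed.

Lemma sampleS_atom_free y : P [set x | S n x = y] = 0%E.
Proof.
(* Value of the tilt on the event S = y, where it is constant. *)
pose r := expR (eta * (y + n%:R * (v - c))).
apply: (@transform_atom_free _ _ _ P m c v eta lam d q0 _ _ _ _ _ _ tr1 mS _ _ i1 y r) => //.
- exact: expR_gt0.
- by move=> x; exact: expR_ge0.
- by move=> x Sx; rewrite /r -Sx /tilt /sampleS subrK.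
Qed.

Let local1 := transform_local q0 tr1 mS (measurable_cst _) (measurable_cst _) i1 i1t sampleS_atom_free.
Let localW := transform_local q0 trW mS mre mim iW iWt sampleS_atom_free.

Let X0 : R := 2 * pi * expR (eta * (n%:R * (v - c))).
Let X0_gt0 : 0 < X0. Proof. by rewrite !mulr_gt0 ?pi_gt0 ?expR_gt0. Qed.

Let event (a b : R) := [set x | a <= S n x <= b].
Let mevent a b : measurable (event a b).
Proof.
rewrite (_ : event a b = S n @^-1` `[a, b]); first exact: mSset.
by apply/seteqP; split => x /=; rewrite in_itv.
Qed.

Let window a b (F : T -> R) : intg P F ->
  2 * pi * \int[P]_x (F x * tilt Z eta lam d n x * ((fun y => expR (- (eta * y))) \_ `[a, b]) (S n x))
  = X0 * \int[P]_(x in event a b) F x.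
Proof.
move=> iF; rewrite (tilt_event (@mevent a b) iF) => [|x].
  by rewrite [LHS]mulrA.
by rewrite patchE; congr (if _ then _ else _); apply/idP/idP; rewrite !inE /event /= in_itv.
Qed.

Lemma tail_gt0 : 0 < fine (P [set x | 0 <= S n x]).
Proof.
have [C C0 h] := local1.
pose D l := X0 * fine (P (event 0 l)).
(* [ratio_limit] is applied with equal numerator and denominator, only for the positivity it gives
   on small windows [0, l]. *)
have [Dp _] : (\forall l \near 0^'+, 0 < D l) /\ D l / D l @[l --> 0^'+] -->
   (sampleM eta lam d n * sp_integral (cst 1) (cst 0) n) / (sampleM eta lam d n * sp_integral (cst 1) (cst 0) n).
  apply: (@ratio_limit R D D _ _ C 1) => //; first exact: mulr_gt0.
  move=> l l0 l1; suff : `|D l - l * (sampleM eta lam d n * sp_integral (cst 1) (cst 0) n)| <= C * l ^+ 2 by [].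
  have := h 0 l; rewrite subr0 => /(_ _ _ _ l1) hh.
  apply: le_trans (hh _ _ _) => //; last exact: ltW.
  rewrite /D -Rint_cst1// -window; last exact: finite_measure_integrable_cst.
  by rewrite le_eqVlt; apply/orP; left; apply/eqP; congr `|_ - _|; congr (_ * _); apply: eq_Rintegral => x _; rewrite mul1r.
have [l] := @filter_ex _ _ (at_right_proper_filter (0 : R)) _ Dp.
rewrite pmulr_rgt0// => pl; apply: (lt_le_trans pl).
have mA : measurable [set x | 0 <= S n x].
  rewrite (_ : [set x | 0 <= S n x] = S n @^-1` `[0, +oo[); first exact: mSset.
  by apply/seteqP; split => x /=; rewrite in_itv/= andbT.
apply: fine_le; rewrite ?fin_num_measure//.
by apply: le_measure; rewrite ?inE// => x /andP[].
Qed.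

Lemma cond_exp_at_sample : cond_exp_at P (smean (Wcopy Z w0 w) n) (smean (Ycopy Z c lam d) n) v
  (w0 + sp_integral mean_re mean_im n / sp_integral (cst 1) (cst 0) n).
Proof.
have [C1 C10 h1] := local1; have [C2 C20 h2] := localW.
have [iWn _] := intg_sampleW lam d w indepZ normalZ n.
pose K := sampleM eta lam d n.
pose p h := fine (P (event (- (n%:R * h)) (n%:R * h))).
pose u h := \int[P]_(x in event (- (n%:R * h)) (n%:R * h)) W n x.
have [Dp lim] : (\forall h \near 0^'+, 0 < X0 * p h) /\ (X0 * u h / n%:R) / (X0 * p h) @[h --> 0^'+] -->
   (2 * n%:R * K * sp_integral mean_re mean_im n) / (2 * n%:R * K * sp_integral (cst 1) (cst 0) n).
  (* The event |Ybar - v| <= h is |S| <= n h, a window of length 2 n h: hence the factor (2 n)^2,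
     and the range h <= 1/n that keeps it within [-1, 1]. *)
  apply: (@ratio_limit R _ _ _ _ ((C1 + C2) * (2 * n%:R) ^+ 2) n%:R^-1).
  - by rewrite invr_gt0.
  - by rewrite !mulr_gt0.
  move=> h h0; rewrite -[X in h <= X]mul1r ler_pdivlMr// mulrC => hn.
  have l0 : 0 <= n%:R * h by rewrite mulr_ge0// ltW.
  have a1 : -1 <= - (n%:R * h) by rewrite lerN2.
  have a0 : - (n%:R * h) <= 0 by rewrite oppr_le0.
  have := h1 _ _ a1 a0 l0 hn; have := h2 _ _ a1 a0 l0 hn; rewrite window// -/(u h).
  have -> : 2 * pi * \int[P]_x (tilt Z eta lam d n x *
      ((fun y => expR (- (eta * y))) \_ `[(- (n%:R * h)), (n%:R * h)]) (S n x)) = X0 * p h.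
    rewrite /p -Rint_cst1// -window; last exact: finite_measure_integrable_cst.
    by congr (_ * _); apply: eq_Rintegral => x _; rewrite mul1r.
  have -> : n%:R * h - - (n%:R * h) = 2 * n%:R * h by ring.
  move=> e2 e1; have sq : 0 <= (2 * n%:R * h) ^+ 2 by exact: sqr_ge0.
  have -> : (C1 + C2) * (2 * n%:R) ^+ 2 * h ^+ 2 = (C1 + C2) * (2 * n%:R * h) ^+ 2 by ring.
  split; last first.
    have -> : h * (2 * n%:R * K * sp_integral (cst 1) (cst 0) n) =
      2 * n%:R * h * (K * sp_integral (cst 1) (cst 0) n) by ring.
    by apply: (le_trans e1); rewrite ler_wpM2r// lerDl.
  have -> : X0 * u h / n%:R - h * (2 * n%:R * K * sp_integral mean_re mean_im n) =
     (X0 * u h - 2 * n%:R * h * (n%:R * K * sp_integral mean_re mean_im n)) / n%:R.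
    by field; exact: lt0r_neq0.
  rewrite normrM [X in _ * X]gtr0_norm ?invr_gt0// ler_pdivrMr//.
  apply: (le_trans e2); apply: (@le_trans _ _ ((C1 + C2) * (2 * n%:R * h) ^+ 2)).
    by rewrite ler_wpM2r// lerDr.
  by rewrite ler_peMr ?ler1n// mulr_ge0// addr_ge0.
have n1' := lt0r_neq0 n1; have J1' := lt0r_neq0 J1; have M0' := lt0r_neq0 M0; have X0' := lt0r_neq0 X0_gt0.
have e : sp_integral mean_re mean_im n / sp_integral (cst 1) (cst 0) n =
  (2 * n%:R * K * sp_integral mean_re mean_im n) / (2 * n%:R * K * sp_integral (cst 1) (cst 0) n).
  by rewrite /K; field; rewrite n1' J1' M0'.
rewrite /cond_exp_at e; apply: cvg_trans (cvgD (cvg_cst w0) lim); apply: near_eq_cvg; near=> h.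
have p0 : 0 < p h by rewrite -(pmulr_rgt0 _ X0_gt0); near: h; exact: Dp.
have Ex x : (`|smean (Ycopy Z c lam d) n x - v| <= h) = (- (n%:R * h) <= S n x <= n%:R * h).
  rewrite (@smean_Ycopy _ _ _ P m Z c v)// addrAC subrr add0r normrM.
  by rewrite (gtr0_norm (_ : 0 < n%:R^-1)) ?invr_gt0// ler_pdivrMr// [h * _]mulrC ler_norml.
have E : [set x | `|smean (Ycopy Z c lam d) n x - v| <= h] = event (- (n%:R * h)) (n%:R * h).
  by apply/seteqP; split => x /=; rewrite Ex.
rewrite [in RHS]E cond_exp_Wbar// /=; congr (_ + _).
by rewrite -/(u h) -/(p h); field; rewrite n1' X0' lt0r_neq0.
Unshelve. all: by end_near. Qed.

Notation half_mean_re := (tothre eta lam d w).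
Notation half_mean_im := (tothim eta lam d w).
Hypothesis eta0 : eta != 0.
Hypothesis iH : intg leb (laplace_main A B half_mean_re half_mean_im s).

Let half_reE : half_re eta mean_re mean_im = half_mean_re.
Proof.
apply/funext => t; have D : eta ^+ 2 + t ^+ 2 != 0.
  by rewrite gt_eqF// ltr_pwDl ?sqr_ge0// exprn_even_gt0.
rewrite /half_re /totre /totim /tothre !mulr_suml -big_split/= mulr_suml.
by apply: eq_bigr => k _; rewrite -(@hre_him_div _ _ _ (d k) (q0 k) _ D).1; ring.
Qed.

Let half_imE : half_im eta mean_re mean_im = half_mean_im.
Proof.
apply/funext => t; have D : eta ^+ 2 + t ^+ 2 != 0.
  by rewrite gt_eqF// ltr_pwDl ?sqr_ge0// exprn_even_gt0.
rewrite /half_im /totre /totim /tothim !mulr_suml -sumrB/= mulr_suml.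
by apply: eq_bigr => k _; rewrite -(@hre_him_div _ _ _ (d k) (q0 k) _ D).2; ring.
Qed.

Lemma tail_expectation : 2 * pi * expR (eta * (n%:R * (v - c))) * \int[P]_(x in [set x | 0 <= S n x]) W n x
  = n%:R * sampleM eta lam d n * sp_integral half_mean_re half_mean_im n.
Proof.
have [iWn W0] := intg_sampleW lam d w indepZ normalZ n.
have iH' : intg leb (laplace_main A B (half_re eta mean_re mean_im) (half_im eta mean_re mean_im) s).
  by rewrite half_reE half_imE.
have mA : measurable [set x | 0 <= S n x].
  rewrite (_ : [set x | 0 <= S n x] = S n @^-1` `[0, +oo[); first exact: mSset.
  by apply/seteqP; split => x /=; rewrite in_itv/= andbT.
have mN : measurable [set x | S n x <= 0].
  rewrite (_ : [set x | S n x <= 0] = S n @^-1` `]-oo, 0]); first exact: mSset.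
  by apply/seteqP; split => x /=; rewrite in_itv/=.
have [ep|en|/esym/eqP] := ltgtP 0 eta; last by rewrite (negbTE eta0).
  have := transform_half_pos q0 trW mS mre mim iW iWt sampleS_atom_free iH' ep.
  rewrite half_reE half_imE => <-.
  rewrite (tilt_event mA iWn) => [|x]; first by rewrite [RHS]mulrA.
  by rewrite patchE; congr (if _ then _ else _); apply/idP/idP; rewrite !inE /= in_itv/= andbT.
have := transform_half_neg q0 trW mS mre mim iW iWt sampleS_atom_free iH' en.
rewrite half_reE half_imE => /(congr1 -%R); rewrite opprK => <-.
rewrite (tilt_event mN iWn) => [|x]; last first.
  rewrite patchE mulrNN; congr (if _ then _ else _).
  by apply/idP/idP; rewrite !inE /= in_itv/= andbT oppr_ge0.
have m0 : measurable [set x | S n x = 0] by exact: (mSset (measurable_set1 0)).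
(* The two half-lines overlap only in the null event S = 0, and the mean of [W] is 0. *)
have -> : \int[P]_(x in [set x | 0 <= S n x]) W n x = - \int[P]_(x in [set x | S n x <= 0]) W n x.
  apply/eqP; rewrite -addr_eq0 -[X in _ == X]W0 /Rintegral.
  have iWN : P.-integrable [set x | S n x <= 0] (EFin \o W n) by exact: integrableS iWn.
  rewrite [X in _ + fine X](@negligible_integral _ _ _ P _ _ _ m0 mN iWN (sampleS_atom_free 0)).
  rewrite -[X in _ + X]/(\int[P]_(x in _) W n x) -[X in X + _]/(\int[P]_(x in _) W n x).
  have U : [set x | 0 <= S n x] `|` ([set x | S n x <= 0] `\` [set x | S n x = 0]) = setT.
    apply/seteqP; split => // x _ /=; have [|h] := leP 0 (S n x); first by left.
    by right; split; [exact: ltW|move=> e; move: h; rewrite e ltxx].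
  rewrite -Rintegral_setU ?U//; first exact: measurableD.
  apply/disj_setPLR => x /= h0 [h1 h2]; apply: h2; apply/eqP.
  by rewrite eq_le h0 h1.
by ring.
Qed.

End sample_events.

(** * The saddlepoint expansions *)

(** For the main terms, (a (1 + e/x) + b/x) / (1 + e/x) is a + b/(x + e) without error, so only E1
    and E2 contribute. The requirements 4 |e| <= x and 4 K <= x keep J1/g above 1/2 and x + e above
    3/4. *)
Lemma ratio_expansion (R : realType) (x g a b e K J1 J2 : R) : 0 < g -> 1 <= x -> 0 <= K ->
  4 * `|e| <= x -> 4 * K <= x ->
  `|J1 - g * (1 + e / x)| <= g * (K / x ^+ 2) ->
  `|J2 - g * (a + (a * e + b) / x)| <= g * (K / x ^+ 2) ->
  0 < J1 /\ `|J2 / J1 - (a + b / (x + e))| <= 2 * K * (1 + `|a| + 2 * `|b|) / x ^+ 2.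
Proof.
move=> g0 x1 K0 ex Kx h1 h2.
have x0 : 0 < x by rewrite (lt_le_trans _ x1).
have xn := lt0r_neq0 x0; have gn := lt0r_neq0 g0.
pose k := K / x ^+ 2.
have k0 : 0 <= k by rewrite divr_ge0// sqr_ge0.
have k4 : k <= 4^-1.
  rewrite /k ler_pdivrMr ?exprn_gt0//.
  have : x <= x ^+ 2 by rewrite expr2 ler_peMr// ltW.
  lra.
pose E1 := J1 / g - (1 + e / x); pose E2 := J2 / g - (a + (a * e + b) / x).
have sc (J L : R) : `|J - g * L| <= g * k -> `|J / g - L| <= k.
  move=> h; have -> : J / g - L = (J - g * L) / g by field.
  by rewrite normrM (gtr0_norm (_ : 0 < g^-1)) ?invr_gt0// ler_pdivrMr// [k * g]mulrC.
have e1 : `|E1| <= k by exact: sc.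
have e2 : `|E2| <= k by exact: sc.
have exx : - 4^-1 <= e / x.
  rewrite ler_pdivlMr//; have := ler_norm (- e); rewrite normrN; lra.
have xe : 3 / 4 <= x + e by have := ler_norm (- e); rewrite normrN; lra.
have xe0 : x + e != 0 by rewrite gt_eqF//; lra.
pose D := J1 / g.
have DE : D = 1 + e / x + E1 by rewrite /E1 /D; ring.
have D2 : 2^-1 <= D by rewrite DE; have := ler_norm (- E1); rewrite normrN; lra.
have D0 : 0 < D by lra.
have J10 : 0 < J1 by move: D0; rewrite /D pmulr_lgt0// invr_gt0.
split => //; have J1n := lt0r_neq0 J10; have Dn := lt0r_neq0 D0.
have -> : J2 / J1 - (a + b / (x + e)) = (E2 - a * E1 - b / (x + e) * E1) / D.
  rewrite /E1 /E2 /D; field.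
  by rewrite J1n xe0 gn xn.
rewrite normrM (gtr0_norm (_ : 0 < D^-1)) ?invr_gt0// ler_pdivrMr//.
have bx : `|b / (x + e)| <= 2 * `|b|.
  rewrite normrM mulrC ler_wpM2r// gtr0_norm ?invr_gt0; last lra.
  by rewrite invf_ple ?posrE//; lra.
have n1 : `|E2 - a * E1 - b / (x + e) * E1| <= k + `|a| * k + 2 * `|b| * k.
  rewrite (le_trans (ler_normB _ _))// normrM lerD//; last by apply: ler_pM.
  by rewrite (le_trans (ler_normB _ _))// normrM lerD// ler_wpM2l.
apply: (le_trans n1).
have -> : 2 * K * (1 + `|a| + 2 * `|b|) / x ^+ 2 * D = (k + `|a| * k + 2 * `|b| * k) * (2 * D).
  by rewrite /k; field.
rewrite ler_peMr//; last lra.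
have ha : 0 <= `|a| * k by rewrite mulr_ge0.
have hb : 0 <= 2 * `|b| * k by apply: mulr_ge0 => //; exact: mulr_ge0.
lra.
Qed.

Lemma gmass_scale (R : realType) (q x : R) : 0 < x -> 0 < q -> gmass (x * q) 0 = gmass q 0 / Num.sqrt x.
Proof.
move=> x0 q0; rewrite /gmass expr0n/= !mul0r expR0 !mulr1.
have -> : 2 * pi / (x * q) = (2 * pi / q) * x^-1 by field; rewrite !lt0r_neq0.
by rewrite sqrtrM ?sqrtrV ?ltW// divr_gt0// mulr_gt0// pi_gt0.
Qed.

Section phi_identity.
Context {R : realType}.
Variables (m : nat) (c v eta : R) (lam d : 'I_m -> R).
Hypothesis q0 : forall k, 0 < tq eta (lam k).
Hypothesis saddle : \sum_(k < m) ((lam k * (1 - 2 * lam k * eta) + d k ^+ 2 * (1 - lam k * eta) * eta)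
                / (1 - 2 * lam k * eta) ^+ 2) = v - c.

Let e k := - 2^-1 * ln (tq eta (lam k)) + 2^-1 * (d k ^+ 2 * eta ^+ 2 / tq eta (lam k)).

Lemma KY_sub : KY c lam d eta - eta * v = \sum_(k < m) e k - eta * (v - c).
Proof. by rewrite /KY /e /tq big_split/= -!mulr_sumr; ring. Qed.

(** With the saddlepoint equation the rate splits into the terms (ln q + 1/q - 1)/2 + (d eta/q)^2/2,
    each nonnegative because ln y <= y - 1. Without this sign the square root in [omegahat] would be
    the default value 0. *)
Lemma rate_ge0 : 0 <= eta * v - KY c lam d eta.
Proof.
rewrite -opprB KY_sub opprB -saddle mulr_sumr -sumrB; apply: sumr_ge0 => k _.
have q1 := q0 k; have qn := lt0r_neq0 q1; rewrite /e; set q := tq _ _ in q1 qn *.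
have -> : eta * ((lam k * (1 - 2 * lam k * eta) + d k ^+ 2 * (1 - lam k * eta) * eta) / (1 - 2 * lam k * eta) ^+ 2)
  - (- 2^-1 * ln q + 2^-1 * (d k ^+ 2 * eta ^+ 2 / q)) =
  2^-1 * (ln q + q^-1 - 1) + (d k * eta / q) ^+ 2 / 2.
  by rewrite -/q /q /tq in qn *; field.
apply: addr_ge0; last by rewrite divr_ge0// sqr_ge0.
have : ln (1 + (q^-1 - 1)) <= q^-1 - 1.
  by apply: le_ln1Dx; rewrite -subr_gt0 opprK subrK invr_gt0.
rewrite addrCA subrr addr0.
rewrite lnV ?posrE//; lra.
Qed.

Lemma tM_exp k : tM eta (lam k) (d k) = expR (e k).
Proof.
have q1 := q0 k; rewrite /tM /gmass expr0n/= !mul0r expR0 mulr1 divr1.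
have s0 : Num.sqrt (2 * pi) != 0 :> R by rewrite gt_eqF// sqrtr_gt0 mulr_gt0// pi_gt0.
rewrite sqrtrM ?mulr_ge0 ?pi_ge0// sqrtrV ?ltW// /e expRD.
have -> : expR (- 2^-1 * ln (tq eta (lam k))) = (Num.sqrt (tq eta (lam k)))^-1.
  by rewrite mulNr expRN -powR12_sqrt ?ltW// /powR gt_eqF.
have -> : (eta * d k) ^+ 2 / (2 * tq eta (lam k)) = 2^-1 * (d k ^+ 2 * eta ^+ 2 / tq eta (lam k)).
  by field; exact: lt0r_neq0.
by field; rewrite s0 gt_eqF// sqrtr_gt0.
Qed.

(** The mass of the tilt is e^{n (K_Y(eta) - c eta)}, and [phi] at sqrt n omega is e^{n (K_Y(eta) -
    eta v)} / sqrt(2 pi). The sign in [omegahat] squares to 1 only for eta nonzero. *)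
Lemma phi_sampleM n : eta != 0 ->
  sampleM eta lam d n = expR (eta * (n%:R * (v - c))) * (Num.sqrt (2 * pi) * phi (Num.sqrt n%:R * omegahat c lam d v eta)).
Proof.
move=> eta0.
have -> : sampleM eta lam d n = expR (n%:R * \sum_(k < m) e k).
  rewrite -sum_sample_idx2 expR_sum /sampleM /sM; apply: eq_bigr => i _.
  exact: tM_exp.
have -> : phi (Num.sqrt n%:R * omegahat c lam d v eta) =
   (Num.sqrt (2 * pi))^-1 * expR (n%:R * (KY c lam d eta - eta * v)).
  rewrite /phi normal_pdfE ?oner_eq0// /normal_peak /normal_fun expr1n mul1r subr0.
  have -> : pi *+ 2 = 2 * pi :> R by rewrite mulr_natl.
  congr (_ * expR _).
  have sg2 : Num.sg eta ^+ 2 = 1 by rewrite sqr_sg eta0.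
  have h : 0 <= 2 * (eta * v - KY c lam d eta) by rewrite mulr_ge0 ?rate_ge0.
  rewrite /omegahat !exprMn sg2 mul1r !sqr_sqrtr//; by field.
have s0 : Num.sqrt (2 * pi) != 0 :> R by rewrite gt_eqF// sqrtr_gt0 mulr_gt0// pi_gt0.
by rewrite mulVKf// -expRD KY_sub; congr expR; ring.
Qed.

End phi_identity.

Lemma sum4_ltn (i j k l n : nat) : (i + j + k + l < n)%N ->
  [/\ (i <= n)%N, (j <= n)%N, (k <= n)%N & (l <= n)%N].
Proof. by move=> h; split; lia. Qed.

(** The summand of [approx_tail] with r for the square root of K_Y''. Everything is an atom of an
    abstract field, so that [field] meets neither roots nor iterated derivatives. *)
Lemma tail_term (R : fieldType) (r k3 k4 eta lam d w x F p sn : R) : (2 : R) != 0 -> (3 : R) != 0 ->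
  r != 0 -> eta != 0 -> 1 - 2 * lam * eta != 0 -> x != 0 -> p != 0 -> sn != 0 ->
  F / (sn * (eta * r) * p) * (w * d / (1 - 2 * lam * eta)) *
    (eta + x^-1 * ((k4 / (r ^+ 2) ^+ 2 / 8 - 5 * (k3 / r ^+ 3) ^+ 2 / 24 - k3 / r ^+ 3 / (2 * (eta * r))
       - 1 / (eta * r) ^+ 2) * eta
     + 1 / (r * (1 - 2 * lam * eta)) * (k3 / r ^+ 3 / 2 + 1 / (eta * r))
     - 4 * lam / (2 * r ^+ 2 * (1 - 2 * lam * eta) ^+ 2))) =
  F / (sn * r * p) * (w * (d / (1 - 2 * lam * eta)) + (w * (d / (1 - 2 * lam * eta))
      * (k4 / (8 * (r ^+ 2) ^+ 2) - 5 * k3 ^+ 2 / (24 * (r ^+ 2) ^+ 3))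
    + (w * (- (d / (1 - 2 * lam * eta) * (2 * lam / (1 - 2 * lam * eta)) ^+ 2)) / r ^+ 2
       + w * (d / (1 - 2 * lam * eta) * (2 * lam / (1 - 2 * lam * eta))) * k3 / (2 * (r ^+ 2) ^+ 2))) / x).
Proof.
move=> n2 n3 r0 e0 q0 x0 p0 s0.
have n8 : (8 : R) != 0 by rewrite (_ : 8 = 2 ^+ 3) ?expf_neq0//; ring.
have n24 : (24 : R) != 0 by rewrite (_ : 24 = 2 ^+ 3 * 3) ?mulf_neq0 ?expf_neq0//; ring.
by field; rewrite n2 n8 n24 r0 e0 q0 x0 p0 s0.
Qed.

(** * The case of positive second cumulant *)

Section regular_case.
Context {R : realType} {dT : measure_display} {T : measurableType dT}.
Notation leb := (@lebesgue_measure R).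
Variables (P : probability T R) (m : nat) (Z : nat -> 'I_m -> {RV P >-> R}).
Variables (c w0 v eta : R) (lam d w : 'I_m -> R).
Hypothesis indepZ : mutually_independent (fun jk : nat * 'I_m => Z jk.1 jk.2).
Hypothesis normalZ : forall j k, std_normal_rv (Z j k).
Hypothesis q0 : forall k, 0 < tq eta (lam k).
Hypothesis saddle : \sum_(k < m) ((lam k * (1 - 2 * lam k * eta) + d k ^+ 2 * (1 - lam k * eta) * eta)
                / (1 - 2 * lam k * eta) ^+ 2) = v - c.
(* Opaque names for the cumulants: as terms they are iterated derivatives. *)
Variables k2 k3 k4 : R.
Hypotheses (k2E : KYn 2 c lam d eta = k2) (k3E : KYn 3 c lam d eta = k3) (k4E : KYn 4 c lam d eta = k4).
Hypothesis K2 : 0 < k2.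

Notation A := (totA eta lam d).
Notation B := (totB c v eta lam d).
(** In standardised cumulants this is rho4/8 - 5 rho3^2/24, the classical first correction to the
    saddlepoint density. *)
Let e4 : R := k4 / (8 * k2 ^+ 2) - 5 * k3 ^+ 2 / (24 * k2 ^+ 3).
Let K2' : 0 < KYn 2 c lam d eta. Proof. by rewrite k2E. Qed.
Let g0 : R := gmass k2 0.
Let g0_gt0 : 0 < g0. Proof. exact: gmass_gt0. Qed.
(** [a], [a2] and [a1] are the Taylor coefficients of the total transform ratio, of orders 0 and 2
    in its real part and 1 in its imaginary part; [b] combines the last two as in
    [laplace_limit]. *)
Let a : R := \sum_(k < m) w k * (eta * d k / tq eta (lam k)).
Let a2 : R := \sum_(k < m) w k * (- (d k * tbeta eta (lam k) / tq eta (lam k) ^+ 2)).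
Let a1 : R := \sum_(k < m) w k * (d k / tq eta (lam k) ^+ 2).
Let b : R := a2 / k2 + a1 * k3 / (2 * k2 ^+ 2).

(** The correction proportional to r0 is kept apart from [r1], so that e4 appears identically in the
    numerator and denominator integrals. *)
Definition sp_value (r0 r1 : R) n : R := g0 / Num.sqrt n%:R * (r0 + (r0 * e4 + r1) / n%:R).

Let sp_valueE r0 r2 s1 n : (0 < n)%N ->
  sp_limit c eta lam d r0 r2 s1 n = sp_value r0 (r2 / k2 + s1 * k3 / (2 * k2 ^+ 2)) n.
Proof.
by move=> n0; rewrite /sp_limit k2E k3E k4E /laplace_limit gmass_scale ?ltr0n// /sp_value -/g0 -/e4 addrA.
Qed.

Let laplace1 : exists2 K : R, 0 <= K & exists n0 : nat, forall n : nat, (n0 <= n)%N ->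
  [/\ (0 < n)%N, `|sp_integral c v eta lam d (cst 1) (cst 0) n - sp_value 1 0 n|
        <= K / (n%:R ^+ 2 * Num.sqrt n%:R),
      intg leb (majorant eta lam d (cst 1) (cst 0) (Num.sqrt n%:R)) &
      intg leb (fun t => `|t| * majorant eta lam d (cst 1) (cst 0) (Num.sqrt n%:R) t)].
Proof.
have h1 : exists2 C : R, 0 <= C & forall t : R, `|cst 1 t - 1 - 0 * t ^+ 2| <= C * `|t| ^+ 4.
  by exists 0 => // t; rewrite /cst/= subrr !mul0r subrr normr0.
have h2 : exists2 C : R, 0 <= C & forall t : R, `|cst 0 t - 0 * t| <= C * `|t| ^+ 3.
  by exists 0 => // t; rewrite /cst/= !mul0r subrr normr0.
have [K K0 [n0 H]] := sp_laplace q0 saddle K2' (measurable_cst _) (measurable_cst _) h1 h2.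
exists K => //; exists n0.+1 => n hn; have [_ e i it] := H n (ltnW hn).
have n1 : (0 < n)%N by apply: leq_ltn_trans hn.
by split => //; move: e; rewrite sp_valueE// !mul0r addr0.
Qed.

Let laplaceW : exists2 K : R, 0 <= K & exists n0 : nat, forall n : nat, (n0 <= n)%N ->
  [/\ `|sp_integral c v eta lam d (totre eta lam d w) (totim eta lam d w) n - sp_value a b n|
        <= K / (n%:R ^+ 2 * Num.sqrt n%:R),
      intg leb (majorant eta lam d (totre eta lam d w) (totim eta lam d w) (Num.sqrt n%:R)) &
      intg leb (fun t => `|t| * majorant eta lam d (totre eta lam d w) (totim eta lam d w) (Num.sqrt n%:R) t)].
Proof.
have [K K0 [n0 H]] := sp_laplace q0 saddle K2' (measurable_totre d w q0) (measurable_totim d w q0)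
  (totre_taylor d w q0) (totim_taylor d w q0).
exists K => //; exists n0.+1 => n hn; have [_ e i it] := H n (ltnW hn).
have n1 : (0 < n)%N by apply: leq_ltn_trans hn.
by split => //; move: e; rewrite sp_valueE.
Qed.

(** The bracket's denominator equals 2 k2^2 (n + e4), which gives the shape delivered by
    [ratio_expansion]. *)
Let approx_eqE n : (0 < n)%N -> n%:R + e4 != 0 -> approx_eq c lam d w0 w eta n = w0 + (a + b / (n%:R + e4)).
Proof.
move=> n0 ne; rewrite /approx_eq k2E k3E k4E /b; congr (_ + _).
have k2n := lt0r_neq0 K2.
have E : a2 / k2 + a1 * k3 / (2 * k2 ^+ 2) = \sum_(k < m) (w k * d k * (k3 * tq eta (lam k) - 4 * lam k * k2)
   / (2 * k2 ^+ 2 * tq eta (lam k) ^+ 3)).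
  rewrite /a2 /a1 !mulr_suml -big_split/=; apply: eq_bigr => k _.
  rewrite /tbeta; field.
  by rewrite k2n lt0r_neq0.
rewrite E mulr_suml /a -big_split/=; apply: eq_bigr => k _.
have q1 := lt0r_neq0 (q0 k).
have -> : 2 * n%:R * k2 ^+ 2 + 4^-1 * k4 - 5 / 12 * k3 ^+ 2 / k2 = 2 * k2 ^+ 2 * (n%:R + e4).
  by rewrite /e4; field.
rewrite -/(tq eta (lam k)).
by field; rewrite q1 ne k2n.
Qed.

Let sp_ratio : exists C : R, exists N : nat, forall n : nat, (N <= n)%N ->
  [/\ (0 < n)%N, intg leb (majorant eta lam d (cst 1) (cst 0) (Num.sqrt n%:R)) /\
      intg leb (fun t => `|t| * majorant eta lam d (cst 1) (cst 0) (Num.sqrt n%:R) t),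
      intg leb (majorant eta lam d (totre eta lam d w) (totim eta lam d w) (Num.sqrt n%:R)) /\
      intg leb (fun t => `|t| * majorant eta lam d (totre eta lam d w) (totim eta lam d w) (Num.sqrt n%:R) t),
      0 < sp_integral c v eta lam d (cst 1) (cst 0) n &
      n%:R + e4 != 0 /\
      `|sp_integral c v eta lam d (totre eta lam d w) (totim eta lam d w) n
        / sp_integral c v eta lam d (cst 1) (cst 0) n - (a + b / (n%:R + e4))| <= C / n%:R ^+ 2].
Proof.
have [C1 C10 [N1 H1]] := laplace1; have [C2 C20 [N2 H2]] := laplaceW.
pose K := (C1 + C2) / g0.
have K0 : 0 <= K by apply: divr_ge0; [exact: addr_ge0|exact: ltW].
exists (2 * K * (1 + `|a| + 2 * `|b|)).
(* Beyond the two Laplace thresholds, this secures 4 |e4| <= n and 4 K <= n. *)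
exists (N1 + N2 + Num.bound (4 * `|e4|) + Num.bound (4 * K)).+1 => n /sum4_ltn[hn1 hn2 hn3 hn4].
have [n0 e1 i1 i1t] := H1 n hn1.
have [eW iW iWt] := H2 n hn2.
have le4 : 4 * `|e4| <= n%:R.
  apply: le_trans (ltW (archi_boundP _)) _; first by rewrite mulr_ge0.
  by rewrite ler_nat.
have leK : 4 * K <= n%:R.
  apply: le_trans (ltW (archi_boundP _)) _; first by rewrite mulr_ge0.
  by rewrite ler_nat.
have n1 : 1 <= n%:R :> R by rewrite ler1n.
have np : 0 < n%:R :> R by rewrite ltr0n.
have sp : 0 < Num.sqrt n%:R :> R by rewrite sqrtr_gt0.
have gp : 0 < g0 / Num.sqrt n%:R by rewrite divr_gt0.
have conv C (J L : R) : C <= C1 + C2 -> `|J - L| <= C / (n%:R ^+ 2 * Num.sqrt n%:R) ->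
    `|J - L| <= g0 / Num.sqrt n%:R * (K / n%:R ^+ 2).
  move=> CC h; apply: (le_trans h).
  have -> : g0 / Num.sqrt n%:R * (K / n%:R ^+ 2) = (C1 + C2) / (n%:R ^+ 2 * Num.sqrt n%:R).
    by rewrite /K; field; rewrite !lt0r_neq0.
  by rewrite ler_wpM2r// invr_ge0 mulr_ge0 ?sqr_ge0// ltW.
have e1' := conv C1 _ _ ltac:(by rewrite lerDl) e1.
have eW' := conv C2 _ _ ltac:(by rewrite lerDr) eW.
rewrite /sp_value mul1r addr0 in e1'.
have [J1 main] := ratio_expansion gp n1 K0 le4 leK e1' eW'.
split => //; split => //.
by rewrite gt_eqF//; have := ler_norm (- e4); rewrite normrN; lra.
Qed.

Lemma regular_part1 : exists C : R, exists N : nat, forall n : nat, (N <= n)%N ->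
  exists L : R, cond_exp_at P (smean (Wcopy Z w0 w) n) (smean (Ycopy Z c lam d) n) v L /\
    `|L - approx_eq c lam d w0 w eta n| <= C / n%:R ^+ 2.
Proof.
have [C [N H]] := sp_ratio; exists C, N => n hn.
have [n0 [i1 i1t] [iW iWt] J1 [ne main]] := H n hn.
exists (w0 + sp_integral c v eta lam d (totre eta lam d w) (totim eta lam d w) n / sp_integral c v eta lam d (cst 1) (cst 0) n).
split.
  exact: (@cond_exp_at_sample _ _ _ P m Z c w0 v eta lam d w indepZ normalZ q0 n n0 i1 i1t iW iWt J1).
by rewrite approx_eqE// opprD addrACA subrr add0r.
Qed.

Let h : R := \sum_(k < m) w k * (d k / tq eta (lam k)).
Let h2 : R := \sum_(k < m) w k * (- (d k / tq eta (lam k) * tbeta eta (lam k) ^+ 2)).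
Let h1 : R := \sum_(k < m) w k * (d k / tq eta (lam k) * tbeta eta (lam k)).
Let hb : R := h2 / k2 + h1 * k3 / (2 * k2 ^+ 2).

Let laplaceH : exists2 K : R, 0 <= K & exists n0 : nat, forall n : nat, (n0 <= n)%N ->
  `|sp_integral c v eta lam d (tothre eta lam d w) (tothim eta lam d w) n - sp_value h hb n|
        <= K / (n%:R ^+ 2 * Num.sqrt n%:R) /\
  intg leb (laplace_main A B (tothre eta lam d w) (tothim eta lam d w) (Num.sqrt n%:R)).
Proof.
have [K K0 [n0 H]] := sp_laplace q0 saddle K2' (measurable_tothre eta lam d w) (measurable_tothim eta lam d w)
  (tothre_taylor d w q0) (tothim_taylor d w q0).
exists K => //; exists n0.+1 => n hn; have [i e _ _] := H n (ltnW hn).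
have n1 : (0 < n)%N by apply: leq_ltn_trans hn.
by split => //; move: e; rewrite sp_valueE.
Qed.

Let approx_tailE n p : eta != 0 -> (0 < n)%N -> p != 0 -> approx_tail c lam d w0 w v eta p n =
  w0 + phi (Num.sqrt n%:R * omegahat c lam d v eta) / (Num.sqrt n%:R * Num.sqrt k2 * p)
    * (h + (h * e4 + hb) / n%:R).
Proof.
move=> e0 n0 p0; rewrite /approx_tail /zhat /rho3hat /rho4hat k2E k3E k4E; congr (_ + _).
set F := phi _; set r := Num.sqrt k2.
have r2 : k2 = r ^+ 2 by rewrite sqr_sqrtr// ltW.
have r0 : r != 0 by rewrite gt_eqF// sqrtr_gt0.
have np : 0 < n%:R :> R by rewrite ltr0n.
have s0 : Num.sqrt n%:R != 0 :> R by rewrite gt_eqF// sqrtr_gt0.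
have E : h + (h * e4 + hb) / n%:R = \sum_(k < m) (w k * (d k / tq eta (lam k)) + (w k * (d k / tq eta (lam k)) * e4
   + (w k * (- (d k / tq eta (lam k) * tbeta eta (lam k) ^+ 2)) / k2
      + w k * (d k / tq eta (lam k) * tbeta eta (lam k)) * k3 / (2 * k2 ^+ 2))) / n%:R).
  by rewrite big_split/= -mulr_suml big_split/= -mulr_suml big_split/= -!mulr_suml.
rewrite E mulr_sumr; apply: eq_bigr => k _.
rewrite /e4 /tbeta -/(tq eta (lam k)) r2 -/r; apply: tail_term; rewrite ?pnatr_eq0// -?lt0n//.
exact: lt0r_neq0 (q0 k).
Qed.

(** The tail probability appears identically on both sides, so the difference is a multiple of one
    Laplace error, that of the transform divided by eta + i t. *)
Lemma regular_part2 : eta != 0 -> exists C : R, exists N : nat, forall n : nat, (N <= n)%N ->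
  let oma := fine (P [set t | v <= smean (Ycopy Z c lam d) n t]) in
  `|cond_exp P (smean (Wcopy Z w0 w) n) [set t | v <= smean (Ycopy Z c lam d) n t]
     - approx_tail c lam d w0 w v eta oma n|
    <= C * (phi (Num.sqrt n%:R * omegahat c lam d v eta) / (Num.sqrt n%:R * oma)) / n%:R ^+ 2.
Proof.
move=> eta0; have [C [N H]] := sp_ratio; have [K K0 [N' H']] := laplaceH.
have s0 : 0 < Num.sqrt (2 * pi) :> R by rewrite sqrtr_gt0 mulr_gt0// pi_gt0.
have ss : 2 * pi = Num.sqrt (2 * pi) ^+ 2 :> R by rewrite sqr_sqrtr// mulr_ge0// pi_ge0.
(* Inversion leaves 1/(2 pi) and the mass of the tilt contributes sqrt(2 pi) [phi], whence the
   constant. *)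
exists (K / Num.sqrt (2 * pi)), (N + N')%N => n hn.
have [n0 [i1 i1t] [iW iWt] J1 _] := H n (leq_trans (leq_addr _ _) hn).
have [eH iH] := H' n (leq_trans (leq_addl _ _) hn).
have np : 0 < n%:R :> R by rewrite ltr0n.
have sp : 0 < Num.sqrt n%:R :> R by rewrite sqrtr_gt0.
have E : [set t | v <= smean (Ycopy Z c lam d) n t] = [set x | 0 <= sampleS Z c v lam d n x].
  apply/seteqP; split => x /=; rewrite (@smean_Ycopy _ _ _ P m Z c v)// lerDl.
    by rewrite pmulr_lge0// invr_gt0.
  by rewrite pmulr_lge0// invr_gt0.
have mD : measurable [set x | 0 <= sampleS Z c v lam d n x].
  rewrite (_ : mkset _ = setT `&` sampleS Z c v lam d n @^-1` `[0, +oo[).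
    by apply: measurable_sampleS.
  by apply/seteqP; split => x /=; rewrite in_itv/= andbT// => -[].
have p0 := tail_gt0 w indepZ normalZ q0 i1 i1t J1.
have U := tail_expectation indepZ normalZ q0 i1 iW iWt eta0 iH.
rewrite E; cbv zeta; set p := fine _ in p0 *.
rewrite (cond_exp_Wbar w0 lam d w indepZ normalZ)// -/p approx_tailE// ?lt0r_neq0//.
move: U; rewrite (phi_sampleM q0 saddle n eta0).
set F := phi _; set J := sp_integral _ _ _ _ _ _ _ _ in eH *; set Wt := Rintegral _ _ _ => U.
have F0 : 0 <= F by exact: normal_pdf_ge0.
have g0E : g0 = Num.sqrt (2 * pi) / Num.sqrt k2.
  rewrite /g0 /gmass expr0n/= !mul0r expR0 mulr1 sqrtrM ?sqrtrV ?ltW//.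
  by rewrite mulr_gt0// pi_gt0.
have r0 : 0 < Num.sqrt k2 by rewrite sqrtr_gt0.
have WE : Wt = n%:R * F * J / Num.sqrt (2 * pi).
  move: ss U; move: (Num.sqrt (2 * pi)) s0 (expR _) (expR_gt0 (eta * (n%:R * (v - c)))) => s s_gt0 ex ex0 -> U.
  have X0 : s ^+ 2 * ex != 0 by rewrite mulf_neq0 ?lt0r_neq0// exprn_gt0.
  apply: (mulfI X0); rewrite U; field.
  by rewrite lt0r_neq0.
move: eH; rewrite /sp_value g0E => eH.
have -> : w0 + n%:R^-1 * Wt / p - (w0 + F / (Num.sqrt n%:R * Num.sqrt k2 * p) * (h + (h * e4 + hb) / n%:R)) =
   F / (Num.sqrt (2 * pi) * p) * (J - Num.sqrt (2 * pi) / Num.sqrt k2 / Num.sqrt n%:R * (h + (h * e4 + hb) / n%:R)).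
  rewrite WE; move: (Num.sqrt (2 * pi)) s0 (Num.sqrt k2) r0 (Num.sqrt n%:R) sp => s s_gt0 r r_gt0 sn sn_gt0.
  by field; rewrite !lt0r_neq0.
have c0 : 0 <= F / (Num.sqrt (2 * pi) * p) by rewrite divr_ge0// mulr_ge0// ltW.
rewrite normrM (ger0_norm c0) (le_trans (ler_wpM2l c0 eH))// le_eqVlt; apply/orP; left; apply/eqP.
move: (Num.sqrt (2 * pi)) s0 (Num.sqrt n%:R) sp => s s_gt0 sn sn_gt0.
by field; rewrite !lt0r_neq0.
Qed.

End regular_case.

Section degenerate_case.
Context {R : realType} {dT : measure_display} {T : measurableType dT}.
Variables (P : probability T R) (m : nat) (Z : nat -> 'I_m -> {RV P >-> R}).
Variables (c w0 v eta : R) (lam d w : 'I_m -> R).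
Hypothesis indepZ : mutually_independent (fun jk : nat * 'I_m => Z jk.1 jk.2).
Hypothesis normalZ : forall j k, std_normal_rv (Z j k).
Hypothesis lam0 : forall k, lam k = 0.
Hypothesis d0 : forall k, d k = 0.

Lemma degenerate_mean n x : (0 < n)%N -> smean (Ycopy Z c lam d) n x = c.
Proof.
move=> n0; rewrite (@smean_Ycopy _ _ _ P m Z c c)//.
rewrite /sampleS /sampleQ /qsum big1 => [|i _]; last by rewrite lam0 d0 !mul0r addr0.
by rewrite subrr mulr0 subrr mul0r addr0.
Qed.

Lemma degenerate_cond_exp n : (0 < n)%N -> cond_exp P (smean (Wcopy Z w0 w) n) setT = w0.
Proof.
move=> n0; have p1 : fine (P setT) = 1 :> R by rewrite probability_setT.
rewrite (cond_exp_Wbar w0 lam d w indepZ normalZ)//; last by rewrite p1.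
by rewrite (intg_sampleW lam d w indepZ normalZ n).2 mulr0 mul0r addr0.
Qed.

Lemma degenerate_approx_eq n : approx_eq c lam d w0 w eta n = w0.
Proof. by rewrite /approx_eq big1 ?addr0// => k _; rewrite d0 mulr0 !mul0r. Qed.

Lemma degenerate_approx_tail n p : approx_tail c lam d w0 w v eta p n = w0.
Proof. by rewrite /approx_tail big1 ?addr0// => k _; rewrite d0 mulr0 !mul0r mulr0 mul0r. Qed.

End degenerate_case.

Lemma KYn2_ge0 (R : realType) (m : nat) (c eta : R) (lam d : 'I_m -> R) :
  (forall k, 0 < tq eta (lam k)) -> 0 <= KYn 2 c lam d eta.
Proof.
move=> q0; rewrite KYn2_sum//; apply: sumr_ge0 => k _.
by rewrite addr_ge0 ?tdelta_ge0// divr_ge0// sqr_ge0.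
Qed.

Lemma KYn2_eq0 (R : realType) (m : nat) (c eta : R) (lam d : 'I_m -> R) :
  (forall k, 0 < tq eta (lam k)) -> KYn 2 c lam d eta = 0 -> (forall k, lam k = 0) /\ (forall k, d k = 0).
Proof.
move=> q0; rewrite KYn2_sum// => /eqP.
rewrite psumr_eq0 => [/allP h|k _]; last first.
  by rewrite addr_ge0 ?tdelta_ge0// divr_ge0// sqr_ge0.
have H k : tbeta eta (lam k) ^+ 2 / 2 = 0 /\ tdelta eta (lam k) (d k) = 0.
  have := h k (mem_index_enum k); rewrite /= paddr_eq0 ?tdelta_ge0//; last by rewrite divr_ge0// sqr_ge0.
  by move=> /andP[/eqP ? /eqP ?].
split => k; have q1 := lt0r_neq0 (q0 k); have [h1 h2] := H k.
  move/eqP: h1; rewrite mulf_eq0 invr_eq0 pnatr_eq0 orbF expf_eq0/= /tbeta.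
  by rewrite !mulf_eq0 pnatr_eq0 invr_eq0 (negbTE q1) orbF => /eqP.
move/eqP: h2; rewrite tdeltaE// mulf_eq0 invr_eq0 expf_eq0 expf_eq0/= (negbTE q1) orbF.
by move=> /eqP.
Qed.

Theorem theorem5 (R : realType) (dT : measure_display) (T : measurableType dT)
  (P : probability T R) (m : nat) (Z : nat -> 'I_m -> {RV P >-> R})
  (c w0 : R) (lam d w : 'I_m -> R) (v eta : R) :
  mutually_independent (fun jk : nat * 'I_m => Z jk.1 jk.2) ->
  (forall j k, std_normal_rv (Z j k)) ->
  (forall k, 0 < 1 - 2 * lam k * eta) ->
  \sum_(k < m) ((lam k * (1 - 2 * lam k * eta) + d k ^+ 2 * (1 - lam k * eta) * eta)
                / (1 - 2 * lam k * eta) ^+ 2) = v - c ->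
  let Ybar := smean (Ycopy Z c lam d) in
  let Wbar := smean (Wcopy Z w0 w) in
  (exists C : R, exists N : nat, forall n : nat, (N <= n)%N ->
     exists L : R, cond_exp_at P (Wbar n) (Ybar n) v L /\
       `|L - approx_eq c lam d w0 w eta n| <= C / n%:R ^+ 2)
  /\
  (eta != 0 ->
   exists C : R, exists N : nat, forall n : nat, (N <= n)%N ->
     let oma := fine (P [set t | v <= Ybar n t]) in
     `|cond_exp P (Wbar n) [set t | v <= Ybar n t]
        - approx_tail c lam d w0 w v eta oma n|
       <= C * (phi (Num.sqrt n%:R * omegahat c lam d v eta)
               / (Num.sqrt n%:R * oma)) / n%:R ^+ 2).
Proof.
move=> indepZ normalZ q0 saddle Ybar Wbar.
have [K2|K2] : 0 < KYn 2 c lam d eta \/ KYn 2 c lam d eta = 0.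
  have := @KYn2_ge0 R m c eta lam d q0; rewrite le_eqVlt => /orP[/eqP <-|]; first by right.
  by left.
  split.
    exact: (regular_part1 w0 w indepZ normalZ q0 saddle erefl erefl erefl K2).
  exact: (regular_part2 w0 w indepZ normalZ q0 saddle erefl erefl erefl K2).
(* The saddlepoint equation now forces v = c, so every conditioning event is the whole space. Each
   corrective summand carries a factor d_k = 0, so both formulas reduce to [w0], the mean of
   [Wbar]. *)
have [lam0 d0] := KYn2_eq0 q0 K2.
have vc : v = c.
  apply/eqP; rewrite -subr_eq0 -saddle big1// => k _.
  by rewrite lam0 d0 expr0n/= !mul0r add0r mul0r.
split => [|eta0]; exists 0, 1%N => n n0.
  exists w0; rewrite degenerate_approx_eq// subrr normr0 mul0r; split => //.
  apply: cvg_near_cst; near=> h; rewrite -[RHS](@degenerate_cond_exp _ _ _ P m Z w0 lam d w indepZ normalZ n n0).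
  congr cond_exp; apply/seteqP; split => // x _ /=.
  rewrite /Ybar degenerate_mean// vc subrr normr0.
  by near: h; exact: nbhs_right_ge.
rewrite /= degenerate_approx_tail//.
have -> : [set t | v <= Ybar n t] = setT.
  by apply/seteqP; split => // x _ /=; rewrite /Ybar degenerate_mean// vc.
by rewrite (@degenerate_cond_exp _ _ _ P m Z w0 lam d w indepZ normalZ n n0) subrr normr0 !mul0r.
Unshelve. all: by end_near. Qed.
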